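(* Suppose $\epsilon_n\to0$ ($\epsilon_n\ge0$) and $\{W_i\}$ is an i.i.d. sequence of $\mathcal{W}$-valued random variables with law $\lambda_0$. Let $\mathcal{N}^{\epsilon_n}_n$ denote the set of empirical distributions $\frac1n\sum_{i=1}^n\delta_{(W_i,x_i)}$ over all $\epsilon_n$-Nash equilibria $(x_1,\dots,x_n)$ with type vector $(W_1,\dots,W_n)$. Then $\{\mathcal{N}^{\epsilon_n}_n\}$ satisfies a large deviation principle on $\mathfrak{C}$ (with the upper Vietoris topology) with good rate function $$J(A)=\inf\{H(\lambda|\lambda_0):\lambda\in\mathcal{P}(\mathcal{W}),\ \mathcal{M}(\lambda)=A\}.$$
   Context: Standing assumptions: $\mathcal{X}$ compact metric space, $\mathcal{W}$ complete separable metric space; $\mathcal{P}(S)$ = Borel probability measures on $S$ with the weak topology. $\mathcal{C}$ maps $w$ to a nonempty closed $\mathcal{C}(w)\subset\mathcal{X}$, continuous in the sense that $\mathrm{Gr}(\mathcal{C})=\{(w,x):x\in\mathcal{C}(w)\}$ is closed and whenever $w_n\to w$, $x\in\mathcal{C}(w)$ there exist $n_k$, $x_{n_k}\in\mathcal{C}(w_{n_k})$ with $x_{n_k}\to x$. $F:\mathcal{P}(\mathcal{W}\times\mathcal{X})\times\mathcal{W}\times\mathcal{X}\to\mathbb{R}$ bounded continuous. For $\epsilon\ge0$, an $\epsilon$-Nash equilibrium with type vector $(w_1,\dots,w_n)$ is $(x_1,\dots,x_n)$ with $x_i\in\mathcal{C}(w_i)$ and, with $m=\frac1n\sum_k\delta_{(w_k,x_k)}$,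 $F(m,w_i,x_i)-\inf_{y\in\mathcal{C}(w_i)}F(m+\frac1n(\delta_{(w_i,y)}-\delta_{(w_i,x_i)}),w_i,y)\le\epsilon$ for all $i$; (exact, $\epsilon=0$) Nash equilibria are assumed to exist for all $n$ and type vectors. These sets of empirical distributions are closed. $\mathcal{M}(\lambda)$ = (closed) set of $m\in\mathcal{P}(\mathcal{W}\times\mathcal{X})$ with first marginal $\lambda$ such that for $m$-a.e. $(w,x)$, $x\in\mathcal{C}(w)$ and $F(m,w,x)=\inf_{y\in\mathcal{C}(w)}F(m,w,y)$. $\mathfrak{C}$ = closed subsets of $\mathcal{P}(\mathcal{W}\times\mathcal{X})$, with upper Vietoris topology generated by the base $\{A\in\mathfrak{C}:A\subset E\}$, $E$ open. $H$ = relative entropy. An LDP with good rate function $I$ means: sublevel sets of $I$ compact, $\limsup\frac1n\log\mathbb{P}(\cdot\in\mathfrak{U})\le-\inf_{\overline{\mathfrak{U}}}I$ and $\liminf\frac1n\log\mathbb{P}(\cdot\in\mathfrak{U})\ge-\inf_{\mathfrak{U}^\circ}I$ for Borel $\mathfrak{U}$. *)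

(* Defs.v *)
From HB Require Import structures.
From mathcomp Require Import all_boot all_order all_algebra.
From mathcomp Require Import all_classical all_reals all_analysis.

Set Implicit Arguments.
Unset Strict Implicit.
Unset Printing Implicit Defensive.

Import Order.TTheory GRing.Theory Num.Theory.
Import numFieldNormedType.Exports.

Local Open Scope classical_set_scope.
Local Open Scope ring_scope.

(* make the product of two pointed topological spaces a ptopologicalType *)
HB.saturate prod.

Definition borel (T : ptopologicalType) : Type := g_sigma_algebraType (@open T).

Definition bounded_continuous (T : topologicalType) (R : realType) (f : T -> R) :=
  continuous f /\ exists M : R, forall x, `|f x| <= M.

Definition pint (T : ptopologicalType) (R : realType)
  (m : probability (borel T) R) (f : T -> R) : R :=
  fine (\int[m]_x (f x)%:E)%E.

(** * P(T) with the weak topology: the coarsest topology making every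
    m |-> \int f dm (f bounded continuous) continuous, i.e. the topology
    generated by the subbase { m | \int f dm \in U }, f bounded continuous,
    U open in R. *)
Definition weakP (T : ptopologicalType) (R : realType) : Type :=
  probability (borel T) R.

HB.instance Definition _ (T : ptopologicalType) (R : realType) :=
  Choice.on (weakP T R).
HB.instance Definition _ (T : ptopologicalType) (R : realType) :=
  Pointed.on (weakP T R).
HB.instance Definition _ (T : ptopologicalType) (R : realType) :=
  @isSubBaseTopological.Build (weakP T R) ((T -> R) * set R)%type
    [set fU | bounded_continuous fU.1 /\ open fU.2]
    (fun fU => [set m : weakP T R | fU.2 (pint m fU.1)]).

Record closedSet (T : topologicalType) := ClosedSet {
  cs_set : set T ;
  cs_closed : closed cs_set }.

HB.instance Definition _ (T : topologicalType) :=
  gen_eqMixin (closedSet T).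
HB.instance Definition _ (T : topologicalType) :=
  gen_choiceMixin (closedSet T).
HB.instance Definition _ (T : topologicalType) :=
  isPointed.Build (closedSet T) (@ClosedSet T setT closedT).
HB.instance Definition _ (T : topologicalType) :=
  @isSubBaseTopological.Build (closedSet T) (set T) (@open T)
    (fun E => [set A : closedSet T | cs_set A `<=` E]).

(** * Relative entropy H(l | l0): \int f ln f dl0 if l has a density f
    w.r.t. l0 (l << l0), +oo otherwise (with 0 ln 0 = 0). *)
Definition density_of d (T : measurableType d) (R : realType)
  (l l0 : probability T R) (f : T -> R) :=
  measurable_fun setT f /\ (forall x, 0 <= f x) /\
  forall A, measurable A -> l A = (\int[l0]_(x in A) (f x)%:E)%E.

Definition relative_entropy d (T : measurableType d) (R : realType)
  (l l0 : probability T R) : \bar R :=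
  match pselect (exists f, density_of l l0 f) with
  | left H => let f := proj1_sig (cid H) in (\int[l0]_x (f x * ln (f x))%:E)%E
  | right _ => +oo%E
  end.

Definition LDP d (Omega : measurableType d) (R : realType) (P : probability Omega R)
  (S : ptopologicalType) (Z : nat -> Omega -> S) (I : S -> \bar R) : Prop :=
  [/\ (forall a : R, compact [set s | (I s <= a%:E)%E]),
      (forall n, measurable_fun setT (Z n : Omega -> borel S)),
      (forall U : set (borel S), measurable U ->
         (limn_esup (fun n => (n%:R^-1)%:E * lne (P (Z n @^-1` U)))
           <= - ereal_inf (I @` closure U))%E) &
      (forall U : set (borel S), measurable U ->
         (- ereal_inf (I @` interior U)
           <= limn_einf (fun n => (n%:R^-1)%:E * lne (P (Z n @^-1` U))))%E)].

Definition iid_law d (Omega : measurableType d) (R : realType) (P : probability Omega R)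
  (V : ptopologicalType) (Y : nat -> Omega -> V) (l0 : probability (borel V) R) : Prop :=
  [/\ (forall i, measurable_fun setT (Y i : Omega -> borel V)),
      (forall i (A : set (borel V)), measurable A -> P (Y i @^-1` A) = l0 A) &
      (forall (J : seq nat) (A : nat -> set (borel V)), uniq J ->
         (forall j, measurable (A j)) ->
         P (\bigcap_(j in [set j | j \in J]) (Y j @^-1` A j)) =
         (\prod_(j <- J) P (Y j @^-1` A j))%E)].

(** * Empirical measure (1/n) sum_i delta_{z_i} (for n >= 1) *)
Definition empirical (T : ptopologicalType) (R : realType) n (z : 'I_n -> T) :
  weakP T R :=
  mnormalize (msum (fun k : nat => match insub k with
                                   | Some i => @dirac _ (borel T) (z i) R
                                   | None => mzero end) n) point.

Definition eps_nash (R : realType) (W X : ptopologicalType)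
  (C : W -> set X) (F : weakP (W * X)%type R -> W -> X -> R)
  (n : nat) (eps : R) (w : 'I_n -> W) (x : 'I_n -> X) : Prop :=
  (forall i, C (w i) (x i)) /\
  forall i,
    F (empirical R (fun j => (w j, x j))) (w i) (x i)
    - inf [set F (empirical R (fun j => (w j, if j == i then y else x j))) (w i) y
          | y in C (w i)] <= eps.

Definition nash_set (R : realType) (W X : ptopologicalType)
  (C : W -> set X) (F : weakP (W * X)%type R -> W -> X -> R)
  (n : nat) (eps : R) (w : 'I_n -> W) : set (weakP (W * X)%type R) :=
  [set empirical R (fun j => (w j, x j)) | x in [set x | eps_nash C F eps w x]].

(** The random closed set N_n^{eps}. The set above is closed (see the
    paper); taking its closure only serves to package it as a closed set. *)
Definition nash_random_set d (Omega : measurableType d) (R : realType)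
  (W X : ptopologicalType)
  (C : W -> set X) (F : weakP (W * X)%type R -> W -> X -> R)
  (eps : nat -> R) (Y : nat -> Omega -> W) (n : nat) (o : Omega) :
  closedSet (weakP (W * X)%type R) :=
  @ClosedSet _ (closure (nash_set C F (eps n) (fun i : 'I_n => Y (nat_of_ord i) o)))
    (@closed_closure _ _).

Definition MFE (R : realType) (W X : ptopologicalType)
  (C : W -> set X) (F : weakP (W * X)%type R -> W -> X -> R)
  (l : probability (borel W) R) : set (weakP (W * X)%type R) :=
  [set m : weakP (W * X)%type R | (forall A : set (borel W), measurable A ->
              m ((@fst W X) @^-1` A) = l A) /\
           {ae m, forall z : borel (W * X)%type,
              C z.1 z.2 /\ F m z.1 z.2 = inf [set F m z.1 y | y in C z.1]}].

Definition rateJ (R : realType) (W X : ptopologicalType)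
  (C : W -> set X) (F : weakP (W * X)%type R -> W -> X -> R)
  (l0 : probability (borel W) R) (A : closedSet (weakP (W * X)%type R)) : \bar R :=
  ereal_inf [set relative_entropy l l0 | l in [set l | MFE C F l = cs_set A]].

(* Main.v *)
(* The map sending [l] to MFE(l) is upper hemicontinuous, and so is its
   approximation by n-player equilibria: if MFE(l) lies in an open set E, then for
   n large every equilibrium measure whose type marginal is close to [l] lies in E.
   Indeed, by compactness of X, equilibrium measures with convergent type marginals
   have cluster points, and a type-action pair that is suboptimal in the limit has
   a neighbourhood without mass along the way. The statement is thus the
   contraction principle applied to Sanov's theorem for the empirical type measure.

   Sanov's theorem is bypassed: finitely many bounded continuous test functions are
   constant, up to an error, on the cells of a finite measurable partition, where
   the method of types gives the upper bound and a change of measure together with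
   Chebyshev's inequality gives the lower bound. Relative entropy enters through
   the Donsker-Varadhan inequality, which yields the compactness of its sublevel
   sets for setwise convergence. Ultrafilters replace sequences, since the space
   of closed sets is not Hausdorff. *)
Require Import Defs.
From HB Require Import structures.
From mathcomp Require Import all_boot all_order all_algebra.
From mathcomp Require Import all_classical all_reals all_analysis.
From mathcomp Require Import finmap measurable_realfun ring lra.
Import Order.TTheory GRing.Theory Num.Theory.
Import numFieldNormedType.Exports.
Local Open Scope classical_set_scope.
Local Open Scope ring_scope.

Set Implicit Arguments.
Unset Strict Implicit.
Unset Printing Implicit Defensive.

(** * Integrals of bounded functions and finite partitions *)
Section bounded_measurable.
Context d (T : measurableType d) (R : realType).
Implicit Types (m : probability T R) (f g : T -> R).

(** A finite measurable partition is represented by a colouring, a map [c] into a finite type with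
    measurable fibres. An empirical measure need not have a density with respect to [lambda0], so
    its own entropy may be [+oo]. It is therefore compared with the measure that has the same cell
    masses and a density constant on each cell: test functions nearly constant on cells hardly
    distinguish the two, and the entropy of the second is the finite sum that the method of types
    controls.

    Weak limits of joint measures come from Daniell's theorem rather than from tightness: the limit
    functional is countably additive because the first marginals converge to a measure and the
    fibres over [W] are compact.

    Two notions are phrased so as to survive limits. Suboptimality is a strictly profitable
    deviation, an open condition, instead of an inequality with an infimum. Nullity of an open set
    is the vanishing of test integrals, which passes to weak limits. *)

Definition bmf f := measurable_fun setT f /\ exists M : R, forall x, `|f x| <= M.

Lemma bmf_integrable m f : bmf f -> m.-integrable setT (EFin \o f).
Proof.
move=> [mf [M fM]]; apply: measurable_bounded_integrable => //.
  by rewrite [ltLHS](_ : _ = 1%E) ?ltry//; exact: probability_setT.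
exists M; split; first exact: num_real.
by move=> x Mx y _; exact: le_trans (fM y) (ltW Mx).
Qed.

Lemma bmf_cst r : bmf (fun=> r).
Proof. by split; [exact: measurable_cst|exists `|r|]. Qed.

Lemma bmfD f g : bmf f -> bmf g -> bmf (fun x => f x + g x).
Proof.
move=> [mf [M fM]] [mg [N gN]]; split; first exact: measurable_funD.
by exists (M + N) => x; rewrite (le_trans (ler_normD _ _))// lerD.
Qed.

Lemma bmfZ r f : bmf f -> bmf (fun x => r * f x).
Proof.
move=> [mf [M fM]]; split; first exact: measurable_funM.
by exists (`|r| * M) => x; rewrite normrM ler_wpM2l.
Qed.

Lemma bmfN f : bmf f -> bmf (fun x => - f x).
Proof.
move=> [mf [M fM]]; split; first exact: measurableT_comp.
by exists M => x; rewrite normrN.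
Qed.

Lemma bmfB f g : bmf f -> bmf g -> bmf (fun x => f x - g x).
Proof. by move=> bf bg; apply: bmfD => //; exact: bmfN. Qed.

Lemma bmf_sum I (s : seq I) (F : I -> T -> R) :
  (forall i, bmf (F i)) -> bmf (fun x => \sum_(i <- s) F i x).
Proof.
move=> bF; elim: s => [|i s ih].
  by under eq_fun do rewrite big_nil; exact: bmf_cst.
by under eq_fun do rewrite big_cons; exact: bmfD.
Qed.

Lemma bmf_indic A : measurable A -> bmf (\1_A : T -> R).
Proof.
move=> mA; split; first exact: measurable_indic.
by exists 1 => x; rewrite indicE; case: (x \in A); rewrite /= ?normr1 ?normr0.
Qed.

Lemma bintD m f g : bmf f -> bmf g ->
  \int[m]_x (f x + g x) = \int[m]_x f x + \int[m]_x g x.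
Proof. by move=> *; rewrite RintegralD//; exact: bmf_integrable. Qed.

Lemma bintB m f g : bmf f -> bmf g ->
  \int[m]_x (f x - g x) = \int[m]_x f x - \int[m]_x g x.
Proof. by move=> *; rewrite RintegralB//; exact: bmf_integrable. Qed.

Lemma bintZ m r f : bmf f -> \int[m]_x (r * f x) = r * \int[m]_x f x.
Proof. by move=> *; rewrite RintegralZl//; exact: bmf_integrable. Qed.

Lemma bint_cst m r : \int[m]_x (r : R) = r.
Proof. by rewrite Rintegral_cst// [X in fine X](_ : _ = 1%E) ?mulr1//; exact: probability_setT. Qed.

Lemma le_bint m f g : bmf f -> bmf g -> (forall x, f x <= g x) ->
  \int[m]_x f x <= \int[m]_x g x.
Proof. by move=> *; apply: le_Rintegral => //; exact: bmf_integrable. Qed.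

Lemma bint_sum m I (s : seq I) (F : I -> T -> R) : (forall i, bmf (F i)) ->
  \int[m]_x (\sum_(i <- s) F i x) = \sum_(i <- s) \int[m]_x F i x.
Proof.
move=> bF; elim: s => [|i s ih].
  under [in LHS]eq_Rintegral do rewrite big_nil.
  by rewrite big_nil bint_cst.
under [in LHS]eq_Rintegral do rewrite big_cons.
by rewrite bintD// ?ih ?big_cons//; exact: bmf_sum.
Qed.

Lemma bint_indic m A : measurable A -> \int[m]_x (\1_A x : R) = fine (m A).
Proof. by move=> mA; rewrite /Rintegral integral_indic// setIT. Qed.

Lemma EFin_bint m f : bmf f -> (\int[m]_x f x)%:E = (\int[m]_x (f x)%:E)%E.
Proof.
move=> bf; rewrite /Rintegral fineK//.
by apply: integrable_fin_num => //; exact: bmf_integrable.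
Qed.

Lemma bint_norm_le m f M : measurable_fun setT f -> (forall x, `|f x| <= M) ->
  `|\int[m]_x f x| <= M.
Proof.
move=> mf fM; have bf : bmf f by split=> //; exists M.
rewrite ler_norml -[X in - X <= _ <= X](bint_cst m) -mulN1r -bintZ; last exact: bmf_cst.
apply/andP; split; apply: le_bint => //.
- exact/bmfZ/bmf_cst.
- by move=> x; rewrite mulN1r; have := fM x; rewrite ler_norml => /andP[].
- exact: bmf_cst.
- by move=> x; have := fM x; rewrite ler_norml => /andP[].
Qed.

Lemma bint_close m f g e : bmf f -> bmf g -> (forall x, `|f x - g x| <= e) ->
  `|\int[m]_x f x - \int[m]_x g x| <= e.
Proof.
move=> bf bg fg; rewrite -bintB//; apply: bint_norm_le => //.
by have [] := bmfB bf bg.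
Qed.

(** The error [e] is paid once under each measure; in the applications [g] is constant on the cells
    of a partition. *)
Lemma bint_close2 m m' f g e : bmf f -> bmf g -> (forall x, `|f x - g x| <= e) ->
  `|\int[m]_x f x - \int[m']_x f x| <= 2 * e + `|\int[m]_x g x - \int[m']_x g x|.
Proof.
move=> bf bg fg; have := bint_close m bf bg fg; have := bint_close m' bf bg fg.
have := ler_norm (\int[m]_x g x - \int[m']_x g x).
have := ler_norm (- (\int[m]_x g x - \int[m']_x g x)).
by rewrite normrN !ler_norml; lra.
Qed.

Lemma coloring_repr (F : Type) (c : T -> F) f e :
  (forall x y, c x = c y -> `|f x - f y| <= e) ->
  exists r : F -> R, forall x, `|f x - r (c x)| <= e.
Proof.
move=> cP.
have /choice[r rP] : forall t, exists a, forall x, c x = t -> `|f x - a| <= e.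
  move=> t; have [[y cy]|nt] := pselect (exists y, c y = t).
    by exists (f y) => x cx; apply: cP; rewrite cx.
  by exists 0 => x cx; exfalso; apply: nt; exists x.
by exists r => x; exact: rP.
Qed.

Section coloring.
Context (F : finType) (c : T -> F).
Hypothesis mc : forall t, measurable (c @^-1` [set t]).

Lemma coloring_sumE (r : F -> R) x : r (c x) = \sum_t r t * \1_(c @^-1` [set t]) x.
Proof.
rewrite (bigD1 (c x))//= indicE mem_set// mulr1 big1 ?addr0// => t tx.
by rewrite indicE memNset ?mulr0//= => ctx; move: tx; rewrite ctx eqxx.
Qed.

Lemma bmf_coloring (r : F -> R) : bmf (fun x => r (c x)).
Proof.
under eq_fun do rewrite coloring_sumE.
by apply: bmf_sum => t; apply: bmfZ; exact: bmf_indic.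
Qed.

Lemma bint_coloring m (r : F -> R) :
  \int[m]_x r (c x) = \sum_t r t * fine (m (c @^-1` [set t])).
Proof.
under eq_Rintegral do rewrite coloring_sumE.
rewrite bint_sum//; last by move=> t; apply: bmfZ; exact: bmf_indic.
by apply: eq_bigr => t _; rewrite bintZ ?bint_indic//; exact: bmf_indic.
Qed.

Lemma coloring_mass m : \sum_t fine (m (c @^-1` [set t])) = 1.
Proof.
rewrite -(bint_cst m 1) (bint_coloring m (fun=> 1)).
by apply: eq_bigr => t _; rewrite mul1r.
Qed.

End coloring.

(** The colour of [x] is the index of the interval of length [e] containing [f x + M], so the fibres
    are preimages of half-open intervals. *)
Lemma exists_coloring1 f e : bmf f -> 0 < e ->
  exists (F : finType) (c : T -> F), (forall t, measurable (c @^-1` [set t])) /\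
    forall x y, c x = c y -> `|f x - f y| <= e.
Proof.
move=> [mf [M fM]] e0.
pose k x := Num.truncn ((f x + M) / e).
have fM0 x : 0 <= (f x + M) / e.
  by rewrite divr_ge0 ?(ltW e0)//; have := fM x; rewrite ler_norml; lra.
have kP x : (k x)%:R <= (f x + M) / e < (k x).+1%:R by exact: truncn_itv.
pose N := Num.truncn ((M + M) / e).
have kN x : (k x < N.+1)%N.
  rewrite ltnS /k /N; apply: le_truncn; rewrite ler_pM2r ?invr_gt0// lerD2r.
  exact: le_trans (ler_norm _) (fM x).
exists 'I_N.+1, (fun x => Ordinal (kN x)); split => [t|x y [kxy]].
  rewrite (_ : _ @^-1` _ = f @^-1` `[t%:R * e - M, t.+1%:R * e - M[).
    by rewrite -[X in measurable X]setTI; exact: mf.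
  apply/seteqP; split => [x [<-]/=|x /=].
    have /andP[] := kP x; rewrite ler_pdivlMr// ltr_pdivrMr//= in_itv/=; lra.
  rewrite in_itv/= => /andP[h1 h2]; apply: val_inj => /=.
  apply/eqP; rewrite truncn_eq// ler_pdivlMr// ltr_pdivrMr//; lra.
have /andP[] := kP x; have /andP[] := kP y; rewrite kxy -natr1.
rewrite !ler_pdivlMr// !ltr_pdivrMr// => *; rewrite ler_norml; lra.
Qed.

(** Pairing colours forms the common refinement of the partitions. *)
Lemma exists_coloring (s : seq (T -> R)) e : (forall f, List.In f s -> bmf f) -> 0 < e ->
  exists (F : finType) (c : T -> F), (forall t, measurable (c @^-1` [set t])) /\
    forall f, List.In f s -> forall x y, c x = c y -> `|f x - f y| <= e.
Proof.
move=> + e0; elim: s => [_|f s ih bs].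
  exists unit, (fun=> tt); split => [[]|//].
  by rewrite (_ : _ @^-1` _ = setT)//; apply/seteqP; split.
have [|F [c [mc cP]]] := ih; first by move=> g gs; apply: bs; right.
have [|F' [c' [mc' c'P]]] := @exists_coloring1 f e _ e0; first by apply: bs; left.
exists (F * F')%type, (fun x => (c x, c' x)); split => [[t t']|g gs x y [cxy c'xy]].
  rewrite (_ : _ @^-1` _ = c @^-1` [set t] `&` c' @^-1` [set t']).
    exact: measurableI.
  by apply/seteqP; split => [x [<- <-]|x [/= -> ->]].
by case: gs => [<-|gs]; [exact: c'P|exact: cP].
Qed.

End bounded_measurable.

(** * Limits under the integral sign *)

Section bounded_convergence.
Context d (T : measurableType d) (R : realType) (m : probability T R).

Lemma bint_cvg (f_ : nat -> T -> R) (f : T -> R) (M : R) :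
  (forall n, measurable_fun setT (f_ n)) -> measurable_fun setT f ->
  (forall n x, `|f_ n x| <= M) ->
  (forall x, f_ ^~ x @ \oo --> f x) ->
  (fun n => \int[m]_x f_ n x) @ \oo --> \int[m]_x f x.
Proof.
move=> mf_ mf fM cf.
have fM' x : `|f x| <= M.
  have /cvg_lim <- // : (fun n => `|f_ n x|) @ \oo --> `|f x| by exact: cvg_norm.
  apply: limr_le; first by apply/cvg_ex; exists `|f x|; exact: cvg_norm.
  exact: nearW.
have [] := @dominated_convergence _ _ _ m setT measurableT (fun n x => (f_ n x)%:E)
  (fun x => (f x)%:E) (fun=> M%:E).
- by move=> n; exact/measurable_EFinP.
- exact/measurable_EFinP.
- by apply: aeW => x _; apply: cvg_EFin; [exact: nearW|exact: cf].
- exact: (bmf_integrable m (bmf_cst _ M)).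
- by apply: aeW => x n _ /=; rewrite lee_fin.
move=> _ _ h.
have bf : bmf f by split=> //; exists M.
by apply: fine_cvg; rewrite -/(Rintegral m setT f) EFin_bint.
Qed.

Lemma fine_probability_cvg0 (A : nat -> set T) :
  (forall n, measurable (A n)) -> (forall n, A n.+1 `<=` A n) ->
  \bigcap_n A n = set0 -> fine (m (A n)) @[n --> \oo] --> 0.
Proof.
move=> mA dA A0.
have dA' i j : (i <= j)%N -> A j `<=` A i.
  elim: j => [|j ih]; first by rewrite leqn0 => /eqP ->.
  rewrite leq_eqVlt => /predU1P[->//|]; rewrite ltnS => /ih h.
  exact: subset_trans (dA j) h.
rewrite (_ : (fun n => _) = (fun n => \int[m]_x (\1_(A n) x : R))); last first.
  by apply/funext => n; rewrite bint_indic.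
rewrite -[X in _ --> X](bint_cst m 0).
apply: (@bint_cvg (fun n => \1_(A n)) (fun=> 0) 1).
- by move=> n; exact: measurable_indic.
- exact: measurable_cst.
- by move=> n x; rewrite indicE; case: (x \in A n); rewrite /= ?normr1 ?normr0.
- move=> x; have [n nAx] : exists n, ~ A n x.
    apply: contrapT => h; have : set0 x by rewrite -A0 => n _; apply: contrapT => ?; apply: h; exists n.
    by [].
  apply: cvg_near_cst; exists n => // k /= nk.
  by rewrite indicE memNset// => /(dA' _ _ nk).
Qed.

End bounded_convergence.

(** * The weak topology *)
Section weak_topology.
Context (T : ptopologicalType) (R : realType).
Implicit Types (f g : T -> R) (m : weakP T R).

Lemma open_borel (U : set T) : open U -> measurable (U : set (borel T)).
Proof. by move=> oU; exact: sub_sigma_algebra. Qed.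

Lemma continuous_measurable_borel f : continuous f ->
  measurable_fun setT (f : borel T -> R).
Proof.
move=> /continuousP cf; apply: (measurability _ (RGenOpens.measurableE R)).
move=> _ [_ [a [b ->] <-]]; rewrite setTI; apply: open_borel.
exact/cf/interval_open.
Qed.

Lemma bc_bmf f : bounded_continuous f -> bmf (f : borel T -> R).
Proof. by move=> [cf bf]; split => //; exact: continuous_measurable_borel. Qed.

Lemma bc_cst (r : R) : bounded_continuous (fun _ : T => r).
Proof. by split; [exact: cst_continuous|exists `|r|]. Qed.

Lemma bcD f g : bounded_continuous f -> bounded_continuous g ->
  bounded_continuous (fun x => f x + g x).
Proof.
move=> bf bg; split; last by have [] := bmfD (bc_bmf bf) (bc_bmf bg).
by move=> x; apply: (@continuousD _ R^o); [exact: bf.1|exact: bg.1].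
Qed.

Lemma bcZ r f : bounded_continuous f -> bounded_continuous (fun x => r * f x).
Proof.
move=> bf; split; last by have [] := bmfZ r (bc_bmf bf).
by move=> x; apply: continuousM; [exact: cst_continuous|exact: bf.1].
Qed.

Lemma bcB f g : bounded_continuous f -> bounded_continuous g ->
  bounded_continuous (fun x => f x - g x).
Proof.
move=> bf bg; split; last by have [] := bmfB (bc_bmf bf) (bc_bmf bg).
by move=> x; apply: (@continuousB _ R^o); [exact: bf.1|exact: bg.1].
Qed.

Lemma bc_sum I (s : seq I) (F : I -> T -> R) :
  (forall i, bounded_continuous (F i)) ->
  bounded_continuous (fun x => \sum_(i <- s) F i x).
Proof.
move=> bF; elim: s => [|i s ih].
  by under eq_fun do rewrite big_nil; exact: bc_cst.
by under eq_fun do rewrite big_cons; exact: bcD.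
Qed.

Lemma bc_max f g : bounded_continuous f -> bounded_continuous g ->
  bounded_continuous (fun x => Num.max (f x) (g x)).
Proof.
move=> [cf [M fM]] [cg [N gN]]; split.
  by move=> x; apply: continuous_max; [exact: cf|exact: cg].
exists (M + N) => x; have := fM x; have := gN x; rewrite !ler_norml.
by rewrite /Num.max; case: ifP => _; lra.
Qed.

Lemma bc_min f g : bounded_continuous f -> bounded_continuous g ->
  bounded_continuous (fun x => Num.min (f x) (g x)).
Proof.
move=> [cf [M fM]] [cg [N gN]]; split.
  by move=> x; apply: continuous_min; [exact: cf|exact: cg].
exists (M + N) => x; have := fM x; have := gN x; rewrite !ler_norml.
by rewrite /Num.min; case: ifP => _; lra.
Qed.

Lemma pintD m f g : bounded_continuous f -> bounded_continuous g ->
  pint m (fun x => f x + g x) = pint m f + pint m g.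
Proof. by move=> /bc_bmf bf /bc_bmf bg; exact: (bintD m bf bg). Qed.

Lemma pintB m f g : bounded_continuous f -> bounded_continuous g ->
  pint m (fun x => f x - g x) = pint m f - pint m g.
Proof. by move=> /bc_bmf bf /bc_bmf bg; exact: (bintB m bf bg). Qed.

Lemma pintZ m r f : bounded_continuous f ->
  pint m (fun x => r * f x) = r * pint m f.
Proof. by move=> /bc_bmf bf; exact: (bintZ m r bf). Qed.

Lemma pint_cst m r : pint m (fun=> r) = r.
Proof. exact: (bint_cst m r). Qed.

Lemma le_pint m f g : bounded_continuous f -> bounded_continuous g ->
  (forall x, f x <= g x) -> pint m f <= pint m g.
Proof. by move=> /bc_bmf bf /bc_bmf bg; exact: (le_bint m bf bg). Qed.

Lemma pint_norm_le m f (M : R) : continuous f -> (forall x, `|f x| <= M) -> `|pint m f| <= M.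
Proof. by move=> /continuous_measurable_borel; exact: (bint_norm_le m). Qed.

Lemma pint_subbase_open f (U : set R) : bounded_continuous f -> open U ->
  open [set m : weakP T R | U (pint m f)].
Proof.
move=> bf oU; exists [set [set m : weakP T R | U (pint m f)]]; last by rewrite bigcup_set1.
move=> _ ->; exists [fset (f, U)]%fset.
  by move=> fU; rewrite in_fset1 => /eqP ->; apply/mem_set.
apply/seteqP; split=> [m h|m Um fU]; last by rewrite /= in_fset1 => /eqP ->.
exact: (h (f, U) (fset11 _)).
Qed.

(** A neighbourhood contains a finite intersection of subbasic sets, and each of these constrains a
    single test integral. *)
Lemma weakP_cvgP (F : set_system (weakP T R)) m : Filter F ->
  F --> m <-> forall f, bounded_continuous f -> pint m' f @[m' --> F] --> pint m f.
Proof.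
move=> FF; split=> [Fm f bf U|h A].
  rewrite /= nbhsE => -[V [oV Vm] VU].
  rewrite /fmap /=; apply: filterS (_ : F [set m' : weakP T R | V (pint m' f)]); first by move=> ?; exact: VU.
  by apply: Fm; exists [set m' : weakP T R | V (pint m' f)] => //; split => //; exact: pint_subbase_open.
rewrite (@nbhsE (weakP T R)) => -[_ [[B sB <-] [C BC Ct] sUBA]].
apply: filterS sUBA _; apply: (@filterS _ _ _ C); first by move=> ? ?; exists C.
have /sB [D sD IDeC] := BC; rewrite -IDeC; apply: filter_bigI => E DE.
have /set_mem[bE oE] := sD _ DE; apply: (h _ bE).
by apply: open_nbhs_nbhs; split => //; move: Ct; rewrite -IDeC => /(_ _ DE).
Qed.

Lemma pint_continuous f : bounded_continuous f -> continuous (fun m => pint m f).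
Proof. by move=> bf m; have /weakP_cvgP := @cvg_id _ (nbhs m); apply. Qed.

Definition pint_close (s : seq (T -> R)) (e : R) m : set (weakP T R) :=
  [set m' | forall f, List.In f s -> `|pint m' f - pint m f| < e].

(** The sets [pint_close s e m] form a filter base. Its filter converges to [m] by the test-function
    criterion, so every neighbourhood contains one of them. *)
Lemma weakP_nbhs_pint_close m A : nbhs m A ->
  exists s e, [/\ forall f, List.In f s -> bounded_continuous f, 0 < e & pint_close s e m `<=` A].
Proof.
pose B := [set se : seq (T -> R) * R |
  (forall f, List.In f se.1 -> bounded_continuous f) /\ 0 < se.2].
pose F := filter_from B (fun se => pint_close se.1 se.2 m).
have FF : Filter F.
  apply: filter_from_filter; first by exists ([::], 1); split.
  move=> [s e] [s' e'] [bs e0] [bs' e0']; exists (s ++ s', Num.min e e').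
    split; last by rewrite lt_min e0.
    by move=> f /List.in_app_iff[]; [exact: bs|exact: bs'].
  move=> m' h; split => f fs.
    by have := h f; rewrite lt_min => /(_ _)/andP[] //; apply/List.in_app_iff; left.
  by have := h f; rewrite lt_min => /(_ _)/andP[] //; apply/List.in_app_iff; right.
have /(weakP_cvgP _ FF) Fm : forall f, bounded_continuous f -> pint m' f @[m' --> F] --> pint m f.
  move=> f bf; apply/cvgrPdist_lt => e e0; exists ([:: f], e).
    by split => // _ [<-|[]].
  by move=> m' /= h; rewrite distrC; apply: h; left.
by move=> /Fm [[s e] [bs e0] sA]; exists s, e.
Qed.

Lemma pint_close_nbhs (s : seq (T -> R)) e m :
  (forall f, List.In f s -> bounded_continuous f) -> 0 < e -> nbhs m (pint_close s e m).
Proof.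
move=> bs e0; elim: s bs => [_|f s ih bs]; first by apply: filterS filterT => m' _ f [].
have h1 : nbhs m (pint_close s e m) by apply: ih => g gs; apply: bs; right.
have : \forall m' \near m, `|pint m f - pint m' f| < e.
  have /cvgrPdist_lt/(_ _ e0) := @pint_continuous f (bs _ (or_introl erefl)) m.
  by [].
move: h1; apply: filterS2 => m' h1 h2 g [<-|gs]; last exact: h1.
by rewrite distrC.
Qed.

(** Halving the radius suffices. Regularity serves to keep the closure of a compact set inside an
    open set. *)
Lemma weakP_regular m A : nbhs m A -> exists2 B, nbhs m B & closure B `<=` A.
Proof.
move=> /weakP_nbhs_pint_close[s [e [bs e0 sA]]].
exists (pint_close s (e / 2) m); first by apply: pint_close_nbhs => //; lra.
move=> m' cm'; apply: sA => f fs.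
have [|m'' [h1 h2]] := cm' (pint_close [:: f] (e / 2) m').
  by apply: pint_close_nbhs; [move=> g [<-|[]]; exact: bs|lra].
have := h1 f fs; have := h2 f (or_introl erefl).
rewrite !ltr_norml; lra.
Qed.

(** The form in which metrizability enters the measure theory: every open set is the set where some
    continuous function is positive. *)
Definition cozero_opens := forall U : set T, open U ->
  exists g : T -> R, [/\ continuous g, forall x, 0 <= g x <= 1 & forall x, U x <-> 0 < g x].

Hypothesis cozT : cozero_opens.

(** The functions [min 1 (n g)], with [g] positive exactly on [U], reach 1 at each point of [U]
    after finitely many steps. *)
Lemma open_bc_approx (U : set T) : open U ->
  exists h : nat -> T -> R, [/\ forall n, bounded_continuous (h n),
    forall n x, 0 <= h n x <= 1,
    forall n x, ~ U x -> h n x = 0,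
    forall n x, h n x <= h n.+1 x & forall x, U x -> \forall n \near \oo, h n x = 1].
Proof.
move=> /cozT[g [cg g01 Ug]].
have bg : bounded_continuous g.
  by split => //; exists 1 => x; have := g01 x; rewrite ler_norml; lra.
exists (fun n x => Num.min 1 (n%:R * g x)); split.
- by move=> n; apply: bc_min; [exact: bc_cst|exact: bcZ].
- move=> n x; have /andP[g0 _] := g01 x; rewrite le_min ler01 mulr_ge0//=.
  by rewrite ge_min lexx.
- move=> n x nU; have : ~ 0 < g x by move=> /Ug.
  have /andP[g0 _] := g01 x; rewrite lt_neqAle g0 andbT => /negP; rewrite negbK => /eqP <-.
  by rewrite mulr0 min_r.
- move=> n x; have /andP[g0 _] := g01 x; rewrite le_min ge_min lexx/= ge_min.
  by rewrite ler_wpM2r ?ler_nat// orbT.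
- move=> x /Ug g0; exists (Num.truncn (g x)^-1).+1 => // n /= hn.
  rewrite min_l// -ler_pdivrMr// mul1r ltW// (lt_le_trans (truncnS_gt _))//.
  by rewrite ler_nat.
Qed.

Lemma open_measure_cvg m (U : set T) (h : nat -> T -> R) : open U ->
  (forall n, bounded_continuous (h n)) -> (forall n x, 0 <= h n x <= 1) ->
  (forall n x, ~ U x -> h n x = 0) ->
  (forall x, U x -> \forall n \near \oo, h n x = 1) ->
  pint m (h n) @[n --> \oo] --> fine (m U).
Proof.
move=> oU bh h01 h0 h1; have mU := open_borel oU.
rewrite -(bint_indic m mU); apply: (@bint_cvg _ (borel T) R m h (\1_U) 1).
- by move=> n; apply: continuous_measurable_borel; exact: (bh n).1.
- exact: measurable_indic.
- by move=> n x; have := h01 n x; rewrite ler_norml; lra.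
move=> x; have [Ux|nUx] := pselect (U x).
  by rewrite indicE mem_set//; apply: cvg_near_cst; exact: h1.
by rewrite indicE memNset//; apply: cvg_near_cst; apply: nearW => n; rewrite h0.
Qed.

(** Test functions determine the mass of open sets by bounded convergence, and open sets are stable
    under intersection and generate the Borel sets. *)
Lemma pint_inj m m' : (forall f, bounded_continuous f -> pint m f = pint m' f) ->
  forall A : set (borel T), measurable A -> m A = m' A.
Proof.
move=> mm'.
have openE U : open U -> m U = m' U.
  move=> oU; have [h [bh h01 h0 _ h1]] := open_bc_approx oU.
  have c1 := open_measure_cvg (m := m) oU bh h01 h0 h1.
  have c2 := open_measure_cvg (m := m') oU bh h01 h0 h1.
  have : fine (m U) = fine (m' U).
    have e : (fun n => pint m (h n)) = (fun n => pint m' (h n)) by apply/funext => n; exact: mm'.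
    by rewrite e in c1; apply: (cvg_unique _ c1 c2).
  move=> e; rewrite -(@fineK _ (m U)) ?e ?fineK//; apply: fin_num_measure; exact: open_borel.
apply: (@measure_unique _ R (borel T) (@open T) (fun=> setT) _ _ _ _ m m') => //.
- exact: openI.
- by move=> _; exact: openT.
- by rewrite bigcup_const//; exists 0%N.
- by move=> _; rewrite [ltLHS](_ : _ = 1%E) ?ltry//; exact: probability_setT.
Qed.

End weak_topology.

(** The function is the distance to the complement, truncated at 1; the truncation also covers an
    empty complement, at distance [+oo]. *)
Lemma pseudometric_cozero (R : realType) (T : pseudoPMetricType R) : cozero_opens T R.
Proof.
move=> U oU.
pose g x := fine (Order.min (edist_inf (~` U) x) 1%:E).
have fin x : Order.min (edist_inf (~` U) x) 1%:E \is a fin_num.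
  rewrite ge0_fin_numE ?le_min ?edist_inf_ge0//=.
  by rewrite gt_min ltry orbT.
exists g; split.
- move=> x; apply: fine_cvg; rewrite /= fineK//.
  apply: (@continuous2_cvg _ _ _ _ _ _ (fun y => edist_inf (~` U) y) (fun=> 1%:E)
    (fun u v : \bar R => Order.min u v)).
  - exact: (@min_continuous _ (\bar R) (edist_inf (~` U) x, 1%:E)).
  - exact: edist_inf_continuous.
  - exact: cvg_cst.
- move=> x; rewrite /g fine_ge0 ?le_min ?edist_inf_ge0//=.
  by rewrite -lee_fin fineK// ge_min lexx orbT.
- move=> x; rewrite /g -lte_fin fineK// lt_min lte_fin ltr01 andbT.
  split=> [Ux|e0]; last first.
    by apply: contrapT => nUx; move: e0; rewrite edist_inf0 ?ltxx.
  have /nbhs_ballP[e /= e0 eU] := open_nbhs_nbhs (conj oU Ux).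
  apply: (@lt_le_trans _ _ e%:E); first by rewrite lte_fin.
  apply: le_ereal_inf_tmp => _ [y nUy <-]; rewrite leNgt; apply/negP.
  by move=> /edist_lt_ball /= /eU.
Qed.

Lemma exists_probability d (T : measurableType d) (R : realType) (mu : set T -> \bar R) :
  mu set0 = 0%E -> (forall A, 0 <= mu A)%E -> semi_sigma_additive mu -> mu setT = 1%E ->
  exists m : probability T R, forall A, m A = mu A.
Proof.
move=> mu0 mu_ge0 mu_add mu1.
pose mM := isMeasure.Build d T R mu mu0 mu_ge0 mu_add.
pose m : {measure set T -> \bar R} := HB.pack mu mM.
pose mP := Measure_isProbability.Build d T R m mu1.
pose p : probability T R := HB.pack mu mM mP.
by exists p.
Qed.

(** * Integrals against empirical measures *)

Section empirical_measure.
Context (T : ptopologicalType) (R : realType).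

(** The formula is obtained for nonnegative functions, then applied to [f + M]. The successor [n.+1]
    avoids the default value that [empirical] takes on an empty sample. *)
Lemma bint_empirical n (z : 'I_n.+1 -> T) (f : T -> R) : bmf (f : borel T -> R) ->
  \int[empirical R z]_x f x = n.+1%:R^-1 * \sum_i f (z i).
Proof.
move=> bf; have [mf [M fM]] := bf.
pose D (k : nat) : {measure set (borel T) -> \bar R} :=
  match insub k with Some i => @dirac _ (borel T) (z (i : 'I_n.+1)) R | None => mzero end.
pose S : {measure set (borel T) -> \bar R} := msum D n.+1.
have DE (i : 'I_n.+1) : D i = @dirac _ (borel T) (z i) R by rewrite /D valK.
have ST : S setT = n.+1%:R%:E.
  have -> : S setT = (\sum_(k < n.+1) D k setT)%E by [].
  rewrite (eq_bigr (fun=> 1%E)); last first.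
    by move=> i _; rewrite DE; exact: diracT.
  by rewrite sumEFin sumr_const card_ord.
have eE A : empirical R z A = (S A * (n.+1%:R^-1)%:E)%E.
  rewrite (_ : empirical R z A = mnormalize S point A)// /mnormalize ST/=.
  by rewrite eqe pnatr_eq0.
have n0 : 0 <= n.+1%:R^-1 :> R by rewrite invr_ge0.
have ge0 g : bmf (g : borel T -> R) -> (forall x, 0 <= g x) ->
    \int[empirical R z]_x g x = n.+1%:R^-1 * \sum_i g (z i).
  move=> [mg _] g0; rewrite /Rintegral.
  rewrite (@eq_measure_integral _ _ _ _ (mscale (NngNum n0) S)); last first.
    by move=> A mA _; rewrite [LHS]eE muleC.
  have mg' : measurable_fun setT (EFin \o (g : borel T -> R)) by exact/measurable_EFinP.
  rewrite ge0_integral_mscale//; last by move=> x _; rewrite lee_fin.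
  rewrite ge0_integral_measure_sum//; last by move=> x _; rewrite lee_fin.
  rewrite (eq_bigr (fun i => (g (z i))%:E)); last first.
    move=> i _; rewrite DE integral_dirac//.
    by rewrite [X in (X * _)%E](_ : _ = 1%E) ?mul1e//; exact: diracT.
  by rewrite sumEFin.
have bM : bmf (fun _ : borel T => M) by exact: bmf_cst.
have -> : \int[empirical R z]_x f x = \int[empirical R z]_x (f x + M) - M.
  by rewrite bintD// bint_cst addrK.
rewrite ge0; last 2 first.
- exact: bmfD.
- by move=> x; have := fM x; rewrite ler_norml; lra.
rewrite big_split/= sumr_const card_ord mulrDr -(mulr_natl M) mulrA.
by rewrite mulVf ?pnatr_eq0// mul1r addrK.
Qed.

Lemma pint_empirical n (z : 'I_n.+1 -> T) f : bounded_continuous f ->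
  pint (empirical R z) f = n.+1%:R^-1 * \sum_i f (z i).
Proof. by move=> /bc_bmf; exact: bint_empirical. Qed.

End empirical_measure.

(** * Daniell's representation theorem *)
Section daniell.
Context (T : ptopologicalType) (R : realType).
Hypothesis cozT : cozero_opens T R.
Variable L : (T -> R) -> R.
Hypothesis LD : forall f g, bounded_continuous f -> bounded_continuous g ->
  L (fun x => f x + g x) = L f + L g.
Hypothesis LZ : forall r f, bounded_continuous f -> L (fun x => r * f x) = r * L f.
Hypothesis L_le : forall f g, bounded_continuous f -> bounded_continuous g ->
  (forall x, f x <= g x) -> L f <= L g.
Hypothesis L1 : L (fun=> 1) = 1.
Hypothesis L_cvg0 : forall f_ : nat -> T -> R, (forall n, bounded_continuous (f_ n)) ->
  (forall n x, 0 <= f_ n.+1 x <= f_ n x) -> (forall x, f_ ^~ x @ \oo --> 0) ->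
  (fun n => L (f_ n)) @ \oo --> 0.

Local Notation bc := (@bounded_continuous T R).

Let L_cst r : L (fun=> r) = r.
Proof.
rewrite (_ : (fun=> r) = (fun x : T => r * 1)); last by apply/funext => x; rewrite mulr1.
by rewrite (LZ r (bc_cst T (1 : R))) L1 mulr1.
Qed.

Let LB f g : bc f -> bc g -> L (fun x => f x - g x) = L f - L g.
Proof.
move=> bf bg; rewrite -[in RHS]mulN1r -LZ// -LD//; last exact: bcZ.
by congr L; apply/funext => x; rewrite mulN1r.
Qed.

Let L_sum n (F : nat -> T -> R) : (forall i, bc (F i)) ->
  L (fun x => \sum_(0 <= i < n) F i x) = \sum_(0 <= i < n) L (F i).
Proof.
move=> bF; elim: n => [|n ih].
  by rewrite big_geq//; under eq_fun do rewrite big_geq//; rewrite L_cst.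
rewrite big_nat_recr//= -ih -LD//; last exact: bc_sum.
by congr L; apply/funext => x; rewrite big_nat_recr.
Qed.

Definition below (U : set T) : set (T -> R) :=
  [set f | [/\ bounded_continuous f, forall x, 0 <= f x <= 1 & forall x, ~ U x -> f x = 0]].

Let below0 U : below U (fun=> 0).
Proof. by split => [|x|//]; [exact: bc_cst|rewrite lexx ler01]. Qed.

Let belowS U V : U `<=` V -> below U `<=` below V.
Proof. by move=> UV f [bf f01 f0]; split => // x nVx; apply: f0 => /UV. Qed.

Let L_below U f : below U f -> 0 <= L f <= 1.
Proof.
move=> [bf f01 _]; rewrite -[X in X <= _ <= _](L_cst 0) -[X in _ <= _ <= X](L_cst 1).
by apply/andP; split; apply: L_le => //; try exact: bc_cst; move=> x;
  have /andP[] := f01 x.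
Qed.

(** Inner approximation of open sets by test functions, followed by outer approximation by open
    sets, as in the Riesz representation theorem. *)
Definition open_mass (U : set T) : \bar R := ereal_sup [set (L f)%:E | f in below U].

Definition outer_mass (A : set T) : \bar R :=
  ereal_inf [set open_mass U | U in [set U | open U /\ A `<=` U]].

Let le_open_mass U f : below U f -> ((L f)%:E <= open_mass U)%E.
Proof. by move=> Uf; apply: ereal_sup_ubound; exists f. Qed.

Let open_mass_ge0 U : (0 <= open_mass U)%E.
Proof. by have := le_open_mass (below0 U); rewrite L_cst. Qed.

Let open_mass_le1 U : (open_mass U <= 1)%E.
Proof.
apply: ge_ereal_sup => _ [f Uf <-]; rewrite lee_fin.
by have /andP[] := L_below Uf.
Qed.

Let open_massS U V : U `<=` V -> (open_mass U <= open_mass V)%E.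
Proof.
by move=> UV; apply: ge_ereal_sup => _ [f Uf <-]; apply: le_open_mass; exact: belowS Uf.
Qed.

Let outer_mass_open U : open U -> outer_mass U = open_mass U.
Proof.
move=> oU; apply/eqP; rewrite eq_le; apply/andP; split.
  by apply: ereal_inf_lbound; exists U => //; split.
by apply: le_ereal_inf_tmp => _ [V [oV UV] <-]; exact: open_massS.
Qed.

Let outer_mass_ge0 A : (0 <= outer_mass A)%E.
Proof. by apply: le_ereal_inf_tmp => _ [U _ <-]. Qed.

Let outer_massS : {homo outer_mass : A B / A `<=` B >-> (A <= B)%E}.
Proof.
move=> A B AB; apply: le_ereal_inf_tmp => _ [U [oU BU] <-].
by apply: ereal_inf_lbound; exists U => //; split => //; exact: subset_trans BU.
Qed.

Let outer_mass_le1 A : (outer_mass A <= 1)%E.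
Proof.
by rewrite (le_trans _ (open_mass_le1 setT))// -outer_mass_open ?outer_massS//; exact: openT.
Qed.

Let outer_mass0 : outer_mass set0 = 0%E.
Proof.
apply/eqP; rewrite eq_le outer_mass_ge0 andbT outer_mass_open; last exact: open0.
apply: ge_ereal_sup => _ [f [_ _ f0] <-]; rewrite lee_fin.
by rewrite (_ : f = fun=> 0) ?L_cst//; apply/funext => x; exact: f0.
Qed.

(** Let [f] be below the union. Subtracting from [f] the approximate indicators [h K k] of the sets
    [U k], [k < K], leaves a positive part that decreases to 0 pointwise. By [L_cvg0] its [L]-value
    tends to 0, which bounds [L f] by the sum of the masses. *)
Let open_mass_bigcup (U : nat -> set T) : (forall n, open (U n)) ->
  (open_mass (\bigcup_n U n) <= \sum_(n <oo) open_mass (U n))%E.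
Proof.
move=> oU; apply: ge_ereal_sup => _ [f [bf f01 f0] <-].
have /choice[phi phiP] : forall k, exists g : T -> R,
    [/\ continuous g, forall x, 0 <= g x <= 1 & forall x, U k x <-> 0 < g x].
  by move=> k; exact: cozT.
have bphi k : bc (phi k).
  have [cg g01 _] := phiP k; split => //; exists 1 => x.
  by have := g01 x; rewrite ler_norml; lra.
pose h K k x := Num.min 1 (K%:R * phi k x).
have bh K k : bc (h K k) by apply: bc_min; [exact: bc_cst|exact: bcZ].
have h01 K k x : 0 <= h K k x <= 1.
  have [_ g01 _] := phiP k; have /andP[g0 _] := g01 x.
  by rewrite /h le_min ler01 mulr_ge0//= ge_min lexx.
have hU K k : below (U k) (h K k).
  split => // x nUx; have [_ g01 Ug] := phiP k; have /andP[g0 _] := g01 x.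
  have : ~ 0 < phi k x by move=> /Ug.
  by rewrite lt_neqAle g0 andbT => /negP; rewrite negbK /h => /eqP <-; rewrite mulr0 min_r.
have hS K k x : h K k x <= h K.+1 k x.
  have [_ g01 _] := phiP k; have /andP[g0 _] := g01 x.
  by rewrite /h le_min ge_min lexx/= ge_min ler_wpM2r ?ler_nat// orbT.
pose r K x := Num.max (f x - \sum_(0 <= k < K) h K k x) 0.
have br K : bc (r K) by apply: bc_max; [apply: bcB => //; exact: bc_sum|exact: bc_cst].
have Lr : (fun K => L (r K)) @ \oo --> 0.
  apply: L_cvg0 => // [K x|x].
    rewrite /r le_max lexx orbT/= ge_max !le_max lexx !orbT andbT.
    apply/orP; left; rewrite lerD2l lerN2 big_nat_recr//=.
    have /andP[hK _] := h01 K.+1 K x.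
    by rewrite ler_wpDr// ler_sum.
  have [[k _ Ukx]|nU] := pselect ((\bigcup_n U n) x); last first.
    apply: cvg_near_cst; apply: nearW => K; rewrite /r f0// sub0r max_r//.
    by rewrite oppr_le0 sumr_ge0// => i _; have /andP[] := h01 K i x.
  have [_ g01 Ug] := phiP k; have g0 : 0 < phi k x by apply/Ug.
  (* From this index on the term [k] belongs to the sum and has reached 1, which is at least
     [f x]. *)
  apply: cvg_near_cst; exists (maxn k.+1 (Num.truncn (phi k x)^-1).+1) => // K /=.
  rewrite geq_max => /andP[kK hK]; rewrite /r max_r// subr_le0.
  have h1 : h K k x = 1.
    rewrite /h min_l// -ler_pdivrMr// mul1r ltW// (lt_le_trans (truncnS_gt _))//.
    by rewrite ler_nat.
  have /andP[_ fx1] := f01 x; apply: (le_trans fx1).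
  rewrite -h1 big_mkord (bigD1 (Ordinal kK))//= ler_wpDr// sumr_ge0// => i _.
  by have /andP[] := h01 K i x.
have LK K : L f <= L (r K) + \sum_(0 <= k < K) L (h K k).
  rewrite -L_sum// -LD//; last exact: bc_sum.
  apply: L_le => //; first by apply: bcD => //; exact: bc_sum.
  by move=> x; rewrite -lerBlDr /r le_max lexx.
have LS K : ((L f)%:E - (L (r K))%:E <= \sum_(n <oo) open_mass (U n))%E.
  apply: (@le_trans _ _ (\sum_(0 <= k < K) open_mass (U k))%E); last first.
    by apply: nneseries_lim_ge => k _ _; exact: open_mass_ge0.
  apply: (@le_trans _ _ (\sum_(0 <= k < K) (L (h K k))%:E)%E).
    by rewrite sumEFin -EFinB lee_fin lerBlDl.
  by apply: lee_sum => k _; exact: le_open_mass.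
have : (0 <= \sum_(n <oo) open_mass (U n))%E by apply: nneseries_ge0.
move: LS; case: (\sum_(n <oo) open_mass (U n))%E => [s LS _|_ _|_]; [|by rewrite leey|by rewrite leeNy_eq].
rewrite lee_fin; have {}LS K : L f - s <= L (r K).
  by have := LS K; rewrite -EFinB lee_fin; lra.
rewrite -subr_le0 -(cvg_lim _ Lr)//; apply: limr_ge; last exact: nearW.
by apply/cvg_ex; exists 0.
Qed.

Let outer_mass_sigma_subadditive : sigma_subadditive outer_mass.
Proof.
move=> A; apply/lee_addgt0Pr => e e0.
have /choice[U UP] : forall n, exists U, [/\ open U, A n `<=` U &
    (open_mass U <= outer_mass (A n) + (e / (2 ^ n.+1)%:R)%:E)%E].
  move=> n; have en : 0 < e / (2 ^ n.+1)%:R by rewrite divr_gt0// ltr0n expn_gt0.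
  have fA : outer_mass (A n) \is a fin_num.
    by rewrite ge0_fin_numE// (le_lt_trans (outer_mass_le1 _))// ltry.
  have [_ [U [oU AU] <-] lt] := lb_ereal_inf_adherent en fA.
  by exists U; split => //; exact: ltW.
apply: (@le_trans _ _ (open_mass (\bigcup_n U n))).
  apply: ereal_inf_lbound; exists (\bigcup_n U n) => //; split.
    by apply: bigcup_open => n _; have [] := UP n.
  by apply: subset_bigcup => n _; have [] := UP n.
apply: (le_trans (open_mass_bigcup _)); first by move=> n; have [] := UP n.
apply: le_trans (epsilon_trick _ _ (ltW e0)) => //.
by apply: lee_nneseries => [n _ _|n _]; [exact: open_mass_ge0|have [] := UP n].
Qed.

(** Take [f] below [V] and [U], and [g] below the part of [V] where [f < e], which contains [X]
    minus [U]. The supports of [(f - e)^+] and [g] do not overlap, so their sum is still below [V],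
    at a loss of only [e]. *)
Let open_caratheodory U X : open U ->
  (outer_mass (X `&` U) + outer_mass (X `&` ~` U) <= outer_mass X)%E.
Proof.
move=> oU; apply: le_ereal_inf_tmp => _ [V [oV XV] <-].
have fin A : outer_mass A \is a fin_num.
  by rewrite ge0_fin_numE// (le_lt_trans (outer_mass_le1 _))// ltry.
apply: (@le_trans _ _ (open_mass (V `&` U) + outer_mass (X `&` ~` U))%E).
  rewrite leeD2r//; rewrite -outer_mass_open; last exact: openI.
  by apply: outer_massS; exact: setSI.
rewrite -leeBrDr//; apply: ge_ereal_sup => _ [f [bf f01 f0] <-].
rewrite leeBrDr//; apply/lee_addgt0Pr => e e0.
pose f' x := Num.max (f x - e) 0.
have bf' : bc f' by apply: bc_max; [apply: bcB => //; exact: bc_cst|exact: bc_cst].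
have Lf' : L f - e <= L f'.
  rewrite -(L_cst e) -LB//; last exact: bc_cst.
  apply: L_le => //; first by apply: bcB => //; exact: bc_cst.
  by move=> x; rewrite /f' le_max lexx.
pose V' := V `&` f @^-1` [set y | y < e].
have oV' : open V'.
  by have /continuousP cf := bf.1; apply: openI => //; apply: cf; exact: open_lt.
have XV' : (outer_mass (X `&` ~` U) <= open_mass V')%E.
  rewrite -outer_mass_open//; apply: outer_massS => x [Xx nUx]; split; first exact: XV.
  by rewrite /= f0// => -[].
rewrite addeC -leeBrDr//; apply: (le_trans XV').
apply: ge_ereal_sup => _ [g [bg g01 g0] <-]; rewrite leeBrDr//.
have : ((L (fun x => f' x + g x))%:E <= open_mass V)%E.
  apply: le_open_mass; split; first exact: bcD.
    move=> x; have /andP[fx0 fx1] := f01 x; have /andP[gx0 gx1] := g01 x.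
    have [fe|fe] := ltP (f x) e.
      by rewrite /f' max_r ?add0r ?gx0//; lra.
    rewrite g0 ?addr0; last by move=> [_ /=]; rewrite ltNge fe.
    by rewrite /f' max_l; lra.
  move=> x nVx; rewrite g0; last by move=> [].
  by rewrite /f' f0 ?addr0 ?max_r//; [lra|move=> []].
rewrite LD// => h; apply: (@le_trans _ _ (L f' + L g + e)%:E).
  by rewrite -EFinD lee_fin; lra.
by rewrite EFinD leeD2r.
Qed.

Let om : {outer_measure set T -> \bar R} := HB.pack outer_mass
  (isOuterMeasure.Build R T outer_mass outer_mass0 outer_mass_ge0 outer_massS
    outer_mass_sigma_subadditive).

Let borel_caratheodory (A : set (borel T)) : measurable A -> om.-caratheodory A.
Proof.
apply: smallest_sub => [|U oU].
  split; first exact: caratheodory_measurable_set0.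
    by move=> B; rewrite setTD; exact: caratheodory_measurable_setC.
  exact: caratheodory_measurable_bigcup.
by apply: le_caratheodory_measurable => X; exact: open_caratheodory.
Qed.

(* Slicing a function into layers of height 1 (and, after rescaling, of height
   [1 / n]) compares [\int f dm] with [L f]. *)
Let clip_sum (y : R) n : 0 <= y ->
  \sum_(0 <= k < n) Num.min 1 (Num.max (y - k%:R) 0) = Num.min y n%:R.
Proof.
move=> y0; elim: n => [|n ih]; first by rewrite big_geq// min_r.
rewrite big_nat_recr//= ih -natr1 /Num.min /Num.max.
by do !case: ifPn; rewrite -?leNgt => *; lra.
Qed.

Let step_sum (y : R) n : 0 <= y ->
  \sum_(0 <= k < n) (k%:R < y)%R%:R <= Num.min n%:R (y + 1).
Proof.
move=> y0; elim: n => [|n ih].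
  by rewrite big_geq// le_min lexx/=; lra.
rewrite big_nat_recr//= -natr1; move: ih; rewrite !le_min => /andP[h1 h2].
by case: ltP => /= ny; rewrite ?addr0; lra.
Qed.

Theorem daniell_representation :
  exists m : weakP T R, forall f, bounded_continuous f -> pint m f = L f.
Proof.
have [m mE] : exists m : probability (borel T) R, forall A, m A = om A.
  apply: exists_probability.
  - exact: outer_mass0.
  - exact: outer_mass_ge0.
  - move=> F mF tF mUF; apply: caratheodory_measure_sigma_additive => //.
      by move=> i; exact: borel_caratheodory.
    exact: borel_caratheodory.
  - rewrite [LHS](outer_mass_open openT); apply/eqP; rewrite eq_le open_mass_le1/=.
    by rewrite -[X in X%:E]L1; apply: le_open_mass; split => [|x|x];
      [exact: bc_cst|rewrite ler01 lexx|move=> /(_ I)].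
have m_open U f : open U -> below U f -> L f <= fine (m U).
  move=> oU Uf; rewrite -lee_fin fineK; last by apply: fin_num_measure; exact: open_borel.
  by rewrite mE [leRHS](outer_mass_open oU); exact: le_open_mass.
(* [N f] is the sum of its clips [c k], each below the open set where [k < N f], and a given point
   lies in at most [N f + 1] of these sets. Dividing by [N] leaves an error of [1 / N]. *)
have unit_le f : bc f -> (forall x, 0 <= f x <= 1) -> L f <= pint m f.
  move=> bf f01; apply/ler_addgt0Pr => e e0.
  pose N := (Num.truncn e^-1).+1; have N0 : 0 < N%:R :> R by rewrite ltr0n.
  pose c k x := Num.min 1 (Num.max (N%:R * f x - k%:R) 0).
  have bck k : bc (c k).
    apply: bc_min; first exact: bc_cst.
    by apply: bc_max; [apply: bcB; [exact: bcZ|exact: bc_cst]|exact: bc_cst].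
  pose U k := f @^-1` [set y | k%:R < N%:R * y].
  have oU k : open (U k).
    have /continuousP cf := bf.1; apply: cf.
    rewrite (_ : [set y | _] = [set y | k%:R / N%:R < y]); first exact: open_gt.
    by apply/seteqP; split => y /=; rewrite ltr_pdivrMr// mulrC.
  have cU k : below (U k) (c k).
    split => // x; first by rewrite /c le_min ler01 le_max lexx orbT/= ge_min lexx.
    by move=> /negP; rewrite -leNgt => h; rewrite /c max_r ?min_r//; lra.
  have fE : L f = N%:R^-1 * \sum_(0 <= k < N) L (c k).
    rewrite -L_sum// -LZ; last exact: bc_sum.
    congr L; apply/funext => x; have /andP[f0 f1] := f01 x.
    rewrite clip_sum; last by rewrite mulr_ge0// ltW.
    rewrite min_l; last by rewrite ger_pMr.
    by rewrite mulrA mulVf ?mul1r// gt_eqF.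
  have mU k : measurable (U k : set (borel T)) by exact: open_borel.
  have : \sum_(0 <= k < N) L (c k) <= N%:R * pint m f + 1.
    apply: (@le_trans _ _ (\sum_(0 <= k < N) fine (m (U k)))).
      by apply: ler_sum => k _; exact: m_open.
    rewrite (eq_bigr (fun k => \int[m]_x (\1_(U k) x : R))); last first.
      by move=> k _; rewrite bint_indic.
    rewrite -bint_sum; last by move=> k; exact: bmf_indic.
    rewrite -pintZ// -[X in _ + X](pint_cst m) -pintD//; [|exact: bcZ|exact: bc_cst].
    apply: le_bint.
    - by apply: bmf_sum => k; exact: bmf_indic.
    - by apply: bc_bmf; apply: bcD; [exact: bcZ|exact: bc_cst].
    - move=> x; have /andP[f0 f1] := f01 x.
      have y0 : 0 <= N%:R * f x by rewrite mulr_ge0// ltW.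
      have := step_sum N y0; rewrite le_min => /andP[_]; apply: le_trans.
      apply: ler_sum => k _; rewrite indicE /U.
      have [h|h] := ltP k%:R (N%:R * f x); first by case: (x \in _).
      by rewrite memNset//= ltNge h.
  have N1 : N%:R^-1 <= e.
    by rewrite invf_ple// ?posrE// ltW// truncnS_gt.
  rewrite fE -(ler_pM2l (_ : 0 < N%:R^-1)) ?invr_gt0// mulrDr mulrA mulVf ?gt_eqF// mul1r mulr1.
  by move=> h; apply: (le_trans h); rewrite lerD2l.
(* The reverse inequality is [unit_le] for [1 - f]. *)
have unit_eq f : bc f -> (forall x, 0 <= f x <= 1) -> pint m f = L f.
  move=> bf f01; apply/eqP; rewrite eq_le unit_le// andbT.
  have b1 : bc (fun=> 1) by exact: bc_cst.
  have := unit_le (fun x => 1 - f x) (bcB b1 bf).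
  rewrite LB// pintB// L1 pint_cst lerD2l lerN2; apply.
  by move=> x; have := f01 x; lra.
exists m => f bf; have [cf [M fM]] := bf.
(* An affine map takes [[-M', M']] to [[0, 1]]; the maximum with 1 keeps [M'] positive. *)
pose M' := Num.max M 1; have M0 : 0 < M' by rewrite lt_max ltr01 orbT.
have fM' x : `|f x| <= M' by rewrite le_max fM.
pose g x := (2 * M')^-1 * (f x + M').
have bM : bc (fun=> M') by exact: bc_cst.
have bg : bc g by apply: bcZ; exact: bcD.
have := unit_eq g bg; rewrite /g pintZ ?LZ ?pintD ?LD ?pint_cst ?L_cst//; try exact: bcD.
have M2 : 0 < (2 * M')^-1 by rewrite invr_gt0 mulr_gt0.
move=> h.
suff e : (2 * M')^-1 * (pint m f + M') = (2 * M')^-1 * (L f + M').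
  by apply: (addIr M'); exact: (mulfI (lt0r_neq0 M2) e).
apply: h => x; rewrite mulr_ge0 ?(ltW M2)//=; last by have := fM' x; rewrite ler_norml; lra.
by rewrite mulrC ler_pdivrMr ?mulr_gt0//; have := fM' x; rewrite ler_norml; lra.
Qed.

End daniell.

(** * Limits along ultrafilters *)

Section ultrafilters.

Lemma ultra_fmap I J (f : I -> J) (G : set_system I) :
  UltraFilter G -> UltraFilter (f @ G).
Proof.
move=> UG; split; first exact: fmap_proper_filter.
move=> H PH GH; apply/seteqP; split=> // A HA.
have [//|GA] := in_ultra_setVsetC (f @^-1` A) UG.
have /GH HA' : (f @ G) (~` A) by [].
by have [x []] := filter_ex (filterI HA HA').
Qed.

Lemma ultra_bounded_cvg (R : realType) I (G : set_system I) (u : I -> R) M :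
  UltraFilter G -> (forall i, `|u i| <= M) -> exists2 l : R, `|l| <= M & u @ G --> l.
Proof.
move=> UG uM; have := @segment_compact R (- M) M; rewrite compact_ultra.
move=> /(_ (u @ G) (ultra_fmap u UG)) [|l [lM ul]].
  apply: (@filterS _ G _ setT _ _ filterT) => i _.
  by rewrite /= in_itv/= -ler_norml.
by exists l => //; move: lM; rewrite /= in_itv/= -ler_norml.
Qed.

End ultrafilters.

(** * Weak limits on a product with compact fibres *)

Section compact_fibers.
Context (R : realType) (W X : ptopologicalType).
Hypotheses (cozW : cozero_opens W R) (cozWX : cozero_opens (W * X)%type R).
Hypothesis cptX : compact [set: X].

Lemma bc_fst (f : W -> R) : bounded_continuous f ->
  bounded_continuous (fun z : W * X => f z.1).
Proof.
move=> [cf [M fM]]; split; last by exists M.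
move=> z; apply: (@continuous_comp _ _ _ fst f); last exact: cf.
exact: cvg_fst.
Qed.

(** The tube lemma: finitely many product neighbourhoods cover the compact fibre over [w]. *)
Lemma tube_open (f : W * X -> R) e : continuous f ->
  open [set w | forall x, f (w, x) < e].
Proof.
move=> cf; rewrite openE => w /= fw.
have := (compact_near_coveringP _).1 cptX W (nbhs w) (fun w x => f (w, x) < e) _.
move=> h; suff : \forall w' \near w, [set: X] `<=` (fun x => f (w', x) < e).
  by apply: filterS => w' h' x; exact: h'.
apply: h => x _.
have /continuousP/(_ _ (@open_lt _ e)) := cf; rewrite openE => /(_ (w, x) (fw x)).
move=> [[A B] /= [wA xB] AB]; exists (B, A) => //= -[x' w'] /= [Bx Aw].
exact: (AB (w', x')).
Qed.

(** Near each [x] some [f_ N] is below [e], monotonicity carries this to all later indices, and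
    compactness of the fibre makes the index uniform. *)
Lemma dini_fiber (f_ : nat -> W * X -> R) w e : (forall n, continuous (f_ n)) ->
  (forall n z, f_ n.+1 z <= f_ n z) -> (forall z, f_ ^~ z @ \oo --> 0) -> 0 < e ->
  \forall n \near \oo, forall x, f_ n (w, x) < e.
Proof.
move=> cf df f0 e0.
have df' i j z : (i <= j)%N -> f_ j z <= f_ i z.
  elim: j => [|j ih]; first by rewrite leqn0 => /eqP ->.
  by rewrite leq_eqVlt => /predU1P[-> //|]; rewrite ltnS => /ih; exact: le_trans.
have h := (compact_near_coveringP _).1 cptX nat \oo (fun n x => f_ n (w, x) < e) _.
suff : \forall n \near \oo, [set: X] `<=` (fun x => f_ n (w, x) < e).
  by apply: filterS => n h' x; exact: h'.
apply: h => x _.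
have /cvgrPdist_lt/(_ _ e0)[N _ /(_ N (leqnn N))/=] := f0 (w, x).
rewrite sub0r normrN ltr_norml => /andP[_ fN].
have /continuousP/(_ _ (@open_lt _ e)) := cf N; rewrite openE => /(_ (w, x) fN).
move=> [[A B] /= [wA xB] AB]; exists (B, [set n | (N <= n)%N]) => /=.
  by split => //; exists N.
move=> [x' n] /= [Bx Nn]; apply: le_lt_trans (df' _ _ _ Nn) _.
by apply: (AB (w, x')); split => //; exact: nbhs_singleton.
Qed.

Local Notation bc := (@bounded_continuous (W * X)%type R).

(* Dini's theorem on the compact fibres [{w} * X] reduces the continuity of the
   limit functional along decreasing sequences to its first marginal, which is
   the measure [l]; Daniell's theorem then applies. *)
Theorem weakP_ultra_limit (G : set_system (weakP (W * X)%type R)) (l : weakP W R) :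
  UltraFilter G ->
  (forall f, bounded_continuous f -> pint m (fun z => f z.1) @[m --> G] --> pint l f) ->
  exists m : weakP (W * X)%type R, G --> m.
Proof.
move=> UG Gl.
have limP f : bc f -> exists l : R, pint m f @[m --> G] --> l.
  move=> [cf [M fM]].
  have [l' _ h] := @ultra_bounded_cvg R _ G (fun m => pint m f) M UG (fun m => pint_norm_le m cf fM).
  by exists l'.
pose L f := lim (pint m f @[m --> G]).
have LP f : bc f -> pint m f @[m --> G] --> L f.
  by move=> /limP[l' h]; rewrite /L (cvg_lim _ h).
have L_cst r : L (fun=> r) = r.
  rewrite /L; under eq_fun do rewrite pint_cst.
  by apply: cvg_lim => //; exact: cvg_cst.
have LD f g : bc f -> bc g -> L (fun x => f x + g x) = L f + L g.
  move=> bf bg; apply: cvg_lim => //; under eq_fun do rewrite pintD//.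
  by apply: cvgD; exact: LP.
have LZ r f : bc f -> L (fun x => r * f x) = r * L f.
  move=> bf; apply: cvg_lim => //; under eq_fun do rewrite pintZ//.
  by apply: cvgMr; exact: LP.
have L_le f g : bc f -> bc g -> (forall x, f x <= g x) -> L f <= L g.
  move=> bf bg fg; apply: ler_lim; [by apply/cvg_ex; exists (L f); exact: LP|
    by apply/cvg_ex; exists (L g); exact: LP|].
  by apply: nearW => m; exact: le_pint.
have [|m mE] := daniell_representation cozWX LD LZ L_le (L_cst 1).
  move=> f_ bf df f0.
  have f_ge0 n z : 0 <= f_ n z.
    rewrite -(cvg_lim _ (f0 z))//; apply: limr_le; first by apply/cvg_ex; exists 0.
    exists n => // k /= nk; elim: k nk => [|k ih]; first by rewrite leqn0 => /eqP ->.
    rewrite leq_eqVlt => /predU1P[-> //|]; rewrite ltnS => /ih.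
    by apply: le_trans; have /andP[] := df k z.
  have df' i j z : (i <= j)%N -> f_ j z <= f_ i z.
    elim: j => [|j ih]; first by rewrite leqn0 => /eqP ->.
    rewrite leq_eqVlt => /predU1P[-> //|]; rewrite ltnS => /ih.
    by apply: le_trans; have /andP[] := df j z.
  have [M M0 fM] : exists2 M, 0 <= M & forall z, f_ 0%N z <= M.
    have [_ [M fM]] := bf 0%N; exists `|M| => // z.
    by rewrite (le_trans (ler_norm _))// (le_trans (fM z))// ler_norm.
  have L_ge0 n : 0 <= L (f_ n) by rewrite -(L_cst 0); apply: L_le => [| |z];
    [exact: bc_cst|exact: bf|exact: f_ge0].
  apply/cvgrPdist_le => e e0; rewrite /=.
  (* Chosen so that [e1 + M (2 e1) = e]: [e1] bounds the functions over good types, and types of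
     mass below [2 e1] are bad. *)
  pose e1 := e / (1 + 2 * M); have e10 : 0 < e1 by rewrite divr_gt0//; lra.
  pose U n := [set w | forall x, f_ n (w, x) < e1].
  have oU n : open (U n) by apply: tube_open; exact: (bf n).1.
  have mU n : measurable (~` U n : set (borel W)) by apply: measurableC; exact: open_borel.
  (* By Dini every type is eventually good, so the sets of bad types decrease to the empty set. *)
  have : fine (l (~` U n)) @[n --> \oo] --> 0.
    apply: (fine_probability_cvg0 (T := borel W) l) => //.
      by move=> n w /= nU; apply: contra_not nU => Un x; rewrite (le_lt_trans (df' n n.+1 _ _))//.
    apply/seteqP; split => // w /= h.
    have [N _ /(_ N (leqnn N)) hN] := dini_fiber w (fun n => (bf n).1)
      (fun n z => df' n n.+1 z (leqnSn n)) f0 e10.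
    exact: (h N I).
  move=> /cvgrPdist_lt/(_ _ e10)[N _ /(_ N (leqnn N))/=]; rewrite sub0r normrN => lUN.
  (* [L] is known through [l] on continuous functions of the type only, so the indicator of the good
     types is replaced by some [h j] below it. *)
  have [h [bh h01 h0 _ h1]] := open_bc_approx cozW (oU N).
  have := open_measure_cvg (m := l) (oU N) bh h01 h0 h1.
  have -> : fine (l (U N)) = 1 - fine (l (~` U N)).
    rewrite probability_setC//; last exact: open_borel.
    rewrite fineB ?fin_num_measure//; last exact: open_borel.
    by rewrite subKr.
  move=> /cvgrPdist_lt/(_ _ e10)[j _ /(_ j (leqnn j))/=]; rewrite ltr_norml => /andP[_ hj].
  have {}hj : 1 - 2 * e1 < pint l (h j).
    have : fine (l (~` U N)) < e1 by rewrite (le_lt_trans (ler_norm _)).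
    lra.
  exists N => // n /= Nn; rewrite sub0r normrN ger0_norm//.
  have bhj : bc (fun z => h j z.1) := bc_fst (bh j).
  have b1 (r : R) : bc (fun=> r) by exact: bc_cst.
  apply: (@le_trans _ _ (L (fun z => e1 + M * (1 - h j z.1)))).
    apply: L_le => //; first by apply: bcD => //; apply: bcZ; exact: bcB.
    move=> [w x] /=; have /andP[h_0 h_1] := h01 j w.
    have [Uw|nUw] := pselect (U N w).
      rewrite (le_trans (df' _ _ _ Nn))// (le_trans (ltW (Uw x)))//.
      by rewrite lerDl mulr_ge0// subr_ge0.
    rewrite h0// subr0 mulr1 (le_trans (df' _ _ (w, x) (leq0n n)))//.
    by rewrite (le_trans (fM _))// lerDr ltW.
  have b1h : bc (fun z => 1 - h j z.1) := bcB (b1 1) bhj.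
  have bMh : bc (fun z => M * (1 - h j z.1)) := bcZ M b1h.
  have bNh : bc (fun z => -1 * h j z.1) := bcZ (-1) bhj.
  rewrite (LD _ _ (b1 e1) bMh) (LZ _ _ b1h).
  rewrite (_ : (fun z : W * X => 1 - h j z.1) = (fun z => 1 + -1 * h j z.1)); last first.
    by apply/funext => z; rewrite mulN1r.
  rewrite (LD _ _ (b1 1) bNh) (LZ _ _ bhj) !L_cst.
  have -> : L (fun z => h j z.1) = pint l (h j) by apply: cvg_lim => //; exact: Gl.
  have -> : e = e1 + M * (2 * e1).
    by rewrite /e1; field; rewrite gt_eqF//; lra.
  by rewrite lerD2l ler_wpM2l//; lra.
exists m; apply/weakP_cvgP => f bf; rewrite mE//; exact: LP.
Qed.

End compact_fibers.

(** * Countable bases as sequences of open sets *)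

Section open_sequences.

Definition open_basis_seq (T : topologicalType) (V : nat -> set T) :=
  (forall n, open (V n)) /\
  forall O x, open O -> O x -> exists n, V n x /\ V n `<=` O.

Lemma second_countable_basis_seq (T : topologicalType) :
  @second_countable T -> exists V : nat -> set T, open_basis_seq V.
Proof.
move=> [B /countable_injP[f finj] [oB bB]].
exists (fun n => \bigcup_(b in [set b | B b /\ f b = n]) b); split.
  by move=> n; apply: bigcup_open => b [/oB].
move=> O x oO Ox; have [b [Bb bx] bO] := bB x O (open_nbhs_nbhs (conj oO Ox)).
exists (f b); split; first by exists b.
move=> y [b' [Bb' fb] b'y]; apply: bO.
by have <- : b' = b := finj _ _ (mem_set Bb') (mem_set Bb) fb.
Qed.

(** Interiors of balls of radius [1 / (k + 1)] about dense points, indexed by coded pairs. Each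
    union defining [B] has at most one term, since [f] is injective on [D]. *)
Lemma separable_basis_seq (R : realType) (T : pseudoMetricType R) :
  (exists D : set T, countable D /\ dense D) ->
  exists V : nat -> set T, open_basis_seq V.
Proof.
move=> [D [/countable_injP[f finj] dD]].
pose B (p : nat * nat) := \bigcup_(d in [set d | D d /\ f d = p.1]) (ball d p.2.+1%:R^-1)°.
exists (fun n => oapp B set0 (@choice.unpickle (nat * nat)%type n)); split.
  move=> n; case: choice.unpickle => [p|]; last exact: open0.
  rewrite /=.
  by apply: bigcup_open => d _; exact: open_interior.
move=> O x oO Ox; have /nbhs_ballP[e /= e0 eO] := open_nbhs_nbhs (conj oO Ox).
pose k := Num.truncn (2 / e).
have k0 : 0 < k.+1%:R^-1 :> R by rewrite invr_gt0.
have ke : k.+1%:R^-1 + k.+1%:R^-1 <= e.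
  have := truncnS_gt (2 / e); rewrite -/k ltr_pdivrMr// => h.
  by rewrite -mulr2n -[X in X <= _]mulr_natl ler_pdivrMr ?ltr0n// mulrC ltW.
have k20 : 0 < k.+1%:R^-1 / 2 :> R by rewrite divr_gt0.
(* Half the radius leaves room for [x] to be interior to the ball around [d]. *)
have [|d [dx Dd]] := dD (ball x (k.+1%:R^-1 / 2))° _ (open_interior _).
  by exists x; exact: nbhsx_ballx.
have {}dx : ball x (k.+1%:R^-1 / 2) d by exact: interior_subset dx.
exists (choice.pickle (f d, k)); rewrite choice.pickleK /=; split.
  exists d => //; apply/nbhs_ballP; exists (k.+1%:R^-1 / 2) => // y xy.
  by rewrite (splitr k.+1%:R^-1); apply: ball_triangle xy; exact: ball_sym.
move=> y [d' [Dd' fd]] /interior_subset dy.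
have dd : d' = d := finj _ _ (mem_set Dd') (mem_set Dd) fd.
rewrite dd /= in dy.
apply: eO; apply: le_ball (ball_triangle dx dy); apply: le_trans ke; rewrite lerD2r.
by move: (k.+1%:R^-1) k0 => r r0; lra.
Qed.

Lemma prod_basis_seq (S T : topologicalType) (U : nat -> set S) (V : nat -> set T) :
  open_basis_seq U -> open_basis_seq V ->
  exists V' : nat -> set (S * T), open_basis_seq V'.
Proof.
move=> [oU bU] [oV bV].
exists (fun n => oapp (fun p : nat * nat => U p.1 `*` V p.2) set0 (@choice.unpickle (nat * nat)%type n)); split.
  move=> n; case: choice.unpickle => [p|]; last exact: open0.
  rewrite openE => -[x y] [/= Ux Vy]; exists (U p.1, V p.2) => //=.
  by split; apply: open_nbhs_nbhs.
move=> O [x y] oO Oxy.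
have [[A B] /= [xA yB] AB] := open_nbhs_nbhs (conj oO Oxy).
move: xA yB; rewrite !nbhsE => -[A' [oA' A'x] AA'] [B' [oB' B'y] BB'].
have [i [Ux UA]] := bU _ _ oA' A'x; have [j [Vy VB]] := bV _ _ oB' B'y.
exists (choice.pickle (i, j)); rewrite choice.pickleK; split => // -[x' y'] [/= Ux' Vy'].
by apply: AB; split => /=; [apply: AA'; apply: UA|apply: BB'; apply: VB].
Qed.

End open_sequences.

(** * Neighbourhoods in the upper Vietoris topology *)

Section closed_sets.
Context (T : topologicalType).

(** Inclusion in [E] and in [E'] is inclusion in their intersection, so the subbasic sets already
    form a base. *)
Lemma closedSet_nbhs (A : closedSet T) (U : set (closedSet T)) : nbhs A U ->
  exists E, [/\ open E, cs_set A `<=` E & forall B : closedSet T, cs_set B `<=` E -> U B].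
Proof.
pose D := [set E : set T | open E /\ cs_set A `<=` E].
pose F := filter_from D (fun E => [set B : closedSet T | cs_set B `<=` E]).
have FF : Filter F.
  apply: filter_from_filter; first by exists setT; split => //; exact: openT.
  move=> E E' [oE AE] [oE' AE']; exists (E `&` E').
    by split; [exact: openI|move=> x Ax; split; [exact: AE|exact: AE']].
  by move=> B /= BE; split => x /BE[].
suff FA : F --> A by move=> /FA[E [oE AE] EU]; exists E; split => // B; exact: EU.
move=> {}U; rewrite (@nbhsE (closedSet T)) => -[_ [[B sB <-] [C BC Ct] sUBA]].
apply: filterS sUBA _; apply: (@filterS _ _ _ C); first by move=> ? ?; exists C.
have /sB [S sS IDeC] := BC; rewrite -IDeC; apply: filter_bigI => E SE.
have /set_mem oE := sS _ SE; exists E => //; split => //.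
by move: Ct; rewrite -IDeC => /(_ _ SE).
Qed.

End closed_sets.

Lemma cvg_sum (R : realType) I J (H : set_system I) (s : seq J) (u : J -> I -> R) (l : J -> R) :
  Filter H -> (forall j, u j x @[x --> H] --> l j) ->
  (\sum_(j <- s) u j x) @[x --> H] --> \sum_(j <- s) l j.
Proof.
move=> FH ul; elim: s => [|j s ih].
  by rewrite big_nil; under eq_fun do rewrite big_nil; exact: cvg_cst.
by rewrite big_cons; under eq_fun do rewrite big_cons; exact: cvgD.
Qed.

(** * Closures and null sets under weak limits *)

Section weak_limits.
Context (R : realType) (T : ptopologicalType).
Hypothesis cozT : cozero_opens T R.
Implicit Types m : weakP T R.

(** An ultrafilter on [K] finer than the neighbourhoods of [p] also converges to some [q] in [K].
    Regularity at [q] puts [p] in the closure of a neighbourhood that stays inside [E]. *)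
Lemma compact_closure_weakP (K E : set (weakP T R)) : compact K -> open E ->
  K `<=` E -> closure K `<=` E.
Proof.
move=> cK oE KE p Kp.
have PF := within_nbhs_proper Kp.
have [G [UG sG]] := ultraFilterLemma PF.
have GK : G K by apply: sG; exact: withinT.
move: cK; rewrite compact_ultra => /(_ G UG GK)[q [/KE Eq Gq]].
have [B qB BE] := weakP_regular (open_nbhs_nbhs (conj oE Eq)).
apply: BE => A pA; apply: (@filter_ex _ G).
apply: filterI; first exact: Gq.
by apply: sG; apply: filterS pA => x Ax _.
Qed.

Definition null_open m (O : set T) := forall g : T -> R, bounded_continuous g ->
  (forall x, 0 <= g x) -> (forall x, ~ O x -> g x = 0) -> pint m g = 0.

Lemma null_open_measure m O : open O -> null_open m O -> m O = 0%E.
Proof.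
move=> oO mO; have [h [bh h01 h0 _ h1]] := open_bc_approx cozT oO.
have := open_measure_cvg (m := m) oO bh h01 h0 h1.
rewrite (_ : (fun n => _) = fun=> 0); last first.
  apply/funext => n; apply: mO => //; first by move=> x; have /andP[] := h01 n x.
  exact: h0.
move=> /(cvg_unique _ (cvg_cst 0)) => /(_ (@Rhausdorff R)) e.
by rewrite -(@fineK _ (m O)) -?e//; apply: fin_num_measure; exact: open_borel.
Qed.

Lemma measure0_null_open m (O : set T) : open O -> m O = 0%E -> null_open m O.
Proof.
move=> oO mO g bg g0 gO; have [_ [M gM]] := bg.
have mO' : measurable (O : set (borel T)) by exact: open_borel.
have bO : bmf (\1_O : borel T -> R) by exact: bmf_indic.
apply/eqP; rewrite eq_le; apply/andP; split; last exact: Rintegral_ge0.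
apply: (@le_trans _ _ (\int[m]_x (M * (\1_O : borel T -> R) x))).
  apply: le_bint => [||x]; [exact: bc_bmf|exact: bmfZ|].
  rewrite indicE; have [Ox|nOx] := pselect (O x).
    by rewrite mem_set// mulr1 (le_trans (ler_norm _)).
  by rewrite memNset// gO// mulr0.
by rewrite bintZ// bint_indic// [X in fine X](_ : _ = 0%E) ?mulr0.
Qed.

Lemma null_open_limit (G : set_system (weakP T R)) m O : ProperFilter G ->
  G --> m -> (\forall m' \near G, null_open m' O) -> null_open m O.
Proof.
move=> PG /weakP_cvgP Gm GO g bg g0 gO.
apply: (cvg_unique (@Rhausdorff R) (Gm g bg)).
apply: cvg_near_cst; move: GO; apply: filterS => m' h; exact: h.
Qed.

(** A Lindelöf argument: countably many null basic sets cover [B]. *)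
Lemma negligible_of_null_nbhs m (B : set T) (V : nat -> set T) : open_basis_seq V ->
  (forall z, B z -> exists O, [/\ open O, O z & null_open m O]) ->
  m.-negligible (B : set (borel T)).
Proof.
move=> [oV bV] hB.
pose N n : set (borel T) := if pselect (m (V n) = 0%E) then V n else set0.
have : m.-negligible (\bigcup_n N n).
  apply: negligible_bigcup => n; rewrite /N; case: pselect => mV.
    by exists (V n); split => //; exact: open_borel.
  exact: negligible_set0.
apply: negligibleS => z Bz; have [Q [oO Oz mO]] := hB z Bz.
have [n [Vz VO]] := bV _ _ oO Oz; exists n => //; rewrite /N; case: pselect => //.
move=> mVn; exfalso; apply: mVn; apply/eqP; rewrite eq_le measure_ge0 andbT.
rewrite -[leRHS](null_open_measure oO mO); apply: le_measure => //; apply/mem_set; exact: open_borel.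
Qed.

Lemma empirical_cvg I (H : set_system I) n (zs : I -> 'I_n -> T) (z : 'I_n -> T) :
  Filter H -> (forall k, zs j k @[j --> H] --> z k) ->
  (empirical R (zs j) : weakP T R) @[j --> H] --> (empirical R z : weakP T R).
Proof.
move=> FH; case: n zs z => [|n] zs z zsz.
  (* With no atoms [empirical] is a single default measure. *)
  rewrite (_ : (fun j => _) = fun=> empirical R z); first exact: cvg_cst.
  by apply/funext => j; congr empirical; apply/funext => -[].
apply/weakP_cvgP => f bf.
suff h : (fun j => pint (empirical R (zs j)) f) @ H --> pint (empirical R z) f by exact: h.
rewrite pint_empirical//; under eq_fun do rewrite pint_empirical//.
apply: cvgMr; apply: cvg_sum => i.
exact: (cvg_comp _ _ (zsz i) (bf.1 (z i))).
Qed.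

End weak_limits.

(** For a function of a colouring both integrals are the same finite sum over cells, and bounded
    functions are uniform limits of such functions. *)
Lemma bint_preimage d d' (S : measurableType d) (T : measurableType d') (R : realType)
    (m : probability S R) (l : probability T R) (phi : S -> T) (f : T -> R) :
  measurable_fun setT phi -> (forall A, measurable A -> m (phi @^-1` A) = l A) ->
  bmf f -> \int[m]_x f (phi x) = \int[l]_x f x.
Proof.
move=> mphi ml bf; have [mf [M fM]] := bf.
have bfp : bmf (fun x => f (phi x)) by split; [exact: measurableT_comp|exists M].
apply/eqP; rewrite -subr_eq0 -normr_eq0 eq_le normr_ge0 andbT.
apply/ler_addgt0Pr => e e0; rewrite add0r.
have e20 : 0 < e / 2 by rewrite divr_gt0.
have [F [c [mc cP]]] := exists_coloring1 bf e20.
have [r rP] : exists r : F -> R, forall x, `|f x - r (c x)| <= e / 2.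
  have /choice[r rP] : forall t, exists a, forall x, c x = t -> `|f x - a| <= e / 2.
    move=> t; have [[y cy]|nt] := pselect (exists y, c y = t).
      by exists (f y) => x cx; apply: cP; rewrite cx.
    by exists 0 => x cx; exfalso; apply: nt; exists x.
  by exists r => x; exact: rP.
have mcp t : measurable ((c \o phi) @^-1` [set t]).
  by rewrite comp_preimage -[X in measurable X]setTI; exact: mphi.
have h1 := bint_close l bf (bmf_coloring mc r) rP.
have h2 := bint_close m bfp (bmf_coloring mcp r) (fun x => rP (phi x)).
move: h1 h2; rewrite (bint_coloring mc) (bint_coloring mcp).
under [in X in _ -> X -> _]eq_bigr do rewrite comp_preimage ml//.
rewrite !ler_norml; lra.
Qed.

(** * Equilibria of the game *)
Section static_game.
Context (R : realType) (W : completePseudoMetricType R) (X : pseudoPMetricType R).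
Hypothesis sepW : exists D : set W, countable D /\ dense D.
Hypothesis cptX : compact [set: X].
Variable C : W -> set X.
Hypothesis C_ne : forall w, C w !=set0.
Hypothesis C_graph : closed [set z : W * X | C z.1 z.2].
Hypothesis C_lower : forall (ws : nat -> W) (w0 : W) (x0 : X),
  ws @ \oo --> w0 -> C w0 x0 ->
  exists (phi : nat -> nat) (xs : nat -> X),
    [/\ {homo phi : k l / (k < l)%N}, (forall k, C (ws (phi k)) (xs k)) & xs @ \oo --> x0].
Variable F : weakP (W * X)%type R -> W -> X -> R.
Hypothesis F_bounded : exists M : R, forall m w x, `|F m w x| <= M.
Hypothesis F_cont : continuous (fun p : (weakP (W * X)%type R * W * X)%type => F p.1.1 p.1.2 p.2).

Let cozW : cozero_opens W R := @pseudometric_cozero R W.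
Let cozWX : cozero_opens (W * X)%type R := @pseudometric_cozero R (W * X)%type.

Let basisWX : exists V : nat -> set (W * X), open_basis_seq V.
Proof.
have [U bU] := separable_basis_seq sepW.
have [V bV] := second_countable_basis_seq (compact_second_countable cptX).
exact: prod_basis_seq bU bV.
Qed.

Lemma F_cvg I (H : set_system I) (ms : I -> weakP (W * X)%type R) (ws : I -> W) (xs : I -> X) m w x :
  Filter H -> ms @ H --> m -> ws @ H --> w -> xs @ H --> x ->
  F (ms j) (ws j) (xs j) @[j --> H] --> F m w x.
Proof.
move=> FH msm wsw xsx.
have h : (ms j, ws j, xs j) @[j --> H] --> (m, w, x).
  exact: (cvg_pair (cvg_pair msm wsw) xsx).
exact: (cvg_comp _ _ h (@F_cont (m, w, x))).
Qed.

(** The neighbourhood form of [C_lower], fit for filters. Its failure would give points [ws n]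
    within [1 / (n + 1)] of [w] that contradict the sequential form. *)
Lemma C_lower_nbhs w x (B : set X) : C w x -> nbhs x B ->
  \forall w' \near w, exists2 y, B y & C w' y.
Proof.
move=> Cwx xB; apply: contrapT => h.
have /choice[ws wsP] : forall n, exists w', ball w n.+1%:R^-1 w' /\ ~ exists2 y, B y & C w' y.
  move=> n; apply: contrapT => h'; apply: h; apply/nbhs_ballP.
  exists n.+1%:R^-1 => /=; first by rewrite invr_gt0.
  by move=> w' ww'; apply: contrapT => h''; apply: h'; exists w'.
have wsw : ws @ \oo --> w.
  apply/cvg_ballP => e e0; exists (Num.truncn e^-1) => // n /= Nn.
  apply: le_ball (wsP n).1; rewrite invf_ple ?posrE//.
  by rewrite ltW// (lt_le_trans (truncnS_gt _))// ler_nat ltnS.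
have [phi [xs [_ Cxs xsx]]] := C_lower wsw Cwx.
have [k _ /(_ k (leqnn k)) Bk] := xsx _ xB.
by apply: (wsP (phi k)).2; exists (xs k).
Qed.

Lemma inf_le_cost m w y : C w y -> inf [set F m w y' | y' in C w] <= F m w y.
Proof.
move=> Cwy; apply: ge_inf; last by exists y.
have [M FM] := F_bounded; exists (- M) => _ [x _ <-].
by have := FM m w x; rewrite ler_norml => /andP[].
Qed.

Lemma le_inf_cost (f : X -> R) w a : (forall y, C w y -> a <= f y) ->
  a <= inf [set f y | y in C w].
Proof.
move=> h; apply: lb_le_inf; first by have [y Cy] := C_ne w; exists (f y), y.
by move=> _ [y Cy <-]; exact: h.
Qed.

(** The complement of the condition in [MFE], with an explicit deviation in place of the infimum so
    that it can be propagated to neighbours. *)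
Definition suboptimal m (z : W * X) :=
  ~ C z.1 z.2 \/ exists2 y, C z.1 y & F m z.1 y < F m z.1 z.2.

Lemma suboptimalP m z :
  ~ suboptimal m z <-> C z.1 z.2 /\ F m z.1 z.2 = inf [set F m z.1 y | y in C z.1].
Proof.
split=> [h|[Cz Fz] [//|[y Cy]]].
  have Cz : C z.1 z.2 by apply: contrapT => nC; apply: h; left.
  split => //; apply/eqP; rewrite eq_le inf_le_cost// andbT.
  apply: le_inf_cost => y Cy; rewrite leNgt; apply/negP => lt.
  by apply: h; right; exists y.
by rewrite Fz ltNge inf_le_cost.
Qed.

(* The deviation [y] stays profitable by the margin [e] even when the two costs
   are evaluated at different measures near [m]: in the n-player game a deviation
   also moves the empirical measure. *)
Lemma suboptimal_near m z : suboptimal m z ->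
  exists O N (e : R), [/\ open O, O z, nbhs m N, 0 < e & forall z', O z' ->
    ~ C z'.1 z'.2 \/ exists2 y, C z'.1 y &
      forall m1 m2, N m1 -> N m2 -> F m1 z'.1 y + e < F m2 z'.1 z'.2].
Proof.
case: z => w x [/= nC|[/= y Cy Fy]].
  exists (~` [set z : W * X | C z.1 z.2]), setT, 1; split => //.
  - exact: closed_openC.
  - exact: filterT.
  - by move=> z' nCz'; left.
(* A quarter of the gain: each of the two costs moves by less than [e], which leaves a gap above
   [2 e]. *)
pose e := (F m w x - F m w y) / 4; have e0 : 0 < e by rewrite divr_gt0//; lra.
have : \forall p \near (m, w, x), F m w x - e < F p.1.1 p.1.2 p.2.
  have /cvgrPdist_lt/(_ _ e0) := @F_cont (m, w, x).
  by apply: filterS => p /=; rewrite ltr_norml; lra.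
move=> [[A1 Bx] /= [[[N1 U1] /= [mN1 wU1] A1E] xBx] h1].
have : \forall p \near (m, w, y), F p.1.1 p.1.2 p.2 < F m w y + e.
  have /cvgrPdist_lt/(_ _ e0) := @F_cont (m, w, y).
  by apply: filterS => p /=; rewrite ltr_norml; lra.
move=> [[A2 By] /= [[[N2 U2] /= [mN2 wU2] A2E] yBy] h2].
have wU3 := C_lower_nbhs Cy yBy.
have wU : nbhs w (U1 `&` U2 `&` [set w' | exists2 y', By y' & C w' y']).
  by apply: filterI => //; exact: filterI.
exists ((U1 `&` U2 `&` [set w' | exists2 y', By y' & C w' y'])° `*` Bx°), (N1 `&` N2), e.
split => //.
- rewrite openE => -[w' x'] [/= w'U x'B].
  exists ((U1 `&` U2 `&` [set w' | exists2 y', By y' & C w' y'])°, Bx°) => //=.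
  by split; apply: open_nbhs_nbhs; split => //; exact: open_interior.
- exact: filterI.
move=> [w' x'] [/= /interior_subset[[U1w U2w] [y' By' Cy']] /interior_subset Bx'].
right; exists y' => // m1 m2 [_ N2m1] [N1m2 _].
have /= := h1 (m2, w', x') (conj (A1E (m2, w') (conj N1m2 U1w)) Bx').
have /= := h2 (m1, w', y') (conj (A2E (m1, w') (conj N2m1 U2w)) By').
rewrite /e; lra.
Qed.

(** Shared by the limits of mean-field and of n-player equilibria. Every suboptimal point has an
    open neighbourhood where a deviation stays profitable; being null along [G], it is null for [m],
    and countably many null basic sets cover all these points. *)
Lemma ae_optimal_limit (G : set_system (weakP (W * X)%type R)) (m : weakP (W * X)%type R) :
  ProperFilter G -> G --> m ->
  (forall z O N (e : R), open O -> O z -> nbhs m N -> 0 < e ->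
    (forall z', O z' -> ~ C z'.1 z'.2 \/ exists2 y, C z'.1 y &
      forall m1 m2, N m1 -> N m2 -> F m1 z'.1 y + e < F m2 z'.1 z'.2) ->
    \forall m' \near G, null_open m' O) ->
  {ae m, forall z : borel (W * X)%type,
    C z.1 z.2 /\ F m z.1 z.2 = inf [set F m z.1 y | y in C z.1]}.
Proof.
move=> PG Gm h; have [V bV] := basisWX.
apply: (negligibleS _ (negligible_of_null_nbhs cozWX bV (B := suboptimal m) _)).
  move=> z /= nz; apply: contrapT => /suboptimalP; exact: nz.
move=> z /suboptimal_near[Q [N [e [oO Oz mN e0 hO]]]].
by exists Q; split => //; apply: null_open_limit Gm _; exact: (h z Q N e).
Qed.

(** The Borel sets here are generated by the open sets of the product rather than by rectangles, so
    continuity of the projection is the reason. *)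
Lemma measurable_fst : measurable_fun setT (fst : borel (W * X)%type -> borel W).
Proof.
apply: (@measurability _ _ (borel (W * X)%type) (borel W) setT fst (@open W) erefl) => _ [U oU <-].
rewrite setTI; apply: open_borel.
have /continuousP : continuous (fst : W * X -> W) by move=> z; exact: cvg_fst.
exact.
Qed.

Lemma pint_marginal (m : weakP (W * X)%type R) (l : weakP W R) :
  (forall A : set (borel W), measurable A -> m ((@fst W X) @^-1` A) = l A) ->
  forall f, bounded_continuous f -> pint m (fun z => f z.1) = pint l f.
Proof.
move=> ml f bf; exact: (bint_preimage measurable_fst ml (bc_bmf bf)).
Qed.

(** The marginal of [m] is built as a probability on [W], to which uniqueness from test integrals
    applies. *)
Lemma marginal_pint (m : weakP (W * X)%type R) (l : weakP W R) :
  (forall f, bounded_continuous f -> pint m (fun z => f z.1) = pint l f) ->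
  forall A : set (borel W), measurable A -> m ((@fst W X) @^-1` A) = l A.
Proof.
move=> ml.
have [m1 m1E] : exists m1 : probability (borel W) R,
    forall A, m1 A = (pushforward m (fst : borel (W * X)%type -> borel W)) A.
  have mf := measurable_fst.
  apply: exists_probability.
  - by rewrite /pushforward preimage_set0 measure0.
  - by move=> A; rewrite /pushforward measure_ge0.
  - move=> A mA tA mUA; rewrite /pushforward preimage_bigcup.
    apply: measure_semi_sigma_additive.
    + by move=> n; rewrite -[X in measurable X]setTI; exact: mf.
    + by move=> i j _ _ [z [Az Bz]]; apply: (tA i j) => //; exists z.1.
    + by rewrite -preimage_bigcup -[X in measurable X]setTI; exact: mf.
  - by rewrite /pushforward preimage_setT; exact: probability_setT.
move=> A mA; have := m1E A; rewrite /pushforward => <-.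
apply: (pint_inj cozW (m := m1 : weakP W R)) => // f bf.
rewrite -ml//; apply/esym; apply: pint_marginal => // B mB.
by rewrite m1E.
Qed.

Lemma MFE_limit I (H : set_system I) (ls : I -> weakP W R) (ms : I -> weakP (W * X)%type R)
    (l : weakP W R) (m : weakP (W * X)%type R) :
  ProperFilter H -> ls @ H --> l -> ms @ H --> m ->
  (\forall j \near H, MFE C F (ls j) (ms j)) -> MFE C F l m.
Proof.
move=> PH lsl msm HM; split.
  apply: marginal_pint => f bf.
  have /weakP_cvgP/(_ _ (bc_fst X bf)) c := msm.
  have /weakP_cvgP/(_ _ bf) c' := lsl.
  have c'' : pint (ms j) (fun z => f z.1) @[j --> H] --> pint l f.
    apply: (cvg_trans _ c'); apply: near_eq_cvg.
    by move: HM; apply: filterS => j [mj _]; apply/esym; exact: pint_marginal.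
  exact: (cvg_unique (@Rhausdorff R) c c'').
apply: (ae_optimal_limit _ msm) => z O N e oO Oz mN e0 hO.
have HN : H [set j | N (ms j)] by exact: msm.
suff : H [set j | null_open (ms j) O] by [].
move: HM HN; apply: filterS2 => j [_ [A [mA A0 hA]]] Nm'.
apply: measure0_null_open => //.
have mO : measurable (O : set (borel (W * X)%type)) by exact: open_borel.
apply/eqP; rewrite eq_le measure_ge0 andbT -A0.
(* Every point of [O] is suboptimal for [ms j], so [O] lies in its null set [A] of exceptions. *)
apply: le_measure; [exact/mem_set|exact/mem_set|move=> z' Oz'].
apply: hA => /suboptimalP; apply.
have [nC|[y Cy hy]] := hO z' Oz'; first by left.
right; exists y => //; have := hy (ms j) (ms j) Nm' Nm'; lra.
Qed.

Lemma closed_MFE (l : weakP W R) : closed (MFE C F l).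
Proof.
move=> m clm; have PG := within_nbhs_proper clm.
by apply: (MFE_limit PG (cvg_cst l) (ms := id)); [exact: cvg_within|exact: withinT].
Qed.

(** Counterexamples, that is, marginals near [l] paired with equilibria outside [E], would generate
    a filter. Along a finer ultrafilter the equilibria converge since their marginals do, and the
    limit is an equilibrium for [l], hence in [E]. *)
Lemma MFE_uhc (l : weakP W R) (E : set (weakP (W * X)%type R)) : open E -> MFE C F l `<=` E ->
  \forall l' \near l, MFE C F l' `<=` E.
Proof.
move=> oE lE; apply: contrapT => h.
pose I := (weakP W R * weakP (W * X)%type R)%type.
pose B (V : set (weakP W R)) := [set j : I | [/\ V j.1, MFE C F j.1 j.2 & ~ E j.2]].
have FF : Filter (filter_from (nbhs l) B).
  apply: filter_from_filter; first by exists setT; exact: filterT.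
  move=> V V' lV lV'; exists (V `&` V'); first exact: filterI.
  by move=> j [/= [Vj V'j] h1 h2]; split; split.
have PF : ProperFilter (filter_from (nbhs l) B).
  apply: filter_from_proper => // V lV; apply: contrapT => hB; apply: h.
  move: lV; apply: filterS => l' Vl' m ml'; apply: contrapT => nE.
  by apply: hB; exists (l', m).
have [H [UH sH]] := ultraFilterLemma PF.
have lsl : (fun j : I => j.1) @ H --> l by move=> V lV; apply: sH; exists V => // j [].
have HM : H [set j : I | MFE C F j.1 j.2].
  by apply: sH; exists setT => [|j []//]; exact: filterT.
have HE : H [set j : I | ~ E j.2].
  by apply: sH; exists setT => [|j []//]; exact: filterT.
have emf f : bounded_continuous f -> pint j.2 (fun z => f z.1) @[j --> H] --> pint l f.
  move=> bf; have /weakP_cvgP/(_ f bf) c := lsl.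
  apply: (cvg_trans _ c); apply: near_eq_cvg.
  by move: HM; apply: filterS => j [mj _]; apply/esym; exact: pint_marginal.
have [m msm] := weakP_ultra_limit cozW cozWX cptX (ultra_fmap (fun j : I => j.2) UH) emf.
have Em : E m by apply: lE; exact: (MFE_limit _ lsl msm HM).
have HE' : H [set j : I | E j.2] by exact: (msm _ (open_nbhs_nbhs (conj oE Em))).
by have [j [nEj]] := filter_ex (filterI HE HE').
Qed.

(** A deviation [y] admissible for [w i] need not be admissible for [ws j i]. The filter [H'] of
    pairs [(j, y')], with [y'] admissible for [ws j i] and close to [y], is proper by lower
    hemicontinuity, and both costs converge along it. *)
Lemma eps_nash_limit I (H : set_system I) n (e : R) (ws : I -> 'I_n -> W)
    (xs : I -> 'I_n -> X) w x : ProperFilter H ->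
  (forall i, ws j i @[j --> H] --> w i) -> (forall i, xs j i @[j --> H] --> x i) ->
  (\forall j \near H, eps_nash C F e (ws j) (xs j)) -> eps_nash C F e w x.
Proof.
move=> PH wsw xsx Hn; split=> i.
  apply: (@C_graph (w i, x i)) => A wxA.
  have : (ws j i, xs j i) @[j --> H] --> (w i, x i) by exact: cvg_pair.
  move=> /(_ A wxA) HA'; have HA : H [set j | A (ws j i, xs j i)] by exact: HA'.
  have [j [Aj [Cj _]]] := filter_ex (filterI HA Hn).
  by exists (ws j i, xs j i); split => //=; exact: Cj.
rewrite lerBlDl -lerBlDr; apply: le_inf_cost => y Cy.
pose D := [set AB : set I * set X | H AB.1 /\ nbhs y AB.2].
pose H' := filter_from D (fun AB => [set p : I * X | [/\ AB.1 p.1, AB.2 p.2 & C (ws p.1 i) p.2]]).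
have FH' : Filter H'.
  apply: filter_from_filter; first by exists (setT, setT); split => /=; exact: filterT.
  move=> [A B] [A' B'] [/= HA yB] [/= HA' yB']; exists (A `&` A', B `&` B').
    by split; exact: filterI.
  by move=> [j y'] [/= [Aj A'j] [By B'y] Cj]; split; split.
have PH' : ProperFilter H'.
  apply: filter_from_proper => // -[A B] [/= HA yB].
  have HB : H [set j | exists2 y', B y' & C (ws j i) y'].
    exact: (wsw i _ (C_lower_nbhs Cy yB)).
  have [j [Aj [y' By' Cy']]] := filter_ex (filterI HA HB).
  by exists (j, y'); split.
have fstH : (fun p : I * X => p.1) @ H' --> H.
  by move=> A HA; exists (A, setT) => [|[j y'] []//]; split => //; exact: filterT.
have sndH : (fun p : I * X => p.2) @ H' --> y.
  by move=> B yB; exists (setT, B) => [|[j y'] []//]; split => //; exact: filterT.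
have H'C : H' [set p | C (ws p.1 i) p.2].
  by exists (setT, setT) => [|[j y'] []//]; split; exact: filterT.
have wsw' k : ws p.1 k @[p --> H'] --> w k.
  exact: (cvg_comp _ _ fstH (wsw k)).
have xsx' k : xs p.1 k @[p --> H'] --> x k.
  exact: (cvg_comp _ _ fstH (xsx k)).
have c1 : F (empirical R (fun k => (ws p.1 k, xs p.1 k))) (ws p.1 i) (xs p.1 i) @[p --> H'] -->
    F (empirical R (fun k => (w k, x k))) (w i) (x i).
  apply: F_cvg => //; apply: (empirical_cvg (T := (W * X)%type)) => k.
  exact: cvg_pair.
have c2 : F (empirical R (fun k => (ws p.1 k, if k == i then p.2 else xs p.1 k))) (ws p.1 i) p.2
      @[p --> H'] -->
    F (empirical R (fun k => (w k, if k == i then y else x k))) (w i) y.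
  apply: F_cvg => //; apply: (empirical_cvg (T := (W * X)%type)) => k.
  by apply: cvg_pair => //; case: ifP.
rewrite lerBlDl -lerBlDr.
have c3 := @cvgB _ _ _ H' FH' _ _ _ _ c1 c2; rewrite -(cvg_lim (@Rhausdorff R) c3).
apply: limr_le; first by apply/cvg_ex; eexists; exact: c3.
have H'n : H' [set p | eps_nash C F e (ws p.1) (xs p.1)].
  exact: (fstH _ Hn).
move: H'n H'C; apply: filterS2 => -[j y'] /= [_ /(_ i) h] Cy'.
apply: le_trans h; rewrite lerD2l lerN2; apply: ge_inf; last by exists y'.
have [M FM] := F_bounded; exists (- M) => _ [x' _ <-].
by have := FM (empirical R (fun k => (ws j k, if k == i then x' else xs j k))) (ws j i) x';
  rewrite ler_norml => /andP[].
Qed.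

Lemma ultra_cvg_X I (H : set_system I) (u : I -> X) : UltraFilter H -> exists x : X, u @ H --> x.
Proof.
move=> UH; have := cptX; rewrite compact_ultra => /(_ (u @ H) (ultra_fmap u UH)).
by move=> /(_ filterT)[x [_ ux]]; exists x.
Qed.

(** For fixed [n] this makes inclusion in [E] an open condition on the type vector, which is what
    the measurability of the random set rests on. *)
Lemma nash_set_uhc n (e : R) (w : 'I_n -> W) (E : set (weakP (W * X)%type R)) :
  open E -> nash_set C F e w `<=` E ->
  exists U : 'I_n -> set W, (forall i, nbhs (w i) (U i)) /\
    forall w', (forall i, U i (w' i)) -> nash_set C F e w' `<=` E.
Proof.
move=> oE wE; apply: contrapT => h.
pose D := [set U : 'I_n -> set W | forall i, nbhs (w i) (U i)].
pose B (U : 'I_n -> set W) := [set p : ('I_n -> W) * ('I_n -> X) |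
  [/\ forall i, U i (p.1 i), eps_nash C F e p.1 p.2 &
     ~ E (empirical R (fun k => (p.1 k, p.2 k)))]].
have FF : Filter (filter_from D B).
  apply: filter_from_filter; first by exists (fun=> setT) => i; exact: filterT.
  move=> U U' DU DU'; exists (fun i => U i `&` U' i); first by move=> i; exact: filterI.
  by move=> p [Up np nE]; split; split => // i; have [] := Up i.
have PF : ProperFilter (filter_from D B).
  apply: filter_from_proper => // U DU; apply: contrapT => hB; apply: h; exists U; split => //.
  move=> w' Uw' _ [x nx <-]; apply: contrapT => nE; apply: hB.
  by exists (w', x).
have [H [UH sH]] := ultraFilterLemma PF.
have /choice[x xsx] : forall i, exists x : X, p.2 i @[p --> H] --> x.
  by move=> i; exact: ultra_cvg_X.
have wsw i : p.1 i @[p --> H] --> w i.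
  move=> A wA; apply: sH; exists (fun j => if j == i then A else setT).
    by move=> j; case: eqP => [->//|_]; exact: filterT.
  by move=> p [/(_ i)]; rewrite eqxx.
have Hn : H [set p | eps_nash C F e p.1 p.2].
  by apply: sH; exists (fun=> setT) => [i|p []//]; exact: filterT.
have HE : H [set p | ~ E (empirical R (fun k => (p.1 k, p.2 k)))].
  by apply: sH; exists (fun=> setT) => [i|p []//]; exact: filterT.
have Ewx : E (empirical R (fun k => (w k, x k))).
  by apply: wE; exists x => //; exact: (eps_nash_limit _ wsw xsx Hn).
have ec : (empirical R (fun k => (p.1 k, p.2 k)) : weakP (W * X)%type R) @[p --> H] -->
    (empirical R (fun k => (w k, x k)) : weakP (W * X)%type R).
  by apply: (empirical_cvg (T := (W * X)%type)) => k; exact: cvg_pair.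
have HE' : H [set p | E (empirical R (fun k => (p.1 k, p.2 k)))].
  exact: (ec _ (open_nbhs_nbhs (conj oE Ewx))).
by have [p [np]] := filter_ex (filterI HE HE').
Qed.

(** The ultrafilter is lifted from empirical measures to action profiles, which converge
    coordinatewise in [X] to an equilibrium profile. *)
Lemma compact_nash_set n (e : R) (w : 'I_n -> W) : compact (nash_set C F e w).
Proof.
rewrite compact_ultra => G UG GN.
pose B (A : set (weakP (W * X)%type R)) := [set x : 'I_n -> X |
  eps_nash C F e w x /\ A (empirical R (fun k => (w k, x k)))].
have FF : Filter (filter_from G B).
  apply: filter_from_filter; first by exists setT; exact: filterT.
  move=> A A' GA GA'; exists (A `&` A'); first exact: filterI.
  by move=> x [nx [Ax A'x]]; split; split.
have PF : ProperFilter (filter_from G B).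
  apply: filter_from_proper => // A GA.
  by have [_ [[x nx <-] Ax]] := filter_ex (filterI GN GA); exists x.
have [H [UH sH]] := ultraFilterLemma PF.
have /choice[x xsx] : forall i, exists x0 : X, x i @[x --> H] --> x0.
  by move=> i; exact: ultra_cvg_X.
have Hn : H [set x | eps_nash C F e w x] by apply: sH; exists setT => [|y []//]; exact: filterT.
have nx : eps_nash C F e w x.
  by apply: (eps_nash_limit (ws := fun=> w) _ _ xsx Hn) => i; exact: cvg_cst.
exists (empirical R (fun k => (w k, x k))); split; first by exists x.
have ec : (empirical R (fun k => (w k, y k)) : weakP (W * X)%type R) @[y --> H] -->
    (empirical R (fun k => (w k, x k)) : weakP (W * X)%type R).
  apply: (empirical_cvg (T := (W * X)%type)) => k; apply: cvg_pair => //; exact: cvg_cst.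
move=> A /ec Ay; have HA : H [set y | A (empirical R (fun k => (w k, y k)))] by exact: Ay.
have [//|GA] := in_ultra_setVsetC A UG.
have HA' : H [set y | eps_nash C F e w y /\ ~ A (empirical R (fun k => (w k, y k)))].
  by apply: sH; exists (~` A).
by have [y [Ay' [_ nAy]]] := filter_ex (filterI HA HA').
Qed.

(** Hence the closure taken in [nash_random_set] is invisible to the upper Vietoris topology. *)
Lemma closure_nash_setP n (e : R) (w : 'I_n -> W) (E : set (weakP (W * X)%type R)) :
  open E -> (closure (nash_set C F e w) `<=` E) <-> (nash_set C F e w `<=` E).
Proof.
move=> oE; split=> [h|h]; first exact: subset_trans (@subset_closure _ _) h.
apply: compact_closure_weakP oE h.
exact: compact_nash_set.
Qed.

Lemma pint_deviation n (w : 'I_n.+1 -> W) (x : 'I_n.+1 -> X) i y (f : W * X -> R) M :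
  bounded_continuous f -> (forall z, `|f z| <= M) ->
  `|pint (empirical R (fun k => (w k, if k == i then y else x k))) f -
    pint (empirical R (fun k => (w k, x k))) f| <= n.+1%:R^-1 * (2 * M).
Proof.
move=> bf fM; rewrite !pint_empirical// -mulrBr normrM ger0_norm ?invr_ge0//.
rewrite ler_wpM2l ?invr_ge0//.
rewrite (bigD1 i)//= [X in _ - X](bigD1 i)//= eqxx.
rewrite (eq_bigr (fun k => f (w k, x k))); last by move=> k /negbTE ->.
rewrite opprD addrACA subrr addr0 mulrDl !mul1r.
by rewrite (le_trans (ler_normB _ _))// lerD.
Qed.

Variable eps : nat -> R.
Hypothesis eps_cvg : eps @ \oo --> 0.

Theorem nash_set_near_MFE (l : weakP W R) (E : set (weakP (W * X)%type R)) :
  open E -> MFE C F l `<=` E ->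
  exists V n0, nbhs l V /\ forall n (w : 'I_n -> W), (n0 <= n)%N ->
    V (empirical R w) -> nash_set C F (eps n) w `<=` E.
Proof.
move=> oE lE; apply: contrapT => h.
pose I := {n : nat & (('I_n -> W) * ('I_n -> X))%type}.
pose ew (j : I) : weakP W R := empirical R (projT2 j).1.
pose em (j : I) : weakP (W * X)%type R := empirical R (fun k => ((projT2 j).1 k, (projT2 j).2 k)).
pose D := [set Vn : set (weakP W R) * nat | nbhs l Vn.1].
pose B (Vn : set (weakP W R) * nat) := [set j : I |
  [/\ (Vn.2 <= projT1 j)%N, Vn.1 (ew j),
      eps_nash C F (eps (projT1 j)) (projT2 j).1 (projT2 j).2 & ~ E (em j)]].
have FF : Filter (filter_from D B).
  apply: filter_from_filter; first by exists (setT, 0%N); exact: filterT.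
  move=> [V n] [V' n'] DV DV'; exists (V `&` V', maxn n n'); first exact: filterI.
  by move=> j [/=]; rewrite geq_max => /andP[h1 h2] [h3 h4] h5 h6; split; split.
have PF : ProperFilter (filter_from D B).
  apply: filter_from_proper => // -[V n0] DV; apply: contrapT => hB; apply: h.
  exists V, n0; split => // n w n0n Vw _ [x nx <-]; apply: contrapT => nE; apply: hB.
  by exists (existT _ n (w, x)).
have [H [UH sH]] := ultraFilterLemma PF.
have ewl : ew @ H --> l by move=> V lV; apply: sH; exists (V, 0%N) => // j [].
have Hn n0 : H [set j : I | (n0 <= projT1 j)%N].
  by apply: sH; exists (setT, n0) => [|j []//]; exact: filterT.
have Hnash : H [set j : I | eps_nash C F (eps (projT1 j)) (projT2 j).1 (projT2 j).2].
  by apply: sH; exists (setT, 0%N) => [|j []//]; exact: filterT.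
have HE : H [set j : I | ~ E (em j)].
  by apply: sH; exists (setT, 0%N) => [|j []//]; exact: filterT.
have emf f : bounded_continuous f -> pint (em j) (fun z => f z.1) @[j --> H] --> pint l f.
  move=> bf; have /weakP_cvgP/(_ f bf) c := ewl.
  apply: (cvg_trans _ c); apply: near_eq_cvg.
  (* The default value of [empirical] at [n = 0] is excluded, since its marginal is unrelated to
     [ew]. *)
  move: (Hn 1%N); apply: filterS => -[[//|n] [w x]] _.
  by rewrite /em /ew !pint_empirical//; exact: bc_fst.
have [m emm] := weakP_ultra_limit cozW cozWX cptX (ultra_fmap em UH) emf.
have nEm : ~ E m.
  move=> Em; have HE' : H [set j | E (em j)] by exact: (emm _ (open_nbhs_nbhs (conj oE Em))).
  by have [j [nEj]] := filter_ex (filterI HE HE').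
apply: nEm; apply: lE; split.
  apply: marginal_pint => f bf.
  have /weakP_cvgP/(_ _ (bc_fst X bf)) c := emm.
  exact: (cvg_unique (@Rhausdorff R) c (emf f bf)).
apply: (ae_optimal_limit _ emm) => z O N e oO Oz mN e0 hO.
have [s [d [bs d0 sN]]] := weakP_nbhs_pint_close mN.
have d20 : 0 < d / 2 by rewrite divr_gt0.
have Hs : H [set j | pint_close s (d / 2) m (em j)].
  by apply: emm; exact: pint_close_nbhs.
(* One deviation moves a test integral bounded by [M] by at most [2 M / n]; hence the deviated
   empirical measures enter [N] as well, uniformly in the player and the action. *)
have Hdev : H [set j | forall i y f, List.In f s ->
    `|pint (empirical R (fun k => ((projT2 j).1 k, if k == i then y else (projT2 j).2 k))) f -
      pint (em j) f| < d / 2].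
  elim: s bs {sN Hs} => [_|f s ih bs]; first by apply: filterS filterT => j _ i y f [].
  have {ih} : H [set j | forall i y f, List.In f s ->
    `|pint (empirical R (fun k => ((projT2 j).1 k, if k == i then y else (projT2 j).2 k))) f -
      pint (em j) f| < d / 2] by apply: ih => g gs; apply: bs; right.
  have bf := bs f (or_introl erefl); have [_ [M fM]] := bf.
  move: (Hn (Num.truncn (2 * M / (d / 2))).+1); apply: filterS2.
  move=> [[//|n] [w x]] /= nM hs i y g [<-|]; last exact: hs.
  apply: (le_lt_trans (pint_deviation _ _ _ _ bf fM)).
  rewrite ltr_pdivrMl ?ltr0n// -ltr_pdivrMr//.
  by apply: (lt_le_trans (truncnS_gt _)); rewrite ler_nat.
have Heps : H [set j | eps (projT1 j) < e].
  have /cvgrPdist_lt/(_ _ e0)[n0 _ hn0] := eps_cvg.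
  move: (Hn n0); apply: filterS => j /= /hn0 /=.
  by rewrite sub0r normrN; exact: le_lt_trans (ler_norm _).
have FH : Filter H := @filter_filter _ _ (@ultra_proper _ _ UH).
have H4 := @filterI _ H FH _ _ (@filterI _ H FH _ _ Hs Hdev) (@filterI _ H FH _ _ Heps Hnash).
suff : H [set j | null_open (em j) O] by [].
refine (@filterS _ H FH _ _ _ (@filterI _ H FH _ _ (Hn 1%N) H4)).
move=> -[[|n] [w x]] [//= _] [[/= hs hdev] [/= he [Cx hx]]].
(* No atom lies in [O], since its player could gain more than [e], which exceeds the tolerance. *)
move=> g bg g0 gO; rewrite pint_empirical// big1 ?mulr0// => i _.
apply: gO => /hO[/=|[y /= Cy hy]]; first by apply; exact: Cx.
have Nem : N (em (existT _ n.+1 (w, x))).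
  by apply: sN => f fs; have := hs f fs; rewrite !ltr_norml /=; lra.
have Ndev : N (empirical R (fun k => (w k, if k == i then y else x k))).
  apply: sN => f fs; have := hs f fs; have := hdev i y f fs; rewrite !ltr_norml /=; lra.
have h1 := hy _ _ Ndev Nem.
have h2 : inf [set F (empirical R (fun j => (w j, if j == i then y' else x j))) (w i) y' | y' in C (w i)]
    <= F (empirical R (fun k => (w k, if k == i then y else x k))) (w i) y.
  apply: ge_inf; last by exists y.
  have [M FM] := F_bounded; exists (- M) => _ [x' _ <-].
  by have := FM (empirical R (fun k => (w k, if k == i then x' else x k))) (w i) x';
    rewrite ler_norml => /andP[].
have := hx i; rewrite /em /= in h1 *; lra.
Qed.

End static_game.

(** * Relative entropy *)
Section entropy.
Context d (T : measurableType d) (R : realType).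
Implicit Types (l : probability T R) (f g : T -> R).

(* The Legendre pair of [x ln x - x + 1] and [exp g - 1]. *)
Lemma young_entropy (x g : R) : 0 <= x -> x * g + 1 - expR g <= x * ln x - x + 1.
Proof.
rewrite le_eqVlt => /predU1P[<-|x0].
  by rewrite !mul0r sub0r oppr0 !add0r lerBlDr lerDl expR_ge0.
have := expR_ge1Dx (g - ln x).
rewrite -(ler_pM2l x0) expRD expRN lnK ?posrE// mulrCA mulfV ?gt_eqF// mulr1.
rewrite mulrDr mulrBr mulr1; lra.
Qed.

Lemma kl_ge0 (x : R) : 0 <= x -> 0 <= x * ln x - x + 1.
Proof. by move=> /(young_entropy 0); rewrite mulr0 expR0 add0r subrr. Qed.

Section density.
Context (l l0 : probability T R) (f : T -> R) (lf : density_of l l0 f).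

Let mf : measurable_fun setT f. Proof. by have [] := lf. Qed.
Let f_ge0 x : 0 <= f x. Proof. by have [_ []] := lf. Qed.

Lemma density_integral : (\int[l0]_x (f x)%:E = 1)%E.
Proof. by have [_ [_ <-//]] := lf; exact: probability_setT. Qed.

Lemma density_integrable : l0.-integrable setT (EFin \o f).
Proof.
apply/integrableP; split; first exact/measurable_EFinP.
under eq_integral do rewrite /= ger0_norm//.
by rewrite density_integral ltry.
Qed.

Lemma bmf_density_integrable g : bmf g -> l0.-integrable setT (fun x => (g x * f x)%:E).
Proof.
move=> [mg [M gM]].
apply: (@le_integrable _ _ _ l0 _ measurableT _ (fun x => (M * f x)%:E)).
- by apply/measurable_EFinP; exact: measurable_funM.
- move=> x _ /=; rewrite lee_fin !normrM ler_wpM2r//.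
  by rewrite (le_trans (gM x))// ler_norm.
- under eq_fun do rewrite EFinM.
  by apply: integrableZl => //; exact: density_integrable.
Qed.

(** The defining property of a density settles functions of a colouring. As [f] integrates to 1,
    uniform approximation costs at most [e / 2] on either side. *)
Lemma bint_density g : bmf g -> \int[l0]_x (g x * f x) = \int[l]_x g x.
Proof.
move=> bg; have [mg [M gM]] := bg.
apply/eqP; rewrite -subr_eq0 -normr_eq0 eq_le normr_ge0 andbT.
apply/ler_addgt0Pr => e e0; rewrite add0r.
have e20 : 0 < e / 2 by rewrite divr_gt0.
have [F [c [mc cP]]] := exists_coloring1 bg e20.
have [r rP] := coloring_repr cP.
have br : bmf (fun x => r (c x)) by exact: bmf_coloring.
have rE : \int[l0]_x (r (c x) * f x) = \int[l]_x r (c x).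
  under eq_Rintegral do rewrite (coloring_sumE c r) big_distrl/=.
  rewrite bint_coloring// /Rintegral.
  under eq_integral do rewrite -sumEFin.
  rewrite integral_sum//=; last first.
    move=> t; apply: bmf_density_integrable; apply: bmfZ; exact: bmf_indic.
  rewrite (eq_bigr (fun t => (r t * fine (l (c @^-1` [set t])))%:E)) ?sumEFin//.
  move=> t _; under eq_integral do rewrite -mulrA EFinM.
  rewrite integralZl//; last by apply: bmf_density_integrable; exact: bmf_indic.
  rewrite EFinM; congr (_ * _)%E.
  have [_ [_ lE]] := lf; rewrite fineK ?fin_num_measure// lE//.
  rewrite [RHS]integral_mkcond; apply: eq_integral => x _.
  rewrite /patch indicE; case: ifP => xt; rewrite ?mul1r ?mul0r//.
have h1 := bint_close l bg br rP.
have h2 : `|\int[l0]_x (g x * f x) - \int[l0]_x (r (c x) * f x)| <= e / 2.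
  rewrite -RintegralB//; try exact: bmf_density_integrable.
  under eq_Rintegral do rewrite -mulrBl.
  have bgr : bmf (fun x => g x - r (c x)) by exact: bmfB.
  apply: (le_trans (le_normr_Rintegral _ _)) => //; first exact: bmf_density_integrable.
  under eq_Rintegral do rewrite normrM (ger0_norm (f_ge0 _)).
  have bn : bmf (fun x => `|g x - r (c x)|).
    split; first by apply: measurableT_comp => //; have [] := bgr.
    by exists (e / 2) => x; rewrite normr_id.
  apply: (@le_trans _ _ (\int[l0]_x (e / 2 * f x))).
    apply: le_Rintegral => //.
    - exact: bmf_density_integrable.
    - by apply: bmf_density_integrable; exact: bmf_cst.
    - by move=> x _; rewrite ler_wpM2r.
  by rewrite RintegralZl//; [rewrite /Rintegral density_integral mulr1|exact: density_integrable].
move: h1 h2; rewrite rE !ler_norml; lra.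
Qed.

Lemma density_ae_unique f' : density_of l l0 f' -> {ae l0, forall x, f x = f' x}.
Proof.
move=> lf'; have [mf' [_ lE']] := lf'; have [_ [_ lE]] := lf.
have : ae_eq l0 setT (EFin \o f) (EFin \o f').
  apply: integral_ae_eq => //; first exact: density_integrable.
    exact/measurable_EFinP.
  by move=> E _ mE; rewrite -lE// -lE'.
by apply: filterS => x /(_ I)[].
Qed.

Lemma measurable_xlnx (f' : T -> R) : measurable_fun setT f' -> measurable_fun setT (fun x => f' x * ln (f' x)).
Proof.
by move=> mf'; apply: measurable_funM => //; exact: measurableT_comp.
Qed.

Lemma measurable_kl : measurable_fun setT (fun x => f x * ln (f x) - f x + 1).
Proof.
apply: measurable_funD => //; apply: measurable_funB => //; exact: measurable_xlnx.
Qed.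

(** The added [1 - f] has integral 0 and makes the integrand nonnegative, so that an infinite
    entropy is covered too. The density chosen in the definition equals [f] almost everywhere. *)
Lemma relative_entropyE :
  relative_entropy l l0 = (\int[l0]_x (f x * ln (f x) - f x + 1)%:E)%E.
Proof.
rewrite /relative_entropy; case: pselect => [ex|]; last by move=> []; exists f.
case: cid => f' lf' /=; have [mf' _] := lf'.
transitivity (\int[l0]_x (f x * ln (f x))%:E)%E.
  apply: ae_eq_integral => //.
  - by apply/measurable_EFinP; exact: measurable_xlnx.
  - by apply/measurable_EFinP; exact: measurable_xlnx.
  - by have := density_ae_unique lf'; apply: filterS => x /= -> _.
pose h x : \bar R := (f x * ln (f x))%:E.
have mh : measurable_fun setT h by apply/measurable_EFinP; exact: measurable_xlnx.
have hN1 x : -1 <= f x * ln (f x).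
  by have := kl_ge0 (f_ge0 x); have := f_ge0 x; lra.
have hn1 x : (h^\-%E x <= 1)%E.
  by rewrite funenegE /h -EFinN -EFin_max lee_fin ge_max ler01 andbT; have := hN1 x; lra.
have mhn : measurable_fun setT h^\-%E by exact: measurable_funeneg.
(* As [x ln x >= -1], only the positive part can have an infinite integral. *)
have N_fin : (\int[l0]_x h^\-%E x)%E \is a fin_num.
  rewrite ge0_fin_numE; last exact: integral_ge0.
  apply: (@le_lt_trans _ _ (\int[l0]_x (1 : \bar R)))%E.
    by apply: ge0_le_integral.
  by rewrite integral_cst// mul1e [ltLHS](_ : _ = 1%E) ?ltry//; exact: probability_setT.
have int1 : (\int[l0]_x (1 : \bar R) = 1)%E.
  by rewrite integral_cst// mul1e; exact: probability_setT.
have mh1 : measurable_fun setT (fun x => (f x * ln (f x) + 1)%:E).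
  by apply/measurable_EFinP; apply: measurable_funD => //; exact: measurable_xlnx.
have e1 : (\int[l0]_x (f x * ln (f x) + 1)%:E + \int[l0]_x h^\-%E x =
    \int[l0]_x h^\+%E x + 1)%E.
  transitivity (\int[l0]_x h^\+%E x + \int[l0]_x (1 : \bar R))%E; last by rewrite int1.
  rewrite -!ge0_integralD//; first last.
  - by move=> x _; rewrite lee_fin; have := hN1 x; lra.
  - exact: measurable_funepos.
  apply: eq_integral => x _; rewrite funenegE funeposE /h -EFinN -!EFin_max -!EFinD.
  congr EFin; rewrite /Num.max; case: ifPn; case: ifPn; rewrite -?leNgt => *; lra.
have e2 : (\int[l0]_x (f x * ln (f x) + 1)%:E =
    \int[l0]_x (f x * ln (f x) - f x + 1)%:E + 1)%E.
  rewrite -density_integral -ge0_integralD//.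
  - by apply: eq_integral => x _; rewrite -EFinD; congr EFin; lra.
  - by move=> x _; rewrite lee_fin; exact: kl_ge0.
  - by apply/measurable_EFinP; exact: measurable_kl.
  - by move=> x _; rewrite lee_fin.
  - exact/measurable_EFinP.
rewrite integralE -/h; apply/esym.
rewrite -[LHS](@addeK _ (\int[l0]_x h^\-%E x)%E _)//; congr (_ - _)%E.
rewrite -[LHS](@addeK _ 1%E _)// -[RHS](@addeK _ 1%E _)//; congr (_ - _)%E.
by rewrite -e1 e2 addeAC.
Qed.

End density.

(** The integrated Young inequality. This version without logarithm is linear in [l], and it is
    optimal at [g = ln f]. *)
Lemma donsker_varadhan_le l l0 g : bmf g ->
  ((\int[l]_x g x + 1 - \int[l0]_x expR (g x))%:E <= relative_entropy l l0)%E.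
Proof.
move=> bg; have [[f lf]|nex] := pselect (exists f, density_of l l0 f); last first.
  by rewrite /relative_entropy; case: pselect => // _; rewrite leey.
have [mf [f0 _]] := lf; have [mg [M gM]] := bg.
have beg : bmf (fun x => expR (g x)).
  split; first exact: measurableT_comp.
  by exists (expR M) => x; rewrite ger0_norm ?expR_ge0// ler_expR (le_trans (ler_norm _)).
have i1 := bmf_density_integrable lf bg.
have i2 := bmf_integrable l0 (bmf_cst T (1 : R)).
have i3 := bmf_integrable l0 beg.
have i12 : l0.-integrable setT (EFin \o (fun x => g x * f x + 1)).
  exact: (integrableD measurableT i1 i2).
have i123 : l0.-integrable setT (EFin \o (fun x => g x * f x + 1 - expR (g x))).
  exact: (integrableB measurableT i12 i3).
have -> : (\int[l]_x g x + 1 - \int[l0]_x expR (g x))%:E =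
    (\int[l0]_x (g x * f x + 1 - expR (g x))%:E)%E.
  rewrite -[X in X%:E](_ : \int[l0]_x (g x * f x + 1 - expR (g x)) = _).
    by rewrite /Rintegral fineK//; exact: integrable_fin_num.
  by rewrite RintegralB// RintegralD// (bint_density lf bg) bint_cst.
rewrite (relative_entropyE lf).
have kl0 x : 0 <= f x * ln (f x) - f x + 1 by exact: kl_ge0.
have mkl : measurable_fun setT (fun x => (f x * ln (f x) - f x + 1)%:E).
  by apply/measurable_EFinP; exact: measurable_kl lf.
have [->|] := eqVneq (\int[l0]_x (f x * ln (f x) - f x + 1)%:E)%E +oo%E; first exact: leey.
rewrite -ltey => fin.
apply: le_integral => //.
  apply/integrableP; split => //.
  by under eq_integral do rewrite /= ger0_norm//.
by move=> x _; rewrite lee_fin mulrC; exact: young_entropy.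
Qed.

(** The test function is [c] times the indicator of [A], whose exponential is affine in the
    indicator. *)
Lemma entropy_event_le l l0 (a c : R) A : measurable A -> 0 < c ->
  (relative_entropy l l0 <= a%:E)%E ->
  fine (l A) <= (a + (expR c - 1) * fine (l0 A)) / c.
Proof.
move=> mA c0 la.
have bA : bmf (\1_A : T -> R) by exact: bmf_indic.
have := le_trans (donsker_varadhan_le l l0 (bmfZ c bA)) la.
have -> : (fun x => expR (c * (\1_A : T -> R) x)) = (fun x => 1 + (expR c - 1) * \1_A x).
  apply/funext => x; rewrite indicE; case: (x \in A); rewrite ?mulr1 ?mulr0 ?expR0; lra.
rewrite bintZ// bint_indic// bintD ?bintZ ?bint_cst ?bint_indic//; [|exact: bmf_cst|exact: bmfZ].
by rewrite lee_fin ler_pdivlMr//; lra.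
Qed.

Lemma bint_setwise_cvg (G : set_system (probability T R)) l g : Filter G ->
  (forall A, measurable A -> (fun m : probability T R => fine (m A)) @ G --> fine (l A)) ->
  bmf g -> (fun m : probability T R => \int[m]_x g x) @ G --> \int[l]_x g x.
Proof.
move=> FG Gl bg; apply/cvgrPdist_lt => e e0.
have e40 : 0 < e / 4 by rewrite divr_gt0.
have [F [c [mc cP]]] := exists_coloring1 bg e40.
have [r rP] := coloring_repr cP.
have br : bmf (fun x => r (c x)) by exact: bmf_coloring.
have rl : (fun m : probability T R => \int[m]_x r (c x)) @ G --> \int[l]_x r (c x).
  rewrite bint_coloring//; under eq_fun do rewrite bint_coloring//.
  by apply: cvg_sum => t; apply: cvgMr; exact: Gl.
move/cvgrPdist_lt : rl => /(_ _ e40); apply: filterS => m.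
by have := bint_close2 l m bg br rP; lra.
Qed.

(** The Donsker-Varadhan bound passes to the limit for each bounded [g]. The optimal [ln f] may be
    unbounded, so [f] is clipped to [[1 / (n + 1), n + 1]] and Fatou's lemma removes the
    clipping. *)
Lemma entropy_setwise_lsc (G : set_system (probability T R)) l l0 (a : R) f :
  ProperFilter G -> density_of l l0 f ->
  (forall A, measurable A -> (fun m : probability T R => fine (m A)) @ G --> fine (l A)) ->
  (forall b : R, a < b -> G [set m | relative_entropy m l0 <= b%:E]%E) ->
  (relative_entropy l l0 <= a%:E)%E.
Proof.
move=> PG lf Gl Ga; have [mf [f0 _]] := lf.
have DV g : bmf g -> \int[l]_x g x + 1 - \int[l0]_x expR (g x) <= a.
  move=> bg; apply/ler_addgt0Pr => e e0.
  have e40 : 0 < e / 4 by rewrite divr_gt0.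
  have /cvgrPdist_lt/(_ _ e40) Gclose := bint_setwise_cvg PG Gl bg.
  have Ge : G [set m | relative_entropy m l0 <= (a + e / 4)%:E]%E by apply: Ga; lra.
  have [m [/= hm1 hm2]] := filter_ex (filterI Gclose Ge).
  have := le_trans (donsker_varadhan_le m l0 bg) hm2; rewrite lee_fin.
  by move: hm1; rewrite ltr_norml; lra.
pose c n (x : R) := Num.min (Num.max x n.+1%:R^-1) n.+1%:R.
have n1 n : n.+1%:R^-1 <= 1 :> R by rewrite invf_le1 ?ler1n// ltr0n.
have n1' n : 1 <= n.+1%:R :> R by rewrite ler1n.
have nV0 n : 0 < n.+1%:R^-1 :> R by rewrite invr_gt0 ltr0n.
have c0 n x : 0 < c n x by rewrite /c lt_min lt_max nV0 orbT ltr0n.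
have c_bd n x : n.+1%:R^-1 <= c n x <= n.+1%:R.
  by rewrite /c le_min le_max lexx orbT/= (le_trans (n1 n) (n1' n)) ge_min lexx orbT.
have mc n : measurable_fun setT (fun x => c n (f x)).
  by apply: measurable_minr => //; exact: measurable_maxr.
have bg n : bmf (fun x => ln (c n (f x))).
  split; first exact: measurableT_comp.
  exists (ln n.+1%:R) => x; have /andP[h1 h2] := c_bd n (f x).
  by rewrite ler_norml; apply/andP; split; rewrite -?lnV ?posrE ?ltr0n// ler_ln ?posrE ?ltr0n.
pose psi n x := f x * ln (c n (f x)) + 1 - c n (f x).
(* [psi n] exceeds the nonnegative [c ln c - c + 1] by [(f - c) ln c], whose factors have the same
   sign wherever the clipping is active. *)
have psi0 n x : 0 <= psi n x.
  have h := kl_ge0 (ltW (c0 n (f x))); rewrite /psi.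
  suff : 0 <= (f x - c n (f x)) * ln (c n (f x)) by rewrite mulrBl; lra.
  have /andP[h1 h2] := c_bd n (f x).
  have [fx|fx] := ltP (f x) n.+1%:R^-1.
    have -> : c n (f x) = n.+1%:R^-1.
      by rewrite /c max_r ?ltW// min_l// (le_trans (n1 n) (n1' n)).
    by rewrite mulr_le0 ?ln_le0// subr_le0 ltW.
  have [fx'|fx'] := ltP n.+1%:R (f x).
    have -> : c n (f x) = n.+1%:R by rewrite /c max_l// min_r// ltW.
    by rewrite mulr_ge0 ?ln_ge0// subr_ge0 ltW.
  by rewrite (_ : c n (f x) = f x) ?subrr ?mul0r// /c max_l// min_l.
have mpsi n : measurable_fun setT (psi n).
  apply: measurable_funB => //; apply: measurable_funD => //; apply: measurable_funM => //.
  exact: measurableT_comp.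
have psia n : (\int[l0]_x (psi n x)%:E <= a%:E)%E.
  have i1 := bmf_density_integrable lf (bg n).
  have i2 := bmf_integrable l0 (bmf_cst T (1 : R)).
  have bc : bmf (fun x => c n (f x)).
    split => //; exists n.+1%:R => x; have /andP[_ h2] := c_bd n (f x).
    by rewrite ger0_norm// ltW.
  have i3 := bmf_integrable l0 bc.
  have i12 : l0.-integrable setT (EFin \o (fun x => ln (c n (f x)) * f x + 1)).
    exact: (integrableD measurableT i1 i2).
  have i123 : l0.-integrable setT (EFin \o (fun x => ln (c n (f x)) * f x + 1 - c n (f x))).
    exact: (integrableB measurableT i12 i3).
  have := DV _ (bg n); under [X in _ - X]eq_Rintegral do rewrite lnK ?posrE//.
  rewrite -(bint_density lf (bg n)) -(bint_cst l0 1) -RintegralD// -RintegralB//.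
  rewrite -lee_fin /Rintegral fineK; last exact: integrable_fin_num.
  by under eq_integral do rewrite mulrC.
rewrite (relative_entropyE lf).
have psik x : (psi n x)%:E @[n --> \oo] --> (f x * ln (f x) - f x + 1)%:E.
  apply: cvg_EFin; first exact: nearW.
  (* Where [f] vanishes the clipping never becomes inactive, but [psi n] is [1 - 1 / (n + 1)]. *)
  have [fx0|fx0] := eqVneq (f x) 0.
    rewrite /= fx0 mul0r subr0 add0r.
    have -> : fine \o (fun n => (psi n x)%:E) = (fun n => 1 - n.+1%:R^-1).
      apply/funext => n /=; rewrite /psi fx0 mul0r add0r /c max_r ?ltW// min_l//.
      exact: le_trans (n1 n) (n1' n).
    rewrite -[X in _ --> X](subr0 1); apply: cvgB; first exact: cvg_cst.
    exact: cvg_harmonic.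
  have fx1 : 0 < f x by rewrite lt_neqAle eq_sym fx0 f0.
  apply: cvg_near_cst; exists (maxn (Num.truncn (f x)) (Num.truncn (f x)^-1)) => // n /=.
  rewrite geq_max => /andP[h1 h2]; rewrite /psi (_ : c n (f x) = f x); first lra.
  rewrite /c max_l ?min_l//.
    by rewrite ltW// (lt_le_trans (truncnS_gt _))// ler_nat ltnS.
  rewrite invf_ple ?posrE// ltW// (lt_le_trans (truncnS_gt _))// ler_nat ltnS.
  exact: h2.
have := @fatou _ _ _ l0 setT measurableT (fun n x => (psi n x)%:E)
  (fun n => (measurable_EFinP _ _).2 (mpsi n)) (fun n x _ => psi0 n x).
under eq_integral do rewrite (cvg_limn_einf_sup (psik _)).1.
move/le_trans; apply.
rewrite limn_einf_lim; apply: lime_le; first exact: is_cvg_einfs.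
apply: nearW => n; apply: le_trans (psia n).
by apply: ereal_inf_lbound; exists n => /=.
Qed.

(* Bounded entropy gives uniform absolute continuity with respect to [l0]
   (entropy_event_le with [c] large), which makes the setwise ultralimit
   countably additive. *)
Theorem entropy_ultra_compact (G : set_system (probability T R)) l0 (a : R) :
  UltraFilter G ->
  (forall b : R, a < b -> G [set m | relative_entropy m l0 <= b%:E]%E) ->
  exists2 l, (relative_entropy l l0 <= a%:E)%E &
    forall A, measurable A -> (fun m : probability T R => fine (m A)) @ G --> fine (l A).
Proof.
move=> UG Ga.
have fin01 (m : probability T R) A : measurable A -> 0 <= fine (m A) <= 1.
  move=> mA; rewrite fine_ge0//= -lee_fin fineK ?fin_num_measure//.
  exact: probability_le1.
pose nu A : R := lim ((fun m : probability T R => fine (m A)) @ G).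
have nuP A : measurable A -> (fun m : probability T R => fine (m A)) @ G --> nu A.
  move=> mA; have [|v _ h] := @ultra_bounded_cvg R _ G (fun m : probability T R => fine (m A)) 1 UG.
    by move=> m; have := fin01 m A mA; rewrite ler_norml; lra.
  by rewrite /nu (cvg_lim _ h).
have nu_ge0 A : measurable A -> 0 <= nu A.
  move=> mA; apply: limr_ge; first by apply/cvg_ex; exists (nu A); exact: nuP.
  by apply: nearW => m; have /andP[] := fin01 m A mA.
(* [Ga] speaks only of levels above [a]; the level [a + 1] is used. *)
have nu_bound A (c : R) : measurable A -> 0 < c ->
    nu A <= ((a + 1) + (expR c - 1) * fine (l0 A)) / c.
  move=> mA c0; apply: limr_le; first by apply/cvg_ex; exists (nu A); exact: nuP.
  have : G [set m | relative_entropy m l0 <= (a + 1)%:E]%E by apply: Ga; lra.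
  by apply: filterS => m; exact: entropy_event_le.
(* [nu] is known to be a limit on measurable sets only, while [exists_probability] wants a function
   nonnegative on all sets. *)
pose mu A := if pselect (measurable A) then (nu A)%:E else 0%E.
have muE A : measurable A -> mu A = (nu A)%:E by rewrite /mu; case: pselect.
have [l lE] : exists l : probability T R, forall A, l A = mu A.
  apply: exists_probability.
  - rewrite muE//; congr EFin; apply: cvg_lim => //.
    by under eq_fun do rewrite measure0; exact: cvg_cst.
  - by move=> A; rewrite /mu; case: pselect => // mA; rewrite lee_fin; exact: nu_ge0.
  - move=> F mF tF mUF.
    pose B n := \bigcup_i F i `\` \big[setU/set0]_(i < n) F i.
    have mB n : measurable (B n) by apply: measurableD => //; exact: bigsetU_measurable.
    have split_m (m : probability T R) n :
        fine (m (\bigcup_i F i)) = \sum_(0 <= i < n) fine (m (F i)) + fine (m (B n)).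
      have sub : \big[setU/set0]_(i < n) F i `<=` \bigcup_i F i by exact: bigsetU_bigcup.
      have mS : measurable (\big[setU/set0]_(i < n) F i) by exact: bigsetU_measurable.
      have -> : \sum_(0 <= i < n) fine (m (F i)) = fine (m (\big[setU/set0]_(i < n) F i)).
        rewrite measure_bigsetU// sum_fine ?big_mkord//.
        by move=> i _; exact: fin_num_measure.
      rewrite -fineD ?fin_num_measure// -measureU//; last by rewrite /B setDIK.
      by rewrite /B setDUK.
    have split_nu n : nu (\bigcup_i F i) = \sum_(0 <= i < n) nu (F i) + nu (B n).
      apply: (cvg_unique (@Rhausdorff R) (nuP _ mUF)).
      rewrite /= (_ : (fun m : probability T R => _) = (fun m : probability T R =>
        \sum_(0 <= i < n) fine (m (F i)) + fine (m (B n)))); last first.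
        by apply/funext => m; exact: split_m.
      by apply: cvgD; [apply: cvg_sum => i; exact: nuP|exact: nuP].
    have B0 : nu (B n) @[n --> \oo] --> 0.
      have l0B : fine (l0 (B n)) @[n --> \oo] --> 0.
        apply: fine_probability_cvg0 => //.
          by move=> n x [Ux nx]; split => // h; apply: nx; rewrite big_ord_recr; left.
        apply/seteqP; split => // x h; have [[i _ Fix] _] := h 0%N I.
        have [_] := h i.+1 I; apply; rewrite big_ord_recr; right; exact: Fix.
      apply/cvgrPdist_le => e e0.
      pose b := `|a| + 1; have b0 : 0 < b by rewrite ltr_wpDl.
      (* Once [l0 (B n) <= b / expR c], both terms of the numerator in [nu_bound] are at most [b],
         and [2 b / c = e]. *)
      pose c := 2 * b / e; have c0 : 0 < c by rewrite divr_gt0// mulr_gt0.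
      have p0 : 0 < b / expR c by rewrite divr_gt0// expR_gt0.
      have /cvgrPdist_le/(_ _ p0) := l0B; apply: filterS => n.
      rewrite !sub0r !normrN ger0_norm; last by have /andP[] := fin01 l0 _ (mB n).
      rewrite ler_pdivlMr ?expR_gt0// => h.
      rewrite ger0_norm ?nu_ge0//; apply: (le_trans (nu_bound _ _ (mB n) c0)).
      rewrite ler_pdivrMr// (_ : e * c = 2 * b); last first.
        by rewrite /c mulrCA mulfV ?gt_eqF// mulr1.
      have /andP[h0 _] := fin01 l0 _ (mB n); have := ler_norm a.
      by rewrite /b in h *; nra.
    rewrite muE//.
    have -> : (fun n => \sum_(0 <= i < n) mu (F i))%E =
        (fun n => (nu (\bigcup_i F i) - nu (B n))%:E).
      apply/funext => n; rewrite (split_nu n) addrK -sumEFin.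
      by apply: eq_bigr => i _; rewrite muE.
    apply: cvg_EFin; first exact: nearW.
    rewrite -[X in _ --> X]subr0; apply: cvgB => //; exact: cvg_cst.
  - rewrite muE//; congr EFin; apply: cvg_lim => //.
    by under eq_fun do rewrite probability_setT; exact: cvg_cst.
have Gl A : measurable A -> (fun m : probability T R => fine (m A)) @ G --> fine (l A).
  by move=> mA; rewrite lE muE//=; exact: nuP.
have ll0 : l `<< l0.
  apply/null_content_dominatesP => A mA l0A; rewrite lE muE//; congr EFin.
  apply/eqP; rewrite eq_le nu_ge0// andbT; apply/ler_addgt0Pr => e e0; rewrite add0r.
  pose b := `|a| + 1; have b0 : 0 < b by rewrite ltr_wpDl.
  have c0 : 0 < b / e by rewrite divr_gt0.
  apply: (le_trans (nu_bound _ _ mA c0)); rewrite l0A mulr0 addr0 ler_pdivrMr//.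
  by rewrite mulrC divfK ?gt_eqF// lerD2r ler_norm.
(* Entropy is defined through a density, so absolute continuity has to precede lower
   semicontinuity. *)
have [f [f0 ffin fint fE]] := radon_nikodym_sigma_finite ll0.
have lf : density_of l l0 (fine \o f).
  split; first by apply: measurableT_comp => //; exact: measurable_int fint.
  split; first by move=> x; exact: fine_ge0.
  by move=> A mA; rewrite fE//; apply: eq_integral => x _; rewrite /= fineK.
by exists l => //; exact: entropy_setwise_lsc lf Gl Ga.
Qed.

(** * Entropy on a finite partition *)

Section finite_partition.
Context (F : finType) (c : T -> F).
Hypothesis mc : forall t, measurable (c @^-1` [set t]).

Lemma partition_entropy_le l l0 : (relative_entropy l l0 < +oo)%E ->
  let q t := fine (l (c @^-1` [set t])) in let p t := fine (l0 (c @^-1` [set t])) in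
  (forall t, p t = 0 -> q t = 0) /\
  ((\sum_t q t * ln (q t / p t))%:E <= relative_entropy l l0)%E.
Proof.
move=> fin q p.
have q_ge0 t : 0 <= q t by rewrite fine_ge0.
have p_ge0 t : 0 <= p t by rewrite fine_ge0.
have pq t : p t = 0 -> q t = 0.
  have [[f [mf [f0 lE]]]|nex] := pselect (exists f, density_of l l0 f); last first.
    by move: fin; rewrite /relative_entropy; case: pselect.
  move=> pt0; rewrite /q lE// null_set_integral//.
    by apply/measurable_EFinP; exact: measurable_funTS.
  exact: (etrans (esym (fineK (fin_num_measure l0 _ (mc t)))) (congr1 EFin pt0)).
split => //.
apply/lee_addgt0Pr => e e0.
(* The optimal test function is the log-density, which should be [-oo] on cells with [q t = 0]; the
   value [ln e] there adds at most [e] to the exponential integral. *)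
pose r t := if q t == 0 then ln e else ln (q t / p t).
have := donsker_varadhan_le l l0 (bmf_coloring mc r).
rewrite (bint_coloring mc) -/q (bint_coloring mc l0 (fun t => expR (r t))) -/p.
move=> h; apply: le_trans (leeD2r e%:E h); rewrite -EFinD lee_fin.
suff : \sum_t expR (r t) * p t <= 1 + e.
  have -> : \sum_t r t * q t = \sum_t q t * ln (q t / p t).
    apply: eq_bigr => t _; rewrite /r; case: eqP => [->|_]; rewrite ?mulr0 ?mul0r//.
    by rewrite mulrC.
  lra.
have <- : \sum_t q t + \sum_t e * p t = 1 + e.
  by rewrite -big_distrr/= !coloring_mass// mulr1.
rewrite -big_split/=; apply: ler_sum => t _; rewrite /r; case: eqP => [qt|/eqP qt].
  by rewrite lnK ?posrE// lerDr.
have q0 : 0 < q t by rewrite lt_neqAle eq_sym qt q_ge0.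
have p0 : 0 < p t.
  by rewrite lt_neqAle p_ge0 andbT eq_sym; apply/eqP => /pq/eqP; exact/negP.
by rewrite lnK ?posrE ?divr_gt0// divfK ?gt_eqF// lerDl mulr_ge0// ltW.
Qed.

(** The density equal to [q t / p t] on the cell [t] attains equality in the bound of
    [partition_entropy_le]. *)
Lemma exists_partition_measure l0 (q : F -> R) :
  (forall t, 0 <= q t) -> \sum_t q t = 1 ->
  (forall t, fine (l0 (c @^-1` [set t])) = 0 -> q t = 0) ->
  exists l : probability T R, (forall t, fine (l (c @^-1` [set t])) = q t) /\
    relative_entropy l l0 = (\sum_t q t * ln (q t / fine (l0 (c @^-1` [set t]))))%:E.
Proof.
move=> q0 q1 pq; pose p t := fine (l0 (c @^-1` [set t])); rewrite -/p in pq *.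
have p0 t : 0 <= p t by rewrite fine_ge0.
pose phi t := q t / p t; have phi0 t : 0 <= phi t by rewrite divr_ge0.
have bphi : bmf (fun x => phi (c x)) by exact: bmf_coloring.
have mphi : measurable_fun setT (fun x => (phi (c x))%:E).
  by apply/measurable_EFinP; have [] := bphi.
have phip t : phi t * p t = q t.
  rewrite /phi; have [pt|pt] := eqVneq (p t) 0; last by rewrite divfK.
  by rewrite pt mulr0 (pq t pt).
have [l lE] : exists l : probability T R, forall A, l A = (\int[l0]_(x in A) (phi (c x))%:E)%E.
  apply: exists_probability.
  - by rewrite integral_set0.
  - by move=> A; apply: integral_ge0 => x _; rewrite lee_fin.
  - by apply: semi_sigma_additive_nng_induced => // x; rewrite lee_fin.
  - rewrite -EFin_bint// bint_coloring//; congr EFin; rewrite -q1.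
    by apply: eq_bigr => t _; exact: phip.
have lphi : density_of l l0 (fun x => phi (c x)).
  by split; [have [] := bphi|split].
exists l; split => [t|].
  rewrite lE (eq_integral (fun=> (phi t)%:E)); last by move=> x /set_mem /= ->.
  rewrite integral_cst// [X in (_ * X)%E](_ : _ = (p t)%:E) /= ?phip//.
  by rewrite /p fineK ?fin_num_measure.
rewrite (relative_entropyE lphi).
have b2 : bmf (fun x => phi (c x) * ln (phi (c x)) - phi (c x) + 1).
  exact: (bmf_coloring mc (fun t => phi t * ln (phi t) - phi t + 1)).
rewrite -EFin_bint//; congr EFin.
rewrite (bint_coloring mc l0 (fun t => phi t * ln (phi t) - phi t + 1)) -/p.
rewrite (eq_bigr (fun t => q t * ln (q t / p t) + (p t - q t))); last first.
  move=> t _; transitivity (phi t * p t * ln (phi t) + (p t - phi t * p t)).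
    by rewrite /p; ring.
  by rewrite phip.
rewrite big_split/= sumrB q1.
by rewrite [X in _ + (X - _)](coloring_mass mc) subrr addr0.
Qed.

End finite_partition.
End entropy.

(** * The method of types *)
Section method_of_types.
Context (R : realType) (F : finType).
Implicit Types (p q g : F -> R).

(** The type of a sequence in the sense of information theory: its letter frequencies. *)
Definition type_of n (k : {ffun 'I_n -> F}) t : R := n%:R^-1 * #|[pred i | k i == t]|%:R.

Lemma sum_type n (k : {ffun 'I_n -> F}) g :
  n%:R^-1 * \sum_i g (k i) = \sum_t type_of k t * g t.
Proof.
rewrite (partition_big k predT)//= big_distrr/=; apply: eq_bigr => t _.
rewrite (eq_bigr (fun=> g t)); last by move=> i /eqP ->.
by rewrite sumr_const -[g t *+ _]mulr_natl mulrA.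
Qed.

Lemma type_of_ge0 n (k : {ffun 'I_n -> F}) t : 0 <= type_of k t.
Proof. by rewrite mulr_ge0 ?invr_ge0. Qed.

Lemma type_of_gt0 n (k : {ffun 'I_n -> F}) i : 0 < type_of k (k i).
Proof.
case: n k i => [? []//|n] k i.
rewrite mulr_gt0 ?invr_gt0// ltr0n; apply/card_gt0P; exists i.
by rewrite inE/=.
Qed.

Lemma sum_type_of n (k : {ffun 'I_n.+1 -> F}) : \sum_t type_of k t = 1.
Proof.
transitivity (\sum_t type_of k t * 1); first by apply: eq_bigr => t _; rewrite mulr1.
by rewrite -(sum_type k (fun=> 1)) sumr_const card_ord mulVf.
Qed.

Lemma prod_weight_ge0 n p (k : {ffun 'I_n -> F}) : (forall t, 0 <= p t) ->
  0 <= \prod_i p (k i).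
Proof. by move=> p0; apply: prodr_ge0 => i _. Qed.

Lemma sum_prod_weight n p : \sum_(k : {ffun 'I_n -> F}) \prod_i p (k i) = (\sum_t p t) ^+ n.
Proof. by rewrite -(bigA_distr_bigA (fun _ => p)) prodr_const card_ord. Qed.

Lemma prod_weight_ratio n p q (k : {ffun 'I_n -> F}) :
  (forall i, 0 < p (k i)) -> (forall i, 0 < q (k i)) ->
  \prod_i p (k i) = expR (- \sum_i ln (q (k i) / p (k i))) * \prod_i q (k i).
Proof.
move=> p0 q0; rewrite -sumrN expR_sum -big_split/=; apply: eq_bigr => i _.
by rewrite -lnV ?posrE ?divr_gt0// lnK ?posrE ?invr_gt0 ?divr_gt0// invf_div divfK ?gt_eqF.
Qed.

(* Sequences are grouped by type: within one type, [\prod_i q (k i)] for the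
   common type [q] is a probability weight, hence the polynomial factor. *)
Lemma sum_type_weight_le n :
  \sum_(k : {ffun 'I_n.+1 -> F}) \prod_i type_of k (k i) <= (n.+2 ^ #|F|)%:R.
Proof.
pose N (k : {ffun 'I_n.+1 -> F}) : {ffun F -> 'I_n.+2} :=
  [ffun t => inord #|[pred i | k i == t]|].
have NE k t : (N k t : nat) = #|[pred i | k i == t]|.
  by rewrite ffunE inordK// ltnS (leq_trans (max_card _))// card_ord.
pose w (M : {ffun F -> 'I_n.+2}) t : R := n.+1%:R^-1 * (M t : nat)%:R.
rewrite (partition_big N predT)//=.
have -> : (n.+2 ^ #|F|)%:R = \sum_(M : {ffun F -> 'I_n.+2}) (1 : R).
  by rewrite sumr_const card_ffun card_ord.
apply: ler_sum => M _.
have [/existsP[k0 /eqP k0M]|/existsPn h] := boolP [exists k, N k == M]; last first.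
  by rewrite big_pred0 ?ler01// => k; exact/negbTE/h.
have wE k : N k = M -> forall t, type_of k t = w M t.
  by move=> <- t; rewrite /w NE.
apply: (@le_trans _ _ (\sum_(k : {ffun 'I_n.+1 -> F}) \prod_i w M (k i))).
  rewrite [leRHS](bigID (fun k => N k == M))/= -[leLHS]addr0 lerD//.
    by apply: ler_sum => k /eqP kM; rewrite (eq_bigr _ (fun i _ => wE k kM (k i))).
  by apply: sumr_ge0 => k _; apply: prod_weight_ge0 => t; rewrite mulr_ge0 ?invr_ge0.
rewrite sum_prod_weight -(eq_bigr _ (fun t _ => wE k0 k0M t)) sum_type_of.
by rewrite expr1n.
Qed.

(** The weight of [k] under [p] is its weight under its own type times the exponential of minus
    [n.+1] relative entropies of the type. A sequence with a letter of weight 0 contributes nothing,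
    so [hB] asks for positive letters only. *)
Lemma sum_weight_entropy_le n p (a : R) (B : pred {ffun 'I_n.+1 -> F}) :
  (forall t, 0 <= p t) ->
  (forall k, B k -> (forall i, 0 < p (k i)) ->
     a <= \sum_t type_of k t * ln (type_of k t / p t)) ->
  \sum_(k | B k) \prod_i p (k i) <= (n.+2 ^ #|F|)%:R * expR (- (n.+1%:R * a)).
Proof.
move=> p0 hB.
apply: (@le_trans _ _ (\sum_(k : {ffun 'I_n.+1 -> F})
    \prod_i type_of k (k i) * expR (- (n.+1%:R * a)))); last first.
  by rewrite -big_distrl/= ler_wpM2r ?expR_ge0//; exact: sum_type_weight_le.
rewrite [leRHS](bigID B)/= -[leLHS]addr0 lerD//; last first.
  apply: sumr_ge0 => k _; rewrite mulr_ge0 ?expR_ge0//.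
  by apply: prod_weight_ge0; exact: type_of_ge0.
apply: ler_sum => k Bk.
have wk0 : 0 <= \prod_i type_of k (k i) by apply: prod_weight_ge0; exact: type_of_ge0.
have [/forallP pk|/forallPn[i]] := boolP [forall i, 0 < p (k i)]; last first.
  rewrite -leNgt => pki; rewrite (bigD1 i)//= (_ : p (k i) = 0) ?mul0r ?mulr_ge0 ?expR_ge0//.
  by apply/eqP; rewrite eq_le pki p0.
rewrite (prod_weight_ratio pk (type_of_gt0 k)) mulrC ler_wpM2l// ler_expR lerN2.
rewrite -ler_pdivlMl ?ltr0n//.
by rewrite (sum_type k (fun t => ln (type_of k t / p t))); exact: hB.
Qed.

(** * Law of large numbers and change of measure for product weights *)

Section product_weights.
Variable q : F -> R.
Hypotheses (q0 : forall t, 0 <= q t) (q1 : \sum_t q t = 1).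

(** Independence: the product weight factorizes, and a centred factor sums to 0. *)
Lemma sum_prod_weight_cross n g (i j : 'I_n) : \sum_t q t * g t = 0 ->
  \sum_(k : {ffun 'I_n -> F}) (\prod_l q (k l)) * (g (k i) * g (k j)) =
  if i == j then \sum_t q t * g t ^+ 2 else 0.
Proof.
move=> g0; pose h l t := q t * ((if l == i then g t else 1) * (if l == j then g t else 1)).
transitivity (\sum_(k : {ffun 'I_n -> F}) \prod_l h l (k l)).
  apply: eq_bigr => k _; rewrite big_split/= big_split/=; congr (_ * (_ * _)).
    by rewrite -big_mkcond big_pred1_eq.
  by rewrite -big_mkcond big_pred1_eq.
rewrite -bigA_distr_bigA (bigD1 i)//=; have [ij|ij] := eqVneq i j.
  rewrite [X in _ * X]big1 ?mulr1; first by apply: eq_bigr => t _; rewrite /h -ij eqxx expr2.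
  by move=> l /negbTE li; rewrite -[RHS]q1; apply: eq_bigr => t _; rewrite /h -ij li !mulr1.
rewrite (eq_bigr (fun t => q t * g t)) ?g0 ?mul0r// => t _.
by rewrite /h eqxx (negbTE ij) mulr1.
Qed.

Lemma sum_prod_weight_sqr n g : \sum_t q t * g t = 0 ->
  \sum_(k : {ffun 'I_n -> F}) (\prod_l q (k l)) * (\sum_i g (k i)) ^+ 2 =
  n%:R * \sum_t q t * g t ^+ 2.
Proof.
move=> g0; under eq_bigr do rewrite expr2 big_distrlr/= big_distrr/=.
rewrite exchange_big/=.
under eq_bigr => i _.
  under eq_bigr do rewrite big_distrr/=.
  rewrite exchange_big/=.
  under eq_bigr do rewrite sum_prod_weight_cross//.
  rewrite (bigD1 i)//= eqxx [X in _ + X]big1 ?addr0; last first.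
    by move=> j /negbTE ji; rewrite eq_sym ji.
  over.
by rewrite sumr_const card_ord mulr_natl.
Qed.

Lemma product_chebyshev n g (e : R) : 0 < e ->
  \sum_(k : {ffun 'I_n.+1 -> F} | e <= `|n.+1%:R^-1 * \sum_i g (k i) - \sum_t q t * g t|)
     \prod_l q (k l) <=
  (\sum_t q t * (g t - \sum_t q t * g t) ^+ 2) / e ^+ 2 / n.+1%:R.
Proof.
move=> e0; set mu := \sum_t q t * g t; pose h t := g t - mu.
have h0 : \sum_t q t * h t = 0.
  under eq_bigr do rewrite mulrBr.
  by rewrite sumrB -big_distrl/= q1 mul1r subrr.
have n0 : 0 < n.+1%:R :> R by rewrite ltr0n.
have hE (k : {ffun 'I_n.+1 -> F}) :
    n.+1%:R^-1 * \sum_i g (k i) - mu = n.+1%:R^-1 * \sum_i h (k i).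
  by rewrite sumrB sumr_const card_ord mulrBr -[mu *+ _]mulr_natl mulKf ?gt_eqF.
rewrite ler_pdivlMr// ler_pdivlMr ?exprn_gt0//.
rewrite -(ler_pM2l n0) -sum_prod_weight_sqr//.
rewrite [leRHS](bigID (fun k : {ffun 'I_n.+1 -> F} =>
  e <= `|n.+1%:R^-1 * \sum_i g (k i) - mu|))/=.
rewrite -[leLHS]addr0 lerD//; last first.
  by apply: sumr_ge0 => k _; rewrite mulr_ge0 ?sqr_ge0// prod_weight_ge0.
rewrite -mulrA mulrC -mulrA big_distrl/=; apply: ler_sum => k.
rewrite hE normrM ger0_norm ?invr_ge0// ler_pdivlMl// => ek.
rewrite ler_wpM2l ?prod_weight_ge0//.
rewrite -[leRHS]real_normK ?num_real//.
have -> : n.+1%:R * e ^+ 2 * n.+1%:R = (n.+1%:R * e) ^+ 2 by rewrite exprMn; ring.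
by rewrite lerXn2r// nnegrE ?mulr_ge0// ltW.
Qed.

(** Chebyshev for each [g] and a union bound leave an exceptional weight of at most [K / n]. Any
    constant strictly between 0 and 1 would do for exponential rates. *)
Lemma product_lln (gs : seq (F -> R)) (e : R) : 0 < e ->
  \forall n \near \oo, 2^-1 <= \sum_(k : {ffun 'I_n -> F} |
     all (fun g => `|n%:R^-1 * \sum_i g (k i) - \sum_t q t * g t| < e) gs) \prod_l q (k l).
Proof.
move=> e0; pose v g := (\sum_t q t * (g t - \sum_t q t * g t) ^+ 2) / e ^+ 2.
have v0 g : 0 <= v g.
  by rewrite divr_ge0 ?sqr_ge0//; apply: sumr_ge0 => t _; rewrite mulr_ge0 ?sqr_ge0.
pose K := \sum_(g <- gs) v g.
have bad n : 1 - K / n.+1%:R <= \sum_(k : {ffun 'I_n.+1 -> F} |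
     all (fun g => `|n.+1%:R^-1 * \sum_i g (k i) - \sum_t q t * g t| < e) gs) \prod_l q (k l).
  rewrite /K {K}; elim: gs => [|g gs ih].
    by rewrite big_nil mul0r subr0 sum_prod_weight q1 expr1n.
  rewrite big_cons mulrDl.
  set G := (X in _ <= \sum_(k | X k) _) in ih.
  have := product_chebyshev n g e0; rewrite -/(v g) => hg.
  have : \sum_(k | G k) \prod_l q (k l) <=
      \sum_(k : {ffun 'I_n.+1 -> F} |
         all (fun g => `|n.+1%:R^-1 * \sum_i g (k i) - \sum_t q t * g t| < e) (g :: gs))
         \prod_l q (k l) +
      \sum_(k : {ffun 'I_n.+1 -> F} | e <= `|n.+1%:R^-1 * \sum_i g (k i) - \sum_t q t * g t|)
         \prod_l q (k l).
    rewrite big_mkcond [X in _ <= X + _]big_mkcond [X in _ <= _ + X]big_mkcond/= -big_split/=.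
    apply: ler_sum => k _; have wk : 0 <= \prod_l q (k l) by exact: prod_weight_ge0.
    by rewrite -/(G k); case: ltP => _; case: (G k) => /=; rewrite ?addr0 ?add0r.
  have aux (S A B v1 v2 : R) : S <= A + B -> B <= v1 -> 1 - v2 <= S -> 1 - (v1 + v2) <= A by lra.
  by move=> hG; exact: aux hG hg ih.
exists (Num.truncn (2 * K)).+1 => // -[//|n] /= nK.
apply: le_trans (bad n).
have : K / n.+1%:R <= 2^-1.
  rewrite ler_pdivrMr ?ltr0n// -ler_pdivrMl ?invr_gt0// invrK.
  by rewrite ltW// (lt_le_trans (truncnS_gt _))// ler_nat.
by move: (K / n.+1%:R) => x; lra.
Qed.

(** On [B] the logarithm of the likelihood ratio of [q] to [p] is at most [n.+1] times [h + e]. *)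
Lemma product_change_measure n p (h e : R) (B : pred {ffun 'I_n.+1 -> F}) :
  (forall t, 0 <= p t) -> (forall t, p t = 0 -> q t = 0) ->
  \sum_t q t * ln (q t / p t) <= h ->
  (forall k, B k -> `|n.+1%:R^-1 * \sum_i ln (q (k i) / p (k i)) -
                      \sum_t q t * ln (q t / p t)| < e) ->
  \sum_(k | B k) \prod_i q (k i) <= expR (n.+1%:R * (h + e)) * \sum_(k | B k) \prod_i p (k i).
Proof.
move=> p0 pq hh hB; rewrite big_distrr/=; apply: ler_sum => k Bk.
have [/forallP qk|/forallPn[i]] := boolP [forall i, 0 < q (k i)]; last first.
  rewrite -leNgt => qki; rewrite (bigD1 i)//= (_ : q (k i) = 0) ?mul0r.
    by rewrite mulr_ge0 ?expR_ge0// prod_weight_ge0.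
  by apply/eqP; rewrite eq_le qki q0.
have pk i : 0 < p (k i).
  by rewrite lt_neqAle p0 andbT; apply: contraTneq (qk i) => /esym/pq ->; rewrite ltxx.
rewrite (prod_weight_ratio pk qk) mulrA -expRD ler_peMl ?prod_weight_ge0//.
rewrite -[X in X <= _]expR0 ler_expR.
rewrite subr_ge0 -ler_pdivrMl ?ltr0n//.
have aux (x s : R) : s <= h -> `|x - s| < e -> x <= h + e by rewrite ltr_norml; lra.
exact: aux hh (hB k Bk).
Qed.

End product_weights.
End method_of_types.

Lemma weakP_setwise_cvg (T : ptopologicalType) (R : realType) (H : set_system (weakP T R))
    (l : weakP T R) : Filter H ->
  (forall A : set (borel T), measurable A ->
     (fun m : probability (borel T) R => fine (m A)) @ H --> fine (l A)) -> H --> l.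
Proof.
move=> FH Hl; apply/weakP_cvgP => f bf.
exact: (bint_setwise_cvg FH Hl (bc_bmf bf)).
Qed.

(** * Empirical measures seen through a colouring *)

Section empirical_types.
Context (T : ptopologicalType) (R : realType) (F : finType) (c : borel T -> F).
Hypothesis mc : forall t, measurable (c @^-1` [set t]).

Lemma pint_close_coloring (m m' : weakP T R) (s : seq (T -> R)) (e e' : R) :
  (forall f, List.In f s -> bounded_continuous f) ->
  (forall f, List.In f s -> exists2 r : F -> R, forall x, `|f x - r (c x)| <= e &
    `|\int[m']_x r (c x) - \int[m]_x r (c x)| < e') ->
  pint_close s (2 * e + e') m m'.
Proof.
move=> bs h f fs; have [r rP hr] := h f fs.
apply: (le_lt_trans (bint_close2 m' m (bc_bmf (bs f fs)) (bmf_coloring mc r) rP)).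
by rewrite ltrD2l.
Qed.

Lemma bint_empirical_coloring n (w : 'I_n.+1 -> T) (k : {ffun 'I_n.+1 -> F}) (r : F -> R) :
  (forall i, c (w i) = k i) ->
  \int[empirical R w]_x r (c x) = \sum_t type_of R k t * r t.
Proof.
move=> wk; rewrite -(sum_type k r) (@bint_empirical T R n w (fun x => r (c x))).
  by congr (_ * _); apply: eq_bigr => i _; rewrite wk.
exact: bmf_coloring.
Qed.

End empirical_types.

(** * The law of the colours of an i.i.d. sample *)

Section iid_colors.
Context d (Omega : measurableType d) (R : realType) (P : probability Omega R)
  (V : ptopologicalType) (Y : nat -> Omega -> V) (l0 : probability (borel V) R).
Hypothesis iid : iid_law P Y l0.
Context (F : finType) (c : borel V -> F).
Hypothesis mc : forall t, measurable (c @^-1` [set t]).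

Definition colors n (o : Omega) : {ffun 'I_n -> F} := [ffun i : 'I_n => c (Y i o)].

Let measurable_preY j (A : set (borel V)) : measurable A -> measurable (Y j @^-1` A).
Proof.
by move=> mA; have [mY _ _] := iid; rewrite -[X in measurable X]setTI; exact: mY.
Qed.

Lemma colors_cell n (k : {ffun 'I_n -> F}) :
  measurable (colors n @^-1` [set k]) /\
  P (colors n @^-1` [set k]) = (\prod_i fine (l0 (c @^-1` [set k i])))%:E.
Proof.
have [mY PY indep] := iid.
(* Independence is formulated with sets indexed by all of [nat]; beyond [n] the whole space is the
   default. *)
pose A j : set (borel V) := if insub j is Some i then c @^-1` [set k i] else setT.
have mA j : measurable (A j) by rewrite /A; case: insub => [i|//].
have AE : colors n @^-1` [set k] = \bigcap_(j in [set j | j \in iota 0 n]) (Y j @^-1` A j).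
  apply/seteqP; split=> [om ko j|om h].
    rewrite /= mem_iota add0n => /= jn; rewrite /A insubT/= -ko ffunE//.
  apply/ffunP => i; rewrite ffunE.
  have := h i; rewrite /= mem_iota add0n ltn_ord => /(_ erefl).
  by rewrite /A valK.
split.
  by rewrite AE; apply: bigcap_measurableType => j _; exact: measurable_preY.
rewrite AE indep ?iota_uniq//.
have -> : iota 0 n = index_iota 0 n by rewrite /index_iota subn0.
rewrite big_mkord (eq_bigr (fun i => (fine (l0 (c @^-1` [set k i])))%:E)); last first.
  by move=> i _; rewrite PY// /A valK fineK// fin_num_measure.
by rewrite prodEFin.
Qed.

Lemma colors_law n (B : pred {ffun 'I_n -> F}) :
  measurable [set o | B (colors n o)] /\
  P [set o | B (colors n o)] = (\sum_(k | B k) \prod_i fine (l0 (c @^-1` [set k i])))%:E.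
Proof.
have mk k := (@colors_cell n k).1.
have mB : measurable [set o | B (colors n o)].
  have -> : [set o | B (colors n o)] = \bigcup_(k in [set k | B k]) (colors n @^-1` [set k]).
    by apply/seteqP; split=> [om Bo|om [k Bk /= ->]//]; exists (colors n om).
  by apply: fin_bigcup_measurable => [|k _]; [exact: finite_finset|exact: mk].
split => //; rewrite -[LHS]fineK ?fin_num_measure//; congr EFin.
rewrite -bint_indic// [RHS]big_mkcond/=.
rewrite (_ : (fun _ => _) = (fun o => (fun k => (B k)%:R) (colors n o))).
  rewrite (bint_coloring mk P (fun k => (B k)%:R)); apply: eq_bigr => k _; rewrite (@colors_cell n k).2/=.
  by case: (B k); rewrite ?mul1r ?mul0r.
apply/funext => o; rewrite indicE; congr (_ %:R); congr nat_of_bool.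
by apply/idP/idP => [/set_mem//|h]; apply/mem_set.
Qed.

End iid_colors.

(** * Exponential rates in the extended reals *)

Section exponential_rates.
Context (R : realType).
Implicit Types (u v : nat -> \bar R) (a : R).

Lemma limn_esup_le u (l : \bar R) : (\forall n \near \oo, (u n <= l)%E) -> (limn_esup u <= l)%E.
Proof.
move=> h; apply: (@le_trans _ _ (ereal_sup (u @` [set n | (u n <= l)%E]))).
  by apply: ereal_inf_lbound; exists [set n | (u n <= l)%E].
by apply: ub_ereal_sup => _ [n un <-].
Qed.

Lemma le_limn_einf u (l : \bar R) : (\forall n \near \oo, (l <= u n)%E) -> (l <= limn_einf u)%E.
Proof.
move=> h; rewrite leeNr; apply: limn_esup_le.
by move: h; apply: filterS => n; rewrite leeN2.
Qed.

Lemma poly_expR_le (k : nat) (e : R) : 0 < e ->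
  \forall n \near \oo, (n.+2 ^ k)%:R <= expR (n.+1%:R * e).
Proof.
move=> e0; pose d : R := e / (2 * k.+1%:R).
have k0 : 0 < k.+1%:R :> R by rewrite ltr0n.
have d0 : 0 < d by rewrite divr_gt0// mulr_gt0.
have ln_le (x : R) : 0 < x -> ln x <= d * x - ln d.
  move=> x0; have := ln_sublinear (mulr_gt0 d0 x0); rewrite lnM ?posrE//; lra.
pose N := 2 / e * (k%:R * (d - ln d)).
exists (Num.truncn N) => // n /= nN.
have n0 : 0 < n.+2%:R :> R by rewrite ltr0n.
rewrite natrX -[leLHS]lnK ?posrE ?exprn_gt0// ler_expR lnXn//.
rewrite -[_ *+ k]mulr_natl.
apply: (@le_trans _ _ (k%:R * (d * n.+2%:R - ln d))).
  by rewrite ler_wpM2l// ln_le.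
have h1 : k%:R * d <= e / 2.
  have -> : k%:R * d = e / 2 * (k%:R / k.+1%:R).
    by rewrite /d invfM; move: (k.+1%:R^-1) => x; ring.
  by rewrite ler_piMr ?(ltW (divr_gt0 _ _))// ler_pdivrMr// mul1r ler_nat.
have h2 : k%:R * (d - ln d) <= n.+1%:R * (e / 2).
  have : N < n.+1%:R by rewrite (lt_le_trans (truncnS_gt _))// ler_nat ltnS.
  rewrite /N -[2 / e]invf_div ltr_pdivrMl ?divr_gt0// [X in _ < X]mulrC => /ltW.
  by [].
rewrite -[n.+2]addn1 natrD.
have -> : k%:R * (d * (n.+1%:R + 1) - ln d) = n.+1%:R * (k%:R * d) + k%:R * (d - ln d) by ring.
by rewrite [X in _ <= _ * X]splitr [leRHS]mulrDr lerD// ler_wpM2l.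
Qed.

Lemma rate_le n (x : \bar R) b : (0 <= x)%E -> (x <= (expR (n.+1%:R * b))%:E)%E ->
  ((n.+1%:R^-1)%:E * lne x <= b%:E)%E.
Proof.
move=> x0 xb; apply: (@le_trans _ _ ((n.+1%:R^-1)%:E * lne (expR (n.+1%:R * b))%:E)%E).
  apply: lee_wpmul2l; first by rewrite lee_fin invr_ge0.
  by rewrite lee_lne// in_itv/= ?x0 ?leey// lee_fin expR_ge0.
by rewrite lne_EFin ?expR_gt0// expRK -EFinM mulKf.
Qed.

Lemma rate_ge n (x : \bar R) b : ((expR (n.+1%:R * b))%:E <= x)%E ->
  (b%:E <= (n.+1%:R^-1)%:E * lne x)%E.
Proof.
move=> bx; apply: (@le_trans _ _ ((n.+1%:R^-1)%:E * lne (expR (n.+1%:R * b))%:E)%E).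
  by rewrite lne_EFin ?expR_gt0// expRK -EFinM mulKf.
apply: lee_wpmul2l; first by rewrite lee_fin invr_ge0.
have e0 : (0 <= (expR (n.+1%:R * b))%:E)%E by rewrite lee_fin expR_ge0.
by rewrite lee_lne// in_itv/= ?leey ?e0// (le_trans e0).
Qed.

(** The infimum of the rate may be [+oo], so the upper bound is proved for every real [a] below
    it. *)
Lemma le_oppe_of_lt (x y : \bar R) :
  (forall a : R, (a%:E < y)%E -> (x <= (- a)%:E)%E) -> (x <= - y)%E.
Proof.
case: y => [y| |] h; last by rewrite leey.
- apply/lee_addgt0Pr => e e0; have := h (y - e); rewrite lte_fin ltrBlDr ltrDl => /(_ e0).
  by rewrite opprB addrC EFinD EFinN.
- case: x h => [x| |] h; last by rewrite leNye.
    by have := h (1 - x)%R; rewrite ltry lee_fin => /(_ isT) hx; exfalso; lra.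
  by have := h 0%R; rewrite ltry leye_eq => /(_ isT).
Qed.

End exponential_rates.

Lemma closedSet_ext (T : topologicalType) (A B : closedSet T) : cs_set A = cs_set B -> A = B.
Proof.
case: A B => [A cA] [B cB] /= AB; case: _ / AB cB => cB.
by congr ClosedSet; exact: Prop_irrelevance.
Qed.

Lemma all_In T (p : pred T) s x : all p s -> List.In x s -> p x.
Proof. by elim: s => //= y s ih /andP[py ps] [<-//|]; exact: ih. Qed.

(** * The large deviation bounds *)
Section large_deviations.
Context (R : realType) (W : completePseudoMetricType R) (X : pseudoPMetricType R).
Hypothesis sepW : exists D : set W, countable D /\ dense D.
Hypothesis cptX : compact [set: X].
Variable C : W -> set X.
Hypothesis C_ne : forall w, C w !=set0.
Hypothesis C_graph : closed [set z : W * X | C z.1 z.2].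
Hypothesis C_lower : forall (ws : nat -> W) (w0 : W) (x0 : X),
  ws @ \oo --> w0 -> C w0 x0 ->
  exists (phi : nat -> nat) (xs : nat -> X),
    [/\ {homo phi : k l / (k < l)%N}, (forall k, C (ws (phi k)) (xs k)) & xs @ \oo --> x0].
Variable F : weakP (W * X)%type R -> W -> X -> R.
Hypothesis F_bounded : exists M : R, forall m w x, `|F m w x| <= M.
Hypothesis F_cont : continuous (fun p : (weakP (W * X)%type R * W * X)%type => F p.1.1 p.1.2 p.2).
Variable eps : nat -> R.
Hypothesis eps_cvg : eps @ \oo --> 0.
Context (d : measure_display) (Omega : measurableType d) (P : probability Omega R).
Variable lambda0 : probability (borel W) R.
Variable Ws : nat -> Omega -> W.
Hypothesis Ws_iid : iid_law P Ws lambda0.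

Let NS n (w : 'I_n -> W) : closedSet (weakP (W * X)%type R) :=
  ClosedSet (@closed_closure _ (nash_set C F (eps n) w)).
Let ME (l : weakP W R) : closedSet (weakP (W * X)%type R) :=
  ClosedSet (@closed_MFE R W X sepW cptX C C_ne C_graph C_lower F F_bounded F_cont l).
Let J := rateJ C F lambda0.
Let Z n : Omega -> closedSet (weakP (W * X)%type R) := nash_random_set C F eps Ws n.

Let J_ME l : (J (ME l) <= relative_entropy l lambda0)%E.
Proof. by apply: ereal_inf_lbound; exists l. Qed.

(** The ultrafilter on closed sets is lifted to type laws [l] of entropy near or below [a], where a
    setwise limit exists; upper hemicontinuity carries the convergence back to [ME l]. *)
Lemma rateJ_compact (a : R) : compact [set A | (J A <= a%:E)%E].
Proof.
rewrite compact_ultra => G UG GJ.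
pose D := [set Ab : set (closedSet (weakP (W * X)%type R)) * R | G Ab.1 /\ a < Ab.2].
pose B (Ab : set (closedSet (weakP (W * X)%type R)) * R) :=
  [set l : weakP W R | (relative_entropy l lambda0 <= Ab.2%:E)%E /\ Ab.1 (ME l)].
have FF : Filter (filter_from D B).
  apply: filter_from_filter; first by exists (setT, a + 1); split; [exact: filterT|rewrite /= ltrDl].
  move=> [A b] [A' b'] [/= GA ab] [/= GA' ab']; exists (A `&` A', Num.min b b').
    by split; [exact: filterI|rewrite /= lt_min ab].
  move=> l [/= lb [Al A'l]]; split; split => //; apply: (le_trans lb).
    by rewrite lee_fin ge_min lexx.
  by rewrite lee_fin ge_min lexx orbT.
have PF : ProperFilter (filter_from D B).
  apply: filter_from_proper => // -[A b] [/= GA ab].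
  have [s [As Js]] := filter_ex (filterI GA GJ).
  (* The infimum defining [J s] is not known to be attained, hence the levels [b > a]. *)
  have /ereal_inf_lt[_ [l ml <-] lb] : (J s < b%:E)%E by rewrite (le_lt_trans Js) ?lte_fin.
  exists l; split; first exact: ltW.
  by rewrite (_ : ME l = s)//; exact: closedSet_ext.
have [H [UH sH]] := ultraFilterLemma PF.
have [|l la Hl] := @entropy_ultra_compact _ (borel W) R H lambda0 a UH.
  move=> b ab; apply: sH; exists (setT, b); first by split => //; exact: filterT.
  by move=> l [].
have FH : Filter H := @filter_filter _ _ (@ultra_proper _ _ UH).
have Hwl : H --> (l : weakP W R) by exact: weakP_setwise_cvg.
exists (ME l); split; first exact: le_trans (J_ME l) la.
move=> U mU; have [E [oE mE EU]] := closedSet_nbhs mU.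
have [//|GU] := in_ultra_setVsetC U UG.
have h1 : H [set l' | ~ U (ME l')].
  apply: sH; exists (~` U, a + 1); first by split => //=; rewrite ltrDl.
  by move=> l' [].
have h2 : H [set l' | MFE C F l' `<=` E].
  exact: (Hwl _ (MFE_uhc sepW cptX C_ne C_graph C_lower F_bounded F_cont oE mE)).
have [l' [nU l'E]] := filter_ex (@filterI _ H FH _ _ h1 h2).
by exfalso; apply: nU; exact: EU.
Qed.

Let closure_nash n (w : 'I_n -> W) E : open E -> nash_set C F (eps n) w `<=` E ->
  cs_set (NS w) `<=` E.
Proof.
move=> oE wE.
exact/(closure_nash_setP cptX C_ne C_graph C_lower F_bounded F_cont (eps n) w oE).
Qed.

(** Countability is found on the side of the types: the preimage of an open set is open in the type
    vector by [nash_set_uhc], hence a countable union of boxes from the base of [W]. *)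
Lemma measurable_nash_random_set n :
  measurable_fun setT (Z n : Omega -> borel (closedSet (weakP (W * X)%type R))).
Proof.
apply: (@measurability _ _ Omega (borel (closedSet (weakP (W * X)%type R))) setT
  (Z n) (@open _) erefl) => _ [U oU <-]; rewrite setTI.
have [V [oV bV]] := separable_basis_seq sepW.
pose box (k : {ffun 'I_n -> nat}) := \bigcap_(i in [set: 'I_n]) (Ws i @^-1` V (k i)).
pose D := [set k : {ffun 'I_n -> nat} |
  forall w : 'I_n -> W, (forall i, V (k i) (w i)) -> U (NS w)].
have -> : Z n @^-1` U = \bigcup_(k in D) box k.
  apply/seteqP; split => [om Uom|om [k Dk ko]]; last by apply: Dk => i; exact: ko.
  have [E [oE ZE EU]] := closedSet_nbhs (open_nbhs_nbhs (conj oU Uom)).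
  have [Q [Qw QE]] := nash_set_uhc cptX C_ne C_graph C_lower F_bounded F_cont oE
    (subset_trans (@subset_closure _ _) ZE).
  have /choice[k kP] : forall i : 'I_n, exists m, V m (Ws i om) /\ V m `<=` Q i.
    move=> i; have := Qw i; rewrite nbhsE => -[Q' [oQ' Q'w] QQ'].
    have [m [Vm mQ']] := bV _ _ oQ' Q'w.
    by exists m; split => //; exact: subset_trans QQ'.
  exists [ffun i => k i]; last by move=> i _; rewrite /= ffunE; exact: (kP i).1.
  move=> w Vw; apply: EU; apply: closure_nash => //; apply: QE => i; apply: (kP i).2.
  by have := Vw i; rewrite ffunE.
rewrite bigcup_mkcond; apply: countable_bigcupT_measurable => [|k]; first exact: countableP.
case: ifP => // _; apply: fin_bigcap_measurable => [|i _]; first exact: finite_finset.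
have [mW _ _] := Ws_iid; rewrite -[X in measurable X]setTI; apply: mW => //.
exact: open_borel.
Qed.

Let measurable_preZ n (U : set (closedSet (weakP (W * X)%type R))) :
  measurable (U : set (borel (closedSet (weakP (W * X)%type R)))) -> measurable (Z n @^-1` U).
Proof.
by move=> mU; rewrite -[X in measurable X]setTI; exact: measurable_nash_random_set.
Qed.

(* Compactness of the entropy ball makes the separation uniform in [l], so that
   only finitely many test functions matter in the upper bound. *)
Lemma entropy_ball_far (U : set (closedSet (weakP (W * X)%type R))) (a : R) :
  (a%:E < ereal_inf (J @` closure U))%E ->
  exists (s : seq (W -> R)) (r : R) n0,
    [/\ forall f, List.In f s -> bounded_continuous f, 0 < r &
     forall n (w : 'I_n -> W) (l : weakP W R), (n0 <= n)%N -> U (NS w) ->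
       (relative_entropy l lambda0 <= a%:E)%E -> ~ pint_close s r l (empirical R w)].
Proof.
move=> aU; apply: contrapT => h.
pose I := (weakP W R * {n : nat & 'I_n -> W})%type.
pose ew (j : I) : weakP W R := empirical R (projT2 j.2).
pose D := [set srn : seq (W -> R) * R * nat |
  (forall f, List.In f srn.1.1 -> bounded_continuous f) /\ 0 < srn.1.2].
pose B (srn : seq (W -> R) * R * nat) := [set j : I | [/\ (srn.2 <= projT1 j.2)%N,
  U (NS (projT2 j.2)), (relative_entropy j.1 lambda0 <= a%:E)%E &
  pint_close srn.1.1 srn.1.2 j.1 (ew j)]].
have FF : Filter (filter_from D B).
  apply: filter_from_filter; first by exists ([::], 1, 0%N); split => //=.
  move=> [[s r] n] [[s' r'] n'] [/= bs r0] [/= bs' r0'].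
  exists (s ++ s', Num.min r r', maxn n n').
    by split=> [f /List.in_app_iff[/bs|/bs']//|]; rewrite /= lt_min r0.
  move=> j [/=]; rewrite geq_max => /andP[h1 h2] h3 h4 h5; split; split => // f fs.
    have := h5 f; rewrite lt_min => /(_ _)/andP[|//]; apply/List.in_app_iff; by left.
  have := h5 f; rewrite lt_min => /(_ _)/andP[|//]; apply/List.in_app_iff; by right.
have PF : ProperFilter (filter_from D B).
  apply: filter_from_proper => // -[[s r] n0] [/= bs r0]; apply: contrapT => hB; apply: h.
  exists s, r, n0; split => // n w l n0n Uw la ls; apply: hB.
  by exists (l, existT _ n w).
have [H [UH sH]] := ultraFilterLemma PF.
have FH : Filter H := @filter_filter _ _ (@ultra_proper _ _ UH).
have D0 : D ([::], 1, 0%N) by split.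
have [|l la Hl] := @entropy_ultra_compact _ (borel W) R _ lambda0 a
    (ultra_fmap (fun j : I => j.1) UH).
  move=> b ab; suff : H [set j | (relative_entropy j.1 lambda0 <= b%:E)%E] by [].
  apply: sH; exists ([::], 1, 0%N) => // j [_ _ ja _].
  by apply: (le_trans ja); rewrite lee_fin ltW.
have Hwl : (fun j : I => j.1) @ H --> (l : weakP W R) by exact: weakP_setwise_cvg.
have ewl : ew @ H --> (l : weakP W R).
  apply/weakP_cvgP => f bf.
  have /weakP_cvgP/(_ f bf) c := Hwl.
  apply/cvgrPdist_lt => e e0; have e20 : 0 < e / 2 by rewrite divr_gt0.
  move/cvgrPdist_lt : c => /(_ _ e20) c.
  have c' : H [set j | `|pint (ew j) f - pint j.1 f| < e / 2].
    apply: sH; exists ([:: f], e / 2, 0%N); first by split => // g [<-|].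
    by move=> j [_ _ _]; apply; left.
  suff : H [set j | `|pint l f - pint (ew j) f| < e] by [].
  have c'' : H [set j | `|pint l f - pint j.1 f| < e / 2] by exact: c.
  move: (@filterI _ H FH _ _ c' c''); apply: filterS => j [/=].
  by rewrite !ltr_norml; lra.
(* [ME l] has rate at most [a], below the infimum over the closure of [U]. *)
suff cl : closure U (ME l).
  have : (ereal_inf (J @` closure U) <= a%:E)%E.
    apply: le_trans (le_trans (J_ME l) la); apply: ereal_inf_lbound.
    by exists (ME l).
  by rewrite leNgt aU.
move=> N mN; have [E [oE mE EN]] := closedSet_nbhs mN.
have [V [n0 [lV VE]]] := nash_set_near_MFE sepW cptX C_ne C_graph C_lower F_bounded F_cont
  eps_cvg oE mE.
have HV : H [set j | V (ew j)] by exact: ewl.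
have HU : H [set j | (n0 <= projT1 j.2)%N /\ U (NS (projT2 j.2))].
  by apply: sH; exists ([::], 1, n0) => // j [].
have [j [Vj [nj Uj]]] := filter_ex (@filterI _ H FH _ _ HV HU).
exists (NS (projT2 j.2)); split => //; apply: EN; apply: closure_nash => //; exact: VE.
Qed.

(** [B] collects the colour sequences compatible with [U]. If the type of one of them had entropy
    below [a], the cellwise constant measure of that type would lie in the entropy ball and close to
    an empirical measure, against [far]. *)
Let upper_rate (U : set (closedSet (weakP (W * X)%type R))) (a e : R) :
  measurable (U : set (borel (closedSet (weakP (W * X)%type R)))) ->
  (a%:E < ereal_inf (J @` closure U))%E -> 0 < e ->
  \forall n \near \oo, ((n%:R^-1)%:E * lne (P (Z n @^-1` U)) <= (e - a)%:E)%E.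
Proof.
move=> mU /entropy_ball_far[s [r [n0 [bs r0 far]]]] e0.
have r40 : 0 < r / 4 by rewrite divr_gt0.
have [T [c [mc cP]]] := @exists_coloring _ (borel W) R s _ (fun f fs => bc_bmf (bs f fs)) r40.
pose p t := fine (lambda0 (c @^-1` [set t])).
have p0 t : 0 <= p t by rewrite fine_ge0.
pose B n (k : {ffun 'I_n -> T}) := `[< exists w : 'I_n -> W, U (NS w) /\ forall i, c (w i) = k i >].
have bound n : (n0 <= n.+1)%N ->
    (P (Z n.+1 @^-1` U) <= ((n.+2 ^ #|T|)%:R * expR (- (n.+1%:R * a)))%:E)%E.
  move=> n0n; have [mB PB] := colors_law Ws_iid mc (@B n.+1).
  apply: (@le_trans _ _ (P [set o | B n.+1 (colors Ws c n.+1 o)])).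
    apply: le_measure; [apply/mem_set; exact: measurable_preZ|exact/mem_set|].
    move=> om Uom; apply/asboolP; exists (fun i => Ws i om); split => // i.
    by rewrite ffunE.
  rewrite PB lee_fin; apply: (sum_weight_entropy_le p0) => k /asboolP[w [Uw wk]] pk.
  rewrite leNgt; apply/negP => lt_a.
  have pq t : p t = 0 -> type_of R k t = 0.
    move=> pt; rewrite /type_of eq_card0 ?mulr0// => i; rewrite !inE.
    by apply/negP => /eqP kit; have := pk i; rewrite -/(p _) kit pt ltxx.
  have [l [lq lH]] := exists_partition_measure mc (type_of_ge0 R k) (sum_type_of R k) pq.
  apply: (far _ w l) => //; first by rewrite lH lee_fin ltW.
  (* A test is within [r / 4] of a function of the colour, under each measure; the coloured
     integrals agree exactly, with [r / 2] to spare. *)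
  have -> : r = 2 * (r / 4) + r / 2 by lra.
  apply: (pint_close_coloring mc) => // f fs.
  have [q qP] := coloring_repr (cP f fs); exists q => //.
  rewrite (bint_empirical_coloring mc _ wk) bint_coloring//.
  under [X in _ - X]eq_bigr do rewrite lq mulrC.
  by rewrite subrr normr0 divr_gt0.
have [n1 _ h1] := poly_expR_le #|T| e0.
(* The shift is needed because [poly_expR_le] is indexed by the predecessor of the number of
   players. *)
exists (maxn n0 n1).+1 => // -[//|n] /=; rewrite ltnS geq_max => /andP[n0n n1n].
apply: rate_le => //; apply: (le_trans (bound n (leqW n0n))).
rewrite lee_fin mulrBr expRD ler_wpM2r ?expR_ge0//.
exact: h1.
Qed.

Lemma ldp_upper_bound (U : set (closedSet (weakP (W * X)%type R))) :
  measurable (U : set (borel (closedSet (weakP (W * X)%type R)))) ->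
  (limn_esup (fun n => (n%:R^-1)%:E * lne (P (Z n @^-1` U))) <= - ereal_inf (J @` closure U))%E.
Proof.
move=> mU; apply: le_oppe_of_lt => a aU; apply/lee_addgt0Pr => e e0.
by apply: limn_esup_le; rewrite -EFinD addrC; exact: upper_rate.
Qed.

(** Under the cell weights [q] of [l] the event [B] has weight at least [2^-1], and on it the
    equilibria lie in [E]. Returning to [lambda0] costs the exponential of [n (h + e / 2)], since by
    [partition_entropy_le] the partition entropy is at most [h]. *)
Let lower_rate (U : set (closedSet (weakP (W * X)%type R))) (l : weakP W R) (h e : R) :
  measurable (U : set (borel (closedSet (weakP (W * X)%type R)))) ->
  interior U (ME l) -> relative_entropy l lambda0 = h%:E -> 0 < e ->
  \forall n \near \oo, ((- (h + e))%:E <= (n%:R^-1)%:E * lne (P (Z n @^-1` U)))%E.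
Proof.
move=> mU /closedSet_nbhs[E [oE lE EU]] lh e0.
have [V [n0 [lV VE]]] := nash_set_near_MFE sepW cptX C_ne C_graph C_lower F_bounded F_cont
  eps_cvg oE lE.
have [s [r [bs r0 sV]]] := weakP_nbhs_pint_close lV.
have r40 : 0 < r / 4 by rewrite divr_gt0.
have [T [c [mc cP]]] := @exists_coloring _ (borel W) R s _ (fun f fs => bc_bmf (bs f fs)) r40.
have [|pq] := partition_entropy_le mc (l := l) (l0 := lambda0); first by rewrite lh ltry.
pose p t := fine (lambda0 (c @^-1` [set t])); pose q t := fine (l (c @^-1` [set t])).
rewrite lh lee_fin => qh.
have p0 t : 0 <= p t by rewrite fine_ge0.
have q0 t : 0 <= q t by rewrite fine_ge0.
have q1 : \sum_t q t = 1 by exact: coloring_mass.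
have /choice[rep repP] : forall f : W -> R, exists g : T -> R,
    List.In f s -> forall x, `|f x - g (c x)| <= r / 4.
  move=> f; have [fs|nfs] := pselect (List.In f s); last by exists (fun=> 0).
  by have [g gP] := coloring_repr (cP f fs); exists g.
(* [r / 2] keeps the empirical measure in [V], and [e / 2] controls the log-likelihood ratio, which
   is the first function in the list. *)
pose t0 := Num.min (r / 2) (e / 2).
have t00 : 0 < t0 by rewrite lt_min !divr_gt0.
have [n1 _ hn1] := product_lln q0 q1 ((fun t => ln (q t / p t)) :: map rep s) t00.
have e20 : 0 < e / 2 by rewrite divr_gt0.
(* With exponent 1 this gives [2 <= n.+2 <= expR (n.+1 (e / 2))], so the other half of [e] absorbs
   the factor [2^-1]. *)
have [n2 _ hn2] := poly_expR_le 1 e20.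
exists (maxn n0 (maxn n1 n2)).+1 => // -[//|n] /=.
rewrite ltnS !geq_max => /and3P[n0n n1n n2n].
pose B (k : {ffun 'I_n.+1 -> T}) :=
  all (fun g : T -> R => `|n.+1%:R^-1 * \sum_i g (k i) - \sum_t q t * g t| < t0)
    ((fun t => ln (q t / p t)) :: map rep s).
have hB : 2^-1 <= \sum_(k | B k) \prod_i q (k i) := hn1 n.+1 (leqW n1n).
have [mB PB] := colors_law Ws_iid mc B.
apply: rate_ge; apply: (@le_trans _ _ (P [set o | B (colors Ws c n.+1 o)])); last first.
  apply: le_measure; [exact/mem_set|apply/mem_set; exact: measurable_preZ|].
  move=> om; rewrite /= /B /= => /andP[_]; rewrite all_map => Bom.
  apply: EU; apply: closure_nash => //; apply: VE; first exact: leqW.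
  apply: sV; have -> : r = 2 * (r / 4) + r / 2 by lra.
  apply: (pint_close_coloring mc) => // f fs; exists (rep f); first exact: repP.
  rewrite (bint_empirical_coloring mc (k := colors Ws c n.+1 om)); last by move=> i; rewrite ffunE.
  rewrite bint_coloring// -(sum_type _ (rep f)).
  under [X in _ - X]eq_bigr do rewrite mulrC.
  apply: lt_le_trans (all_In Bom fs) _.
  by rewrite ge_min lexx.
rewrite PB lee_fin.
have := product_change_measure (h := h) (e := e / 2) (B := B) q0 p0 pq qh.
move=> /(_ _)/(le_trans hB); set S := (X in _ <= _ * X).
have h2 : 2 <= expR (n.+1%:R * (e / 2)).
  by apply: le_trans (hn2 n n2n); rewrite expn1 ler_nat.
have -> : n.+1%:R * - (h + e) = - (n.+1%:R * (e / 2)) - n.+1%:R * (h + e / 2) by lra.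
move=> hS; rewrite expRD.
rewrite [X in _ * X]expRN ler_pdivrMr ?expR_gt0// [leRHS]mulrC.
apply: le_trans (hS _).
  by rewrite expRN lef_pV2 ?posrE ?expR_gt0.
move=> k /andP[hk _]; apply: (lt_le_trans hk).
by rewrite ge_min lexx orbT.
Qed.

Lemma ldp_lower_bound (U : set (closedSet (weakP (W * X)%type R))) :
  measurable (U : set (borel (closedSet (weakP (W * X)%type R)))) ->
  (- ereal_inf (J @` interior U) <= limn_einf (fun n => (n%:R^-1)%:E * lne (P (Z n @^-1` U))))%E.
Proof.
move=> mU; rewrite leeNl; apply: le_ereal_inf_tmp => _ [A UA <-].
apply: le_ereal_inf_tmp => _ [l lA <-].
have {UA} Ul : interior U (ME l) by rewrite (_ : ME l = A)//; exact: closedSet_ext.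
case lh : (relative_entropy l lambda0) => [h| |]; last 2 first.
- exact: leey.
(* Entropy is never [-oo], as the test function 0 gives a real lower bound. *)
- by have := donsker_varadhan_le l lambda0 (bmf_cst _ 0); rewrite lh leeNy_eq.
apply/lee_addgt0Pr => e e0; rewrite leeNl -EFinD -EFinN.
apply: le_limn_einf; exact: (lower_rate mU Ul lh e0).
Qed.

End large_deviations.

Theorem theorem3p6
  (R : realType)
  (* W : complete separable metric space *)
  (W : completePseudoMetricType R)
  (hW : hausdorff_space W)
  (sepW : exists D : set W, countable D /\ dense D)
  (* X : compact metric space *)
  (X : pseudoPMetricType R)
  (hX : hausdorff_space X)
  (cptX : compact [set: X])
  (* the constraint correspondence C *)
  (C : W -> set X)
  (C_ne : forall w, C w !=set0)
  (C_closed : forall w, closed (C w))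
  (C_graph : closed [set z : W * X | C z.1 z.2])
  (C_lower : forall (ws : nat -> W) (w0 : W) (x0 : X),
      ws @ \oo --> w0 -> C w0 x0 ->
      exists (phi : nat -> nat) (xs : nat -> X),
        [/\ {homo phi : k l / (k < l)%N},
            (forall k, C (ws (phi k)) (xs k)) &
            xs @ \oo --> x0])
  (* the cost F : P(W x X) x W x X -> R, bounded continuous *)
  (F : weakP (W * X)%type R -> W -> X -> R)
  (F_bounded : exists M : R, forall m w x, `|F m w x| <= M)
  (F_cont : continuous (fun p : (weakP (W * X)%type R * W * X)%type =>
                           F p.1.1 p.1.2 p.2))
  (* existence of exact Nash equilibria *)
  (nash_ex : forall (n : nat) (w : 'I_n -> W),
      exists x : 'I_n -> X, eps_nash C F 0 w x)
  (* epsilon_n >= 0, epsilon_n -> 0 *)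
  (eps : nat -> R)
  (eps_ge0 : forall n, 0 <= eps n)
  (eps_cvg : eps @ \oo --> 0)
  (* i.i.d. sequence W_1, W_2, ... with law lambda0 *)
  (d : measure_display) (Omega : measurableType d) (P : probability Omega R)
  (lambda0 : probability (borel W) R)
  (Ws : nat -> Omega -> W)
  (Ws_iid : iid_law P Ws lambda0) :
  LDP P (nash_random_set C F eps Ws) (rateJ C F lambda0).
Proof.
split.
- exact: (@rateJ_compact R W X sepW cptX C C_ne C_graph C_lower F F_bounded F_cont lambda0).
- exact: (@measurable_nash_random_set R W X sepW cptX C C_ne C_graph C_lower F F_bounded F_cont
    eps d Omega P lambda0 Ws Ws_iid).
- exact: (@ldp_upper_bound R W X sepW cptX C C_ne C_graph C_lower F F_bounded F_cont
    eps eps_cvg d Omega P lambda0 Ws Ws_iid).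
- exact: (@ldp_lower_bound R W X sepW cptX C C_ne C_graph C_lower F F_bounded F_cont
    eps eps_cvg d Omega P lambda0 Ws Ws_iid).
Qed.
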